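(* Assume that there exists $\delta\in(0,1)$ such that $\mathbb{E}|\xi_1|^{4(1+\delta)}<\infty$, and that the bandwidth satisfies $b=b_T\in[cT^{-h},CT^{-h}]$ with $\frac14<h<\frac34-\frac{1}{2(1+\delta)}$, where $c,C$ are positive constants. Then under $H_0$: $a_1=\dots=a_p=0$, $$(\hat a_1,\dots,\hat a_p)'=\arg\min_{a_1,\dots,a_p}\sum_{t=p+1}^T\left(X_t^2-\hat d_t-\sum_{j=1}^pa_j\left(X_{t-j}^2-\hat d_{t-j}\right)\right)^2$$ satisfies, as $T\to\infty$, $$T\sum_{j=1}^p\max(\hat a_j,0)^2\longrightarrow\sigma^2\sum_{j=1}^p\max(Z_j,0)^2$$ in distribution, where $Z=(Z_1,\dots,Z_p)$ is a standard Gaussian vector and $$\sigma^2=\frac{\int_0^1\mathrm{Var}\left(X_0(u)^2\right)^2du}{\left(\int_0^1\mathrm{Var}\left(X_0(u)^2\right)du\right)^2}.$$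
   Context: Let $p\ge1$ and let $(\xi_t)_{t\in\mathbb{Z}}$ be i.i.d. real random variables with mean $0$ and variance $1$. The model is the time-varying ARCH model with constant lag coefficients $a_1,\dots,a_p\ge0$: for each $T\ge p+1$, $X_t=\xi_t\sqrt{a_0(t/T)+\sum_{j=1}^pa_jX_{t-j}^2}$, where $a_0:[0,1]\to\mathbb{R}$ is positive and Lipschitz continuous and $\sum_{j=1}^pa_j<1$. Under $H_0$, $X_t=\sqrt{a_0(t/T)}\,\xi_t$ for $1\le t\le T$. For $u\in[0,1]$, $(X_t(u))_{t\in\mathbb{Z}}$ denotes the stationary ARCH process with noise $\xi$ and coefficients $a_0(u),a_1,\dots,a_p$ (so under $H_0$, $X_0(u)=\sqrt{a_0(u)}\,\xi_0$). $K$ is a kernel (probability density), absolutely continuous with support $[-1,1]$; $k_{t,i}(b)=K\left(\frac{t-i}{Tb}\right)\Big/\sum_{j=p+1}^TK\left(\frac{t-j}{Tb}\right)$; and $\hat d_t=\sum_{i=p+1}^Tk_{t,i}(b)X_i^2$ (estimator of $\mathbb{E}X_t^2$), $1\le t\le T$. *)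

(* Defs.v *)
From HB Require Import structures.
From mathcomp Require Import all_boot all_order all_algebra.
From mathcomp Require Import all_classical all_reals all_analysis.
From mathcomp Require Import measurable_realfun.

Set Implicit Arguments.
Unset Strict Implicit.
Unset Printing Implicit Defensive.

Import Order.TTheory GRing.Theory Num.Theory.
Import numFieldNormedType.Exports.

Local Open Scope classical_set_scope.
Local Open Scope ring_scope.

Section probability_notions.
Context (d : measure_display) (Omega : measurableType d) (R : realType)
  (P : probability Omega R).

Definition mutually_independent (I : eqType) (X : I -> {RV P >-> R}) : Prop :=
  forall (s : seq I) (B : I -> set R), uniq s ->
    (forall i, measurable (B i)) ->
    P (\big[setI/setT]_(i <- s) (X i @^-1` B i)) =
    (\prod_(i <- s) P (X i @^-1` B i))%E.

Definition identically_distributed (I : Type) (X : I -> {RV P >-> R}) : Prop :=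
  forall (i j : I) (B : set R), measurable B ->
    distribution P (X i) B = distribution P (X j) B.

Definition iid (I : eqType) (X : I -> {RV P >-> R}) : Prop :=
  mutually_independent X /\ identically_distributed X.

(* Measurable rectangles determine the finite-dimensional distributions. *)
Definition strictly_stationary (X : int -> {RV P >-> R}) : Prop :=
  forall (s : seq int) (B : int -> set R) (h : int), uniq s ->
    (forall t, measurable (B t)) ->
    P (\big[setI/setT]_(t <- s) (X (t + h) @^-1` B t)) =
    P (\big[setI/setT]_(t <- s) (X t @^-1` B t)).

Definition standard_gaussian_vector (p : nat) (Z : 'I_p -> {RV P >-> R}) :
    Prop :=
  mutually_independent Z /\
  forall (j : 'I_p) (B : set R), measurable B ->
    distribution P (Z j) B = normal_prob (0 : R) 1 B.

End probability_notions.
Arguments mutually_independent {d Omega R} P {I} X.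
Arguments identically_distributed {d Omega R} P {I} X.
Arguments iid {d Omega R} P {I} X.
Arguments strictly_stationary {d Omega R} P X.
Arguments standard_gaussian_vector {d Omega R} P {p} Z.

Definition cvg_in_distribution (R : realType)
    (d : measure_display) (Omega : measurableType d) (P : probability Omega R)
    (d' : measure_display) (Omega' : measurableType d')
    (P' : probability Omega' R)
    (Y : nat -> {RV P >-> R}) (Y0 : {RV P' >-> R}) : Prop :=
  forall x : R, {for x, continuous (cdf Y0)} ->
    cdf (Y n) x @[n --> \oo] --> cdf Y0 x.
Arguments cvg_in_distribution {R d Omega} P {d' Omega'} P' Y Y0.

Section positive_part.
Context (d : measure_display) (Omega : measurableType d) (R : realType)
  (p : nat).

Definition scaled_pos_sqnorm (c : R) (V : 'I_p -> {mfun Omega >-> R}) :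
    Omega -> R :=
  fun w => c * \sum_(j < p) Num.max (V j w) 0 ^+ 2.

Lemma measurable_scaled_pos_sqnorm (c : R) (V : 'I_p -> {mfun Omega >-> R}) :
  measurable_fun [set: Omega] (scaled_pos_sqnorm c V).
Proof.
apply: measurable_funM => //; apply: measurable_sum => j.
by apply: measurable_funX; apply: measurable_maxr.
Qed.

HB.instance Definition _ (c : R) (V : 'I_p -> {mfun Omega >-> R}) :=
  isMeasurableFun.Build _ _ _ _ (scaled_pos_sqnorm c V)
    (measurable_scaled_pos_sqnorm c V).

End positive_part.

Section kernels.
Context (R : realType).

(* On the whole line; the conditions on s say that it lists finitely many
   non-overlapping intervals [I.1, I.2]. *)
Definition abs_continuous (f : R -> R) : Prop :=
  forall e : R, 0 < e -> exists2 r : R, 0 < r &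
    forall s : seq (R * R),
      all (fun I => I.1 <= I.2) s ->
      pairwise (fun I J => (I.2 <= J.1) || (J.2 <= I.1)) s ->
      \sum_(I <- s) (I.2 - I.1) < r ->
      \sum_(I <- s) `|f I.2 - f I.1| < e.

Definition probability_density (K : R -> R) : Prop :=
  [/\ measurable_fun [set: R] K, forall x, 0 <= K x
    & (\int[lebesgue_measure]_x (K x)%:E = 1)%E].

Definition smoothing_kernel (K : R -> R) : Prop :=
  [/\ probability_density K, abs_continuous K
    & closure [set x | K x != 0] = `[-1, 1]%classic].

End kernels.

Section tvARCH_model.
Context (d : measure_display) (Omega : measurableType d) (R : realType)
  (P : probability Omega R) (p : nat).

(* X T t is the t-th variable of the array for sample size T; the lag index
   j : 'I_p stands for the lag j.+1. *)
Definition tvARCH (a0 : R -> R) (a : 'I_p -> R) (xi : int -> Omega -> R)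
    (X : nat -> int -> Omega -> R) : Prop :=
  forall (T : nat) (t : int) (w : Omega), (p < T)%N -> 1 <= t <= T%:Z ->
    X T t w = xi t w * Num.sqrt (a0 (t%:~R / T%:R) +
      \sum_(j < p) a j * X T (t - j.+1%:Z) w ^+ 2).

Definition stationary_ARCH (c0 : R) (a : 'I_p -> R)
    (xi Y : int -> {RV P >-> R}) : Prop :=
  strictly_stationary P Y /\
  forall (t : int) (w : Omega),
    Y t w = xi t w * Num.sqrt (c0 +
      \sum_(j < p) a j * Y (t - j.+1%:Z) w ^+ 2).

End tvARCH_model.
Arguments stationary_ARCH {d Omega R} P {p} c0 a xi Y.

(* Sample quantities, as functions of an observed path x. *)
Section least_squares.
Context (R : realType) (K : R -> R) (p T : nat) (b : R).

Definition kernel_weight (t i : int) : R :=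
  K ((t - i)%:~R / (T%:R * b)) /
  \sum_(p.+1 <= j < T.+1) K ((t - j%:Z)%:~R / (T%:R * b)).

Definition d_hat (x : int -> R) (t : int) : R :=
  \sum_(p.+1 <= i < T.+1) kernel_weight t i%:Z * x i%:Z ^+ 2.

Definition ls_loss (x : int -> R) (a : 'I_p -> R) : R :=
  \sum_(p.+1 <= t < T.+1)
    (x t%:Z ^+ 2 - d_hat x t%:Z -
     \sum_(j < p) a j *
       (x (t%:Z - j.+1%:Z) ^+ 2 - d_hat x (t%:Z - j.+1%:Z))) ^+ 2.

Definition ls_argmin (x : int -> R) (a : 'I_p -> R) : Prop :=
  forall a' : 'I_p -> R, ls_loss x a <= ls_loss x a'.

End least_squares.

Section limit_variance.
Context (d : measure_display) (Omega : measurableType d) (R : realType)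
  (P : probability Omega R).

Definition var_sq (Xu : R -> int -> {RV P >-> R}) (u : R) : R :=
  fine 'V_P[fun w => Xu u 0 w ^+ 2].

Definition sigma2 (Xu : R -> int -> {RV P >-> R}) : R :=
  (\int[lebesgue_measure]_(u in `[0, 1]) (var_sq Xu u ^+ 2)) /
  (\int[lebesgue_measure]_(u in `[0, 1]) (var_sq Xu u)) ^+ 2.

End limit_variance.
Arguments var_sq {d Omega R} P Xu u.
Arguments sigma2 {d Omega R} P Xu.

(* Main.v *)
Require Import Defs.
From HB Require Import structures.
From mathcomp Require Import all_boot all_order all_algebra.
From mathcomp Require Import all_classical all_reals all_analysis.
From mathcomp Require Import measurable_realfun.
From mathcomp Require Import ring lra zify.

Set Implicit Arguments.
Unset Strict Implicit.
Unset Printing Implicit Defensive.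

Import Order.TTheory GRing.Theory Num.Theory.
Import numFieldNormedType.Exports.

Local Open Scope classical_set_scope.
Local Open Scope ring_scope.

(* Under the null hypothesis X_t^2 = m_t + m_t zeta_t with m_t = a0 (t / T) and
   zeta_t = xi_t^2 - 1, so that X_t^2 - d_hat_t is the innovation m_t zeta_t minus a
   bias of order b and a kernel average of innovations of variance of order 1 / (T b).
   As sqrt T b^2 and 1 / (sqrt T b) tend to 0, both corrections are negligible in the
   normal equations: the Gram matrix divided by T tends to v \int a0^2 times the
   identity, with v = E zeta^2, and sqrt T ahat_j is asymptotically
   T^(-1/2) sum_t m_t m_(t-j) zeta_t zeta_(t-j) / (v \int a0^2).

   The lagged products are not independent, but Lindeberg's replacement method still
   applies to functions prod_j q_j (w_j): one replaces the summand at time t by a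
   Gaussian, expanding the second-order term around the partial sum stopped before the
   last p observations. Such products span an algebra; composing a smooth version of
   sum_j max (w_j, 0)^2 with the polynomials (1 - y^n)^N that approximate a step
   function then gives the convergence of the distribution functions. *)

(** * Expectations and independence *)

(** The form of the replacement argument is dictated by one fact: given the past, the summand at
    time t has as covariance a random matrix with entries proportional to zeta_(t-i) zeta_(t-j), and
    only its mean is diagonal. The mean can be taken once the second-derivative factor no longer
    sees these lags, and increments of order T^(-1/2) make the step back a third-order error. This
    presupposes bounded increments, whereas zeta is unbounded; hence a truncation whose L2 error is
    uniform in T.

    Test functions are products because Gaussian smoothing then acts on one factor at a time:
    smoothed functions keep their bounds, and only the one-dimensional normal law has to be studied.

    As a0 is merely Lipschitz, the bias is of order b and not b^2. It is harmless because its linear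
    effect is a centred sum of variance O(b^2), without any factor sqrt T; only its square is
    multiplied by sqrt T. The noise of the kernel average has to be paired with the innovations as a
    quadratic form, since Cauchy-Schwarz would only give a bound of order b^(-1/2). *)

Section expectation.
Context (d : measure_display) (Omega : measurableType d) (R : realType)
  (P : probability Omega R).

Definition meas (f : Omega -> R) := measurable_fun [set: Omega] f.
Definition L1 (f : Omega -> R) := P.-integrable [set: Omega] (EFin \o f).
(** A total real-valued expectation, so that real arithmetic applies to it directly. It is the
    [fine] part of the extended integral, hence meaningful only together with [L1]. *)
Definition Ex (f : Omega -> R) : R := \int[P]_w f w.

Lemma L1_meas f : L1 f -> meas f.
Proof. by move=> /integrableP[/measurable_EFinP]. Qed.

Lemma L1_cst c : L1 (fun=> c).
Proof. exact: finite_measure_integrable_cst. Qed.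

Lemma L1_le f g : meas f -> L1 g -> (forall w, `|f w| <= g w) -> L1 f.
Proof.
move=> mf ig fg; apply: (le_integrable measurableT _ _ ig).
  exact/measurable_EFinP.
by move=> w _ /=; rewrite lee_fin (le_trans (fg w))// ler_norm.
Qed.

Lemma L1_bounded f C : meas f -> (forall w, `|f w| <= C) -> L1 f.
Proof. by move=> mf fC; apply: (L1_le mf (L1_cst C)). Qed.

Lemma L1D f g : L1 f -> L1 g -> L1 (fun w => f w + g w).
Proof. by move=> lf lg; apply: (integrableD measurableT lf lg). Qed.

Lemma L1Zl c f : L1 f -> L1 (fun w => c * f w).
Proof. by move=> lf; apply: (integrableZl measurableT c lf). Qed.

Lemma L1N f : L1 f -> L1 (fun w => - f w).
Proof.
by move=> /(L1Zl (-1)); congr L1; apply/funext => w; rewrite mulN1r.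
Qed.

Lemma L1B f g : L1 f -> L1 g -> L1 (fun w => f w - g w).
Proof. by move=> lf lg; apply: L1D => //; apply: L1N. Qed.

Lemma L1_norm f : L1 f -> L1 (fun w => `|f w|).
Proof. exact: integrable_norm. Qed.

Lemma L1_sum (I : Type) (r : seq I) (Q : pred I) (F : I -> Omega -> R) :
  (forall i, Q i -> L1 (F i)) -> L1 (fun w => \sum_(i <- r | Q i) F i w).
Proof.
move=> lF; elim: r => [|i r IH].
  by under eq_fun do rewrite big_nil; apply: L1_cst.
under eq_fun do rewrite big_cons; case Qi: (Q i) => //.
by apply: L1D => //; apply: lF.
Qed.

Lemma eq_Ex f g : (forall w, f w = g w) -> Ex f = Ex g.
Proof. by move=> fg; congr Ex; apply/funext. Qed.

Lemma Ex_cst c : Ex (fun=> c) = c.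
Proof. by rewrite /Ex Rintegral_cst//= probability_setT mulr1. Qed.

Lemma ExD f g : L1 f -> L1 g -> Ex (fun w => f w + g w) = Ex f + Ex g.
Proof. by move=> lf lg; rewrite /Ex RintegralD. Qed.

Lemma ExZl c f : L1 f -> Ex (fun w => c * f w) = c * Ex f.
Proof. by move=> lf; rewrite /Ex RintegralZl. Qed.

Lemma ExB f g : L1 f -> L1 g -> Ex (fun w => f w - g w) = Ex f - Ex g.
Proof. by move=> lf lg; rewrite /Ex RintegralB. Qed.

Lemma Ex_sum (I : Type) (r : seq I) (Q : pred I) (F : I -> Omega -> R) :
  (forall i, Q i -> L1 (F i)) ->
  Ex (fun w => \sum_(i <- r | Q i) F i w) = \sum_(i <- r | Q i) Ex (F i).
Proof.
move=> lF; elim: r => [|i r IH].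
  by rewrite big_nil; under eq_Ex do rewrite big_nil; rewrite Ex_cst.
rewrite big_cons; under eq_Ex do rewrite big_cons; case Qi: (Q i) => //.
by rewrite ExD ?IH//; [exact: lF|exact: L1_sum].
Qed.

Lemma Ex_ge0 f : (forall w, 0 <= f w) -> 0 <= Ex f.
Proof. by move=> f0; apply: Rintegral_ge0 => w _. Qed.

Lemma le_Ex f g : L1 f -> L1 g -> (forall w, f w <= g w) -> Ex f <= Ex g.
Proof. by move=> lf lg fg; apply: le_Rintegral. Qed.

Lemma le_norm_Ex f : L1 f -> `|Ex f| <= Ex (fun w => `|f w|).
Proof. by move=> lf; apply: le_normr_Rintegral. Qed.

Lemma Ex_norm_le f C : meas f -> (forall w, `|f w| <= C) -> `|Ex f| <= C.
Proof.
move=> mf fC; have lf := L1_bounded mf fC.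
rewrite (le_trans (le_norm_Ex lf))// -[leRHS]Ex_cst.
by apply: le_Ex => //; [exact: L1_norm|exact: L1_cst].
Qed.

Lemma EFin_Ex f : L1 f -> (Ex f)%:E = (\int[P]_w (f w)%:E)%E.
Proof. by move=> lf; rewrite /Ex /Rintegral fineK// integrable_fin_num. Qed.

Lemma expectation_Ex f : ('E_P[f] = \int[P]_w (f w)%:E)%E.
Proof. by rewrite unlock. Qed.

Lemma Ex_indic A : measurable A -> Ex \1_A = fine (P A).
Proof. by move=> mA; rewrite /Ex /Rintegral integral_indic// setIT. Qed.

Lemma Ex_lim (f : nat -> Omega -> R) g F :
  (forall n, meas (f n)) -> meas F -> L1 g ->
  (forall w, f n w @[n --> \oo] --> F w) ->
  (forall n w, `|f n w| <= g w) ->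
  Ex (f n) @[n --> \oo] --> Ex F.
Proof.
move=> mf mF lg fF fg.
have [iF _ cF] : [/\ P.-integrable [set: Omega] (EFin \o F),
    ([sequence \int[P]_x `|(EFin \o f n) x - (EFin \o F) x|]_n @ \oo --> 0)%E &
    ([sequence \int[P]_x (EFin \o f n) x]_n @ \oo --> \int[P]_x (EFin \o F) x)%E].
  apply: (@dominated_convergence _ _ _ P _ measurableT _ _ (EFin \o g)) => //.
  - by move=> n; apply/measurable_EFinP; exact: mf.
  - exact/measurable_EFinP.
  - by apply: aeW => w _; apply: cvg_EFin; [exact: nearW|exact: fF].
  - by apply: aeW => w n _ /=; rewrite lee_fin fg.
rewrite /Ex /Rintegral; apply: fine_cvg; rewrite fineK//.
exact: integrable_fin_num.
Qed.

End expectation.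

Definition mfun_of d d' (T : measurableType d) (T' : measurableType d')
  (f : T -> T') (mf : measurable_fun [set: T] f) : {mfun T >-> T'} :=
  HB.pack f (isMeasurableFun.Build _ _ _ _ f mf).

Section independence.
Context (d : measure_display) (Omega : measurableType d) (R : realType)
  (P : probability Omega R).

(** The law of the pair is the product of the laws, since both agree on rectangles; Fubini's theorem
    then factors the integral of |xy|, which gives integrability, and that of xy. *)
Lemma Ex_mul_indep (f g : Omega -> R) : meas f -> meas g ->
  (forall A B, measurable A -> measurable B ->
    P (f @^-1` A `&` g @^-1` B) = (P (f @^-1` A) * P (g @^-1` B))%E) ->
  L1 P f -> L1 P g ->
  L1 P (fun w => f w * g w) /\ Ex P (fun w => f w * g w) = Ex P f * Ex P g.
Proof.
move=> mf mg fg lf lg.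
pose F := mfun_of mf; pose G := mfun_of mg.
have mFG : measurable_fun [set: Omega] (fun w => (f w, g w)).
  exact: measurable_fun_pair.
pose FG := mfun_of mFG.
pose muF := distribution P F; pose muG := distribution P G.
pose muFG := distribution P FG.
have E A : measurable A -> (muF \x muG)%E A = muFG A.
  by apply: product_measure_unique => B C mB mC; rewrite -fg.
pose h (z : R * R) := (z.1 * z.2)%:E.
have mh : measurable_fun [set: R * R] h.
  apply/measurable_EFinP; apply: measurable_funM.
    exact: measurable_fst.
  exact: measurable_snd.
have iF : muF.-integrable [set: R] EFin.
  by apply: integrable_pushforward => //; exact: EFin_measurable.
have iG : muG.-integrable [set: R] EFin.
  by apply: integrable_pushforward => //; exact: EFin_measurable.
have EF : (\int[muF]_x x%:E = (Ex P f)%:E)%E.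
  by rewrite EFin_Ex// integral_distribution//; exact: EFin_measurable.
have EG : (\int[muG]_x x%:E = (Ex P g)%:E)%E.
  by rewrite EFin_Ex// integral_distribution//; exact: EFin_measurable.
have ih : (muF \x muG)%E.-integrable [set: R * R] h.
  apply/integrable12ltyP => //.
  have -> : (\int[muF]_x \int[muG]_y `|h (x, y)| =
      (\int[muF]_x `|x%:E|) * (\int[muG]_y `|y%:E|))%E.
    rewrite -ge0_integralZr//; last exact: integral_ge0.
      apply: eq_integral => x _; rewrite -ge0_integralZl//.
        by apply: eq_integral => y _; rewrite /h /= normrM EFinM.
      by apply: measurableT_comp => //; exact: EFin_measurable.
    by apply: measurableT_comp => //; exact: EFin_measurable.
  rewrite lte_mul_pinfty//.
  - exact: integral_ge0.
  - by apply: integrable_fin_num => //; exact: integrable_abse iF.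
  - by have /integrableP[_] := iG.
have ih' : muFG.-integrable [set: R * R] h.
  apply/integrableP; split=> //.
  rewrite (eq_measure_integral (muF \x muG)%E)//; last by move=> A mA _; first [exact: E|apply: esym; exact: E].
  by have /integrableP[] := ih.
have lfg : L1 P (fun w => f w * g w).
  apply/integrableP; split; first exact/measurable_EFinP/measurable_funM.
  have /integrableP[_] := ih'.
  by rewrite ge0_integral_distribution//; exact: measurableT_comp.
split=> //; apply: EFin_inj; rewrite EFin_Ex//.
transitivity (\int[muFG]_z h z)%E; first by rewrite integral_distribution.
rewrite (eq_measure_integral (muF \x muG)%E)//; last by move=> A mA _; first [exact: E|apply: esym; exact: E].
rewrite -integral12_prod_meas1//.
transitivity (\int[muF]_x (x%:E * (Ex P g)%:E))%E.
  apply: eq_integral => x _; rewrite -EG -integralZl//.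
by rewrite integralZr// EF EFinM.
Qed.

Variables (I : choiceType) (X : I -> {RV P >-> R}).

Definition rects (s : seq I) : set (set Omega) :=
  [set A | exists B : I -> set R, (forall i, measurable (B i)) /\
    A = \big[setI/setT]_(i <- s) (X i @^-1` B i)].

(* The sigma-algebra generated by the X i for i in s. *)
Definition past (s : seq I) := g_sigma_algebraType (rects s).

Definition adapted s (f : Omega -> R) :=
  measurable_fun [set: past s] (f : past s -> R).

Lemma rects_measurable s : rects s `<=` measurable.
Proof.
move=> _ [B [mB ->]]; apply: bigsetI_measurable => i _.
exact: measurable_funPTI.
Qed.

Lemma adapted_meas s f : adapted s f -> meas f.
Proof.
move=> af _ B mB; have := af measurableT B mB.
rewrite !setTI => mfB.
by apply: (smallest_sub _ (@rects_measurable s)) mfB; exact: sigma_algebra_measurable.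
Qed.

Lemma adapted_X s i : i \in s -> adapted s (X i).
Proof.
move=> si _ B mB; rewrite setTI; apply: sub_sigma_algebra.
exists (fun j => if j == i then B else setT); split.
  by move=> j; case: ifP.
apply/seteqP; split=> w.
  move=> Xw; rewrite -bigcap_seq => j /= _.
  by have [->|//] := eqVneq j i.
by rewrite -bigcap_seq => /(_ _ si) /=; rewrite eqxx.
Qed.

Lemma adapted_comp s i (g : R -> R) : i \in s -> measurable_fun setT g ->
  adapted s (g \o X i).
Proof. by move=> si mg; apply: measurableT_comp => //; exact: adapted_X. Qed.

Lemma rects_setI s : setI_closed (rects s).
Proof.
move=> _ _ [B [mB ->]] [C [mC ->]]; exists (fun i => B i `&` C i); split.
  by move=> i; apply: measurableI.
by rewrite -big_split/=; apply: eq_bigr => i _; rewrite preimage_setI.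
Qed.

Hypothesis indepX : mutually_independent P X.

(** Both sides are finite measures in [A] that agree on the pi-system [rects s], hence on the
    sigma-algebra that it generates. *)
Lemma past_indep s k A (B : set R) : uniq (k :: s) -> measurable B ->
  <<s rects s >> A -> P (A `&` X k @^-1` B) = (P A * P (X k @^-1` B))%E.
Proof.
move=> ks mB sA.
have mXB : measurable (X k @^-1` B) by exact: measurable_funPTI.
pose c : {nonneg R} := NngNum (fine_ge0 (measure_ge0 P (X k @^-1` B))).
have cE : (c%:num%:E = P (X k @^-1` B))%E.
  by rewrite fineK// fin_num_measure.
pose m1 : {measure set Omega -> \bar R} := mrestr P mXB.
pose m2 : {measure set Omega -> \bar R} := mscale c P.
have m1E C : m1 C = P (C `&` X k @^-1` B) by [].
have m2E C : m2 C = (P (X k @^-1` B) * P C)%E by rewrite /m2 /= /mscale cE.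
rewrite -m1E muleC -m2E.
apply: (@g_sigma_algebra_measure_unique _ _ _ (rects s) (@rects_measurable s)
  (fun=> setT)) => //.
- move=> _; exists (fun=> setT); split=> //.
  by rewrite big1// => i _; rewrite preimage_setT.
- by rewrite bigcup_const//; exists 0%N.
- exact: rects_setI.
- move=> _ [C [mC ->]]; rewrite m1E m2E.
  (* Independence is applied to the family equal to [B] at [k] and to [C] elsewhere; as [k] is not
     in [s], it coincides with [C] on [s]. *)
  have kC i : i \in s -> (if i == k then B else C i) = C i.
    by move=> si; case: eqP => // ik; move: ks; rewrite /= -ik si.
  have mC' i : measurable (if i == k then B else C i) by case: ifP.
  have := indepX ks mC'; rewrite !big_cons eqxx setIC.
  rewrite big_seq [in X in _ = (_ * X)%E]big_seq.
  under eq_bigr => i si do rewrite kC//.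
  under [in X in _ = X]eq_bigr => i si do rewrite kC//.
  rewrite -!big_seq => ->; congr (_ * _)%E.
  by rewrite (indepX (andP ks).2 mC).
- by move=> _; rewrite m1E setTI -ge0_fin_numE// fin_num_measure.
Qed.

(** Plays the role of conditioning on the past: a factor determined by the variables in [s] splits
    off from a function of the fresh variable [X k]. *)
Lemma Ex_mul_past s k f (g : R -> R) : uniq (k :: s) -> adapted s f ->
  measurable_fun setT g -> L1 P f -> L1 P (g \o X k) ->
  L1 P (fun w => f w * g (X k w)) /\
  Ex P (fun w => f w * g (X k w)) = Ex P f * Ex P (g \o X k).
Proof.
move=> ks af mg lf lg; apply: Ex_mul_indep => //.
- exact: adapted_meas af.
- exact: L1_meas lg.
move=> A B mA mB; rewrite comp_preimage; apply: (@past_indep s k (f @^-1` A) (g @^-1` B) ks).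
- by rewrite -[_ @^-1` _]setTI; exact: mg.
- by have := af measurableT A mA; rewrite setTI.
Qed.

End independence.

(** * Square integrability and convergence in probability *)

Section square_integrable.
Context (d : measure_display) (Omega : measurableType d) (R : realType)
  (P : probability Omega R).
Implicit Types f g : Omega -> R.

Definition L2 f := meas f /\ L1 P (fun w => f w ^+ 2).

Lemma L2_bounded f C : meas f -> (forall w, `|f w| <= C) -> L2 f.
Proof.
move=> mf fC; split=> //; apply: (@L1_bounded _ _ _ _ _ (C ^+ 2)).
  exact: measurable_funX.
by move=> w; rewrite normrX lerXn2r ?nnegrE ?normr_ge0// (le_trans _ (fC w)).
Qed.

Lemma L2_cst c : L2 (fun=> c).
Proof. by split; [exact: measurable_cst|exact: L1_cst]. Qed.

Lemma L2_mul f g : L2 f -> L2 g -> L1 P (fun w => f w * g w).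
Proof.
move=> [mf lf] [mg lg]; apply: (L1_le _ (L1D lf lg)).
  exact: measurable_funM.
move=> w; rewrite ler_norml; apply/andP; split; nra.
Qed.

Lemma L2_L1 f : L2 f -> L1 P f.
Proof.
by move=> /L2_mul /(_ (L2_cst 1)); congr L1; apply/funext => w; rewrite mulr1.
Qed.

Lemma L2D f g : L2 f -> L2 g -> L2 (fun w => f w + g w).
Proof.
move=> lf lg; split; first exact: measurable_funD lf.1 lg.1.
have : L1 P (fun w => f w ^+ 2 + (2 * (f w * g w) + g w ^+ 2)).
  apply: L1D lf.2 _; apply: L1D lg.2; apply: L1Zl; exact: L2_mul.
by congr L1; apply/funext => w; ring.
Qed.

Lemma L2Zl c f : L2 f -> L2 (fun w => c * f w).
Proof.
move=> lf; split; first by apply: measurable_funM => //; exact: lf.1.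
by under eq_fun do rewrite exprMn; apply: L1Zl lf.2.
Qed.

Lemma L2B f g : L2 f -> L2 g -> L2 (fun w => f w - g w).
Proof.
move=> lf /(L2Zl (-1)) lg; under eq_fun do rewrite -mulN1r.
exact: L2D.
Qed.

Lemma L2_sum (I : Type) (r : seq I) (Q : pred I) (F : I -> Omega -> R) :
  (forall i, Q i -> L2 (F i)) -> L2 (fun w => \sum_(i <- r | Q i) F i w).
Proof.
move=> lF; elim: r => [|i r IH].
  by under eq_fun do rewrite big_nil; apply: L2_cst.
under eq_fun do rewrite big_cons; case Qi: (Q i) => //.
by apply: L2D => //; apply: lF.
Qed.

Lemma L1_sqr f : L2 f -> L1 P (fun w => f w ^+ 2).
Proof. by case. Qed.

Lemma Ex_sqr_ge0 f : 0 <= Ex P (fun w => f w ^+ 2).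
Proof. by apply: Ex_ge0 => w; exact: sqr_ge0. Qed.

Lemma Ex_sqrD f g : L2 f -> L2 g ->
  Ex P (fun w => (f w + g w) ^+ 2) =
  Ex P (fun w => f w ^+ 2) + 2 * Ex P (fun w => f w * g w) +
  Ex P (fun w => g w ^+ 2).
Proof.
move=> lf lg; rewrite -ExZl; last exact: L2_mul.
rewrite -ExD; [|exact: L1_sqr|by apply: L1Zl; exact: L2_mul].
rewrite -ExD; last exact: L1_sqr.
  by apply: eq_Ex => w; ring.
by apply: L1D; [exact: L1_sqr|apply: L1Zl; exact: L2_mul].
Qed.

Lemma Ex_sqrD_le f g : L2 f -> L2 g ->
  Ex P (fun w => (f w + g w) ^+ 2) <=
  2 * Ex P (fun w => f w ^+ 2) + 2 * Ex P (fun w => g w ^+ 2).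
Proof.
move=> lf lg; rewrite -!ExZl -?ExD; try by [apply: L1_sqr|apply: L1Zl; exact: L1_sqr].
apply: le_Ex => [||w]; last first.
  rewrite -subr_ge0 (_ : _ - _ = (f w - g w) ^+ 2) ?sqr_ge0//; ring.
  by apply: L1D; apply: L1Zl; exact: L1_sqr.
by apply: L1_sqr; exact: L2D.
Qed.

Lemma Ex_sqr_cst_le f : L2 f -> Ex P f ^+ 2 <= Ex P (fun w => f w ^+ 2).
Proof.
move=> lf; have := Ex_sqr_ge0 (fun w => f w + - Ex P f).
rewrite Ex_sqrD//; last exact: L2_cst.
rewrite Ex_cst; have -> : Ex P (fun w => f w * - Ex P f) = - Ex P f * Ex P f.
  by rewrite -ExZl; [apply: eq_Ex => w; rewrite mulrC|exact: L2_L1].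
nra.
Qed.

Lemma Ex_norm_sqr_le f : L2 f ->
  Ex P (fun w => `|f w|) ^+ 2 <= Ex P (fun w => f w ^+ 2).
Proof.
move=> lf; have lf' : L2 (fun w => `|f w|).
  split; first by apply: measurableT_comp => //; exact: lf.1.
  by under eq_fun do rewrite -normrX ger0_norm ?sqr_ge0//; exact: lf.2.
rewrite (le_trans (Ex_sqr_cst_le lf'))//.
by under eq_Ex do rewrite -normrX ger0_norm ?sqr_ge0//.
Qed.

Lemma Ex_norm_le_sqrt f B : L2 f -> Ex P (fun w => f w ^+ 2) <= B ->
  Ex P (fun w => `|f w|) <= Num.sqrt B.
Proof.
move=> lf fB; have f0 : 0 <= Ex P (fun w => `|f w|) by exact: Ex_ge0.
rewrite -(@ger0_norm _ (Ex P (fun w => `|f w|)))// -sqrtr_sqr.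
by rewrite ler_wsqrtr// (le_trans (Ex_norm_sqr_le lf)).
Qed.

(** Cauchy-Schwarz from the weighted inequality |fg| <= (v/u) f^2 / 2 + (u/v) g^2 / 2. Adding
    [k > 0] to both second moments keeps the weights defined when one of them vanishes; [k] tends to
    0 afterwards. *)
Lemma Ex_mul_norm_le f g : L2 f -> L2 g ->
  Ex P (fun w => `|f w * g w|) <=
  Num.sqrt (Ex P (fun w => f w ^+ 2)) * Num.sqrt (Ex P (fun w => g w ^+ 2)).
Proof.
move=> lf lg.
set a := Ex P (fun w => f w ^+ 2); set b := Ex P (fun w => g w ^+ 2).
have a0 : 0 <= a by exact: Ex_sqr_ge0.
have b0 : 0 <= b by exact: Ex_sqr_ge0.
have lfg : L1 P (fun w => `|f w * g w|) by apply: L1_norm; exact: L2_mul.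
have E0 : 0 <= Ex P (fun w => `|f w * g w|) by exact: Ex_ge0.
suff H k : 0 < k ->
    Ex P (fun w => `|f w * g w|) <= Num.sqrt (a + k) * Num.sqrt (b + k).
  rewrite -sqrtrM// -(ger0_norm E0) -sqrtr_sqr ler_wsqrtr//.
  apply/ler_addgt0Pr => e e0.
  have ab1 : 0 < a + b + 1 by lra.
  (* Since k <= 1, (a + k)(b + k) <= ab + k (a + b + 1) <= ab + e. *)
  pose k := Num.min 1 (e / (a + b + 1)).
  have k0 : 0 < k by rewrite lt_min ltr01 divr_gt0.
  have k1 : k <= 1 by rewrite ge_min lexx.
  have ke : k * (a + b + 1) <= e by rewrite -ler_pdivlMr// ge_min lexx orbT.
  have := H k k0; rewrite -(ler_pXn2r (n := 2)) ?nnegrE ?mulr_ge0 ?sqrtr_ge0//.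
  rewrite exprMn !sqr_sqrtr; [|lra..] => HH.
  by rewrite (le_trans HH)//; nra.
move=> k0.
have ak : 0 < a + k by lra.
have bk : 0 < b + k by lra.
set u := Num.sqrt (a + k); set v := Num.sqrt (b + k).
have u0 : 0 < u by rewrite sqrtr_gt0.
have v0 : 0 < v by rewrite sqrtr_gt0.
have -> : u * v = 2^-1 * (v / u) * (a + k) + 2^-1 * (u / v) * (b + k).
  rewrite -(@sqr_sqrtr _ (a + k)) ?ltW// -(@sqr_sqrtr _ (b + k)) ?ltW// -/u -/v.
  by field; rewrite !gt_eqF.
apply: (@le_trans _ _ (2^-1 * (v / u) * a + 2^-1 * (u / v) * b)); last first.
  by apply: lerD; apply: ler_wpM2l; rewrite ?lerDl ?ltW// !mulr_gt0 ?invr_gt0.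
rewrite -!ExZl -?ExD; try by [apply: L1_sqr|apply: L1Zl; exact: L1_sqr].
apply: le_Ex => //.
  by apply: L1D; apply: L1Zl; exact: L1_sqr.
move=> w; rewrite normrM -(real_normK (num_real (f w))) -(real_normK (num_real (g w))).
rewrite -subr_ge0.
have -> : 2^-1 * (v / u) * `|f w| ^+ 2 + 2^-1 * (u / v) * `|g w| ^+ 2 -
  `|f w| * `|g w| = (v * `|f w| - u * `|g w|) ^+ 2 / (2 * u * v).
  by field; rewrite !gt_eqF.
by rewrite divr_ge0 ?sqr_ge0// !mulr_ge0 ?ltW.
Qed.

End square_integrable.

Section identically_distributed.
Context (d : measure_display) (Omega : measurableType d) (R : realType)
  (P : probability Omega R) (I : Type) (X : I -> {RV P >-> R}).
Hypothesis idX : identically_distributed P X.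

Lemma ge0_int_id i j (g : R -> \bar R) : measurable_fun setT g ->
  (forall x, 0 <= g x)%E ->
  (\int[P]_w g (X i w) = \int[P]_w g (X j w))%E.
Proof.
move=> mg g0.
rewrite -[LHS](@ge0_integral_distribution _ _ _ _ _ P (X i) g)//.
rewrite -[RHS](@ge0_integral_distribution _ _ _ _ _ P (X j) g)//.
by apply: eq_measure_integral => A mA _; exact: idX.
Qed.

Lemma L1_id i j (g : R -> R) : measurable_fun setT g ->
  L1 P (g \o X i) -> L1 P (g \o X j).
Proof.
move=> mg /integrableP[_ H]; apply/integrableP; split.
  by apply/measurable_EFinP; exact: measurableT_comp.
rewrite (@ge0_int_id j i (fun x => `|(g x)%:E|%E))//.
by apply: measurableT_comp => //; exact/measurable_EFinP.
Qed.

Lemma Ex_id i j (g : R -> R) : measurable_fun setT g ->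
  L1 P (g \o X i) -> Ex P (g \o X i) = Ex P (g \o X j).
Proof.
move=> mg lg; congr fine.
have mg' : measurable_fun setT (EFin \o g) by exact/measurable_EFinP.
rewrite -[LHS](@integral_distribution _ _ _ _ _ P (X i) (EFin \o g))//.
rewrite -[RHS](@integral_distribution _ _ _ _ _ P (X j) (EFin \o g))//.
  by apply: eq_measure_integral => A mA _; exact: idX.
exact: L1_id lg.
Qed.

Lemma L2_id i j (g : R -> R) : measurable_fun setT g ->
  L2 P (g \o X i) -> L2 P (g \o X j).
Proof.
move=> mg [_ lg]; split; first exact: measurableT_comp.
exact: (@L1_id i j (fun x => g x ^+ 2)) (measurable_funX _ mg) lg.
Qed.

End identically_distributed.

Section in_probability.
Context (d : measure_display) (Omega : measurableType d) (R : realType)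
  (P : probability Omega R).
Implicit Types Y Z : nat -> Omega -> R.

(* Stochastic o(1) and O(1); the exceptional sets avoid any measurability condition on Y. *)
Definition op1 Y := forall e r : R, 0 < e -> 0 < r ->
  exists N : nat, forall n, (N <= n)%N -> exists A : set Omega,
    [/\ measurable A, (P A <= r%:E)%E & forall w, ~ A w -> `|Y n w| <= e].

Definition Op1 Y := forall r : R, 0 < r ->
  exists B : R, exists N : nat, forall n, (N <= n)%N -> exists A : set Omega,
    [/\ measurable A, (P A <= r%:E)%E & forall w, ~ A w -> `|Y n w| <= B].

Lemma op1D Y Z : op1 Y -> op1 Z -> op1 (fun n w => Y n w + Z n w).
Proof.
move=> oY oZ e r e0 r0.
have e20 : 0 < e / 2 by lra.
have r20 : 0 < r / 2 by lra.
have [N HN] := oY _ _ e20 r20; have [M HM] := oZ _ _ e20 r20.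
exists (maxn N M) => n; rewrite geq_max => /andP[/HN[A [mA PA YA]] /HM[B [mB PB ZB]]].
exists (A `|` B); split; first exact: measurableU.
  rewrite (le_trans (measureU2 _ _ _))// (splitr r) EFinD; exact: leeD.
move=> w /not_orP[/YA Yw /ZB Zw]; rewrite (le_trans (ler_normD _ _))//; lra.
Qed.

Lemma op1_sum (I : Type) (s : seq I) (Q : pred I) (Y : I -> nat -> Omega -> R) :
  (forall i, Q i -> op1 (Y i)) -> op1 (fun n w => \sum_(i <- s | Q i) Y i n w).
Proof.
move=> oY; elim: s => [e r e0 r0|i s IH].
  exists 0%N => n _; exists set0; split => //.
    by rewrite measure0 lee_fin ltW.
  by move=> w _; rewrite big_nil normr0 ltW.
case Qi : (Q i); last first.
  by move: IH; congr op1; apply/funext => n; apply/funext => w; rewrite big_cons Qi.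
have := op1D (oY i Qi) IH.
by congr op1; apply/funext => n; apply/funext => w; rewrite big_cons Qi.
Qed.

Lemma op1_le (N0 : nat) Y Z : (forall n w, (N0 <= n)%N -> `|Y n w| <= `|Z n w|) ->
  op1 Z -> op1 Y.
Proof.
move=> YZ oZ e r e0 r0; have [N HN] := oZ _ _ e0 r0.
exists (maxn N0 N) => n; rewrite geq_max => /andP[n0 /HN[A [mA PA ZA]]].
by exists A; split => // w /ZA; apply: le_trans; exact: YZ.
Qed.

Lemma op1M Y Z : Op1 Y -> op1 Z -> op1 (fun n w => Y n w * Z n w).
Proof.
move=> oY oZ e r e0 r0.
have r20 : 0 < r / 2 by lra.
have [B [N HN]] := oY _ r20.
have e20 : 0 < e / (`|B| + 1) by rewrite divr_gt0// ltr_pwDr.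
have [M HM] := oZ _ _ e20 r20.
exists (maxn N M) => n; rewrite geq_max => /andP[/HN[A [mA PA YA]] /HM[A' [mA' PA' ZA']]].
exists (A `|` A'); split; first exact: measurableU.
  rewrite (le_trans (measureU2 _ _ _))// (splitr r) EFinD; exact: leeD.
move=> w /not_orP[/YA Yw /ZA' Zw]; rewrite normrM.
rewrite -(divfK (_ : `|B| + 1 != 0) e) ?gt_eqF ?ltr_pwDr// mulrC.
apply: ler_pM => //; rewrite (le_trans Yw)// (le_trans (ler_norm _))//; lra.
Qed.

Lemma L1_indic A : measurable A -> L1 P \1_A.
Proof.
move=> mA; apply: (@L1_bounded _ _ _ _ _ 1) => [|w].
  exact: measurable_indic.
by rewrite indicE; case: (_ \in _); rewrite ?normr1 ?normr0.
Qed.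

Lemma markov_set (f : Omega -> R) e : 0 < e -> L1 P f -> exists A : set Omega,
  [/\ measurable A, (P A <= (Ex P (fun w => `|f w|) / e)%:E)%E &
      forall w, ~ A w -> `|f w| <= e].
Proof.
move=> e0 lf; have mf := L1_meas lf.
pose A := [set w | e < `|f w|].
have mA : measurable A.
  have mn : measurable_fun setT (fun w => `|f w|) by exact: measurableT_comp.
  rewrite (_ : A = (fun w => `|f w|) @^-1` `]e, +oo[); last first.
    by apply/seteqP; split=> w; rewrite /A /= in_itv/= andbT.
  by rewrite -[_ @^-1` _]setTI; exact: mn.
exists A; split=> //; last by move=> w /negP; rewrite -leNgt.
rewrite -(@fineK _ (P A)) ?fin_num_measure// lee_fin ler_pdivlMr//.
rewrite -Ex_indic// mulrC -ExZl; last exact: L1_indic.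
apply: le_Ex => [||w]; last 1 first.
- rewrite indicE; case: (boolP (w \in A)) => wA; rewrite ?mulr0 ?mulr1//.
  by apply: ltW; move: wA; rewrite inE.
- by apply: L1Zl; exact: L1_indic.
- exact: L1_norm.
Qed.

Lemma op1_L1 Y (u : nat -> R) (N0 : nat) :
  (forall n, (N0 <= n)%N -> L1 P (Y n) /\ Ex P (fun w => `|Y n w|) <= u n) ->
  u @ \oo --> 0 -> op1 Y.
Proof.
move=> YL u0 e r e0 r0.
have er0 : 0 < e * r by exact: mulr_gt0.
have /cvgrPdist_le /(_ _ er0) [N _ HN] := u0.
exists (maxn N0 N) => n; rewrite geq_max => /andP[/YL[lY EY] /HN /=].
rewrite sub0r normrN => un.
have [A [mA PA AY]] := markov_set e0 lY; exists A; split=> //.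
rewrite (le_trans PA)// lee_fin ler_pdivrMr// (le_trans EY)//.
by rewrite mulrC (le_trans (ler_norm _)).
Qed.

Lemma Op1_L1 Y (B : R) (N0 : nat) :
  (forall n, (N0 <= n)%N -> L1 P (Y n) /\ Ex P (fun w => `|Y n w|) <= B) ->
  Op1 Y.
Proof.
move=> YL r r0; have e0 : 0 < (`|B| + 1) / r by rewrite divr_gt0// ltr_pwDr.
exists ((`|B| + 1) / r), N0 => n /YL[lY EY].
have [A [mA PA AY]] := markov_set e0 lY; exists A; split=> //.
rewrite (le_trans PA)// lee_fin ler_pdivrMr// mulrC divfK ?gt_eqF//.
by rewrite (le_trans EY)// (le_trans (ler_norm _))// lerDl.
Qed.

Lemma op1_L2 Y (u : nat -> R) (N0 : nat) :
  (forall n, (N0 <= n)%N -> L2 P (Y n) /\ Ex P (fun w => Y n w ^+ 2) <= u n) ->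
  u @ \oo --> 0 -> op1 Y.
Proof.
move=> YL u0; apply: (@op1_L1 _ (fun n => Num.sqrt (u n)) N0).
  by move=> n /YL[lY EY]; split; [exact: L2_L1|exact: Ex_norm_le_sqrt].
by rewrite -sqrtr0; apply: continuous_cvg => //; exact: sqrt_continuous.
Qed.

End in_probability.

(** * The standard Gaussian law *)

Section gaussian.
Context (R : realType).
Notation mu := (@lebesgue_measure R).

Definition gam : probability (measurableTypeR R) R := normal_prob (0 : R) 1.

Lemma measurable_sq : measurable_fun [set: R] (fun z : R => z ^+ 2).
Proof. exact: measurable_funX. Qed.

Lemma measurable_norm3 : measurable_fun [set: R] (fun z : R => `|z| ^+ 3).
Proof. by apply: measurable_funX; exact: normr_measurable. Qed.

(** The Radon-Nikodym derivative of [gam] and the normal density have the same integral over every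
    measurable set, so they agree almost everywhere. *)
Lemma gam_density_ereal (f : R -> \bar R) : measurable_fun [set: R] f ->
  (forall x, 0 <= f x)%E ->
  (\int[gam]_z f z = \int[mu]_z (f z * (normal_pdf 0 1 z)%:E))%E.
Proof.
move=> mf f0; have dom := @normal_prob_dominates R 0 1.
rewrite -(Radon_Nikodym_SigmaFinite.change_of_variables dom)//.
apply: ae_eq_integral => //.
- apply: emeasurable_funM => //; apply: (measurable_int mu).
  exact: Radon_Nikodym_SigmaFinite.f_integrable.
- apply: emeasurable_funM => //; apply/measurable_EFinP.
  exact: measurable_normal_pdf.
- apply: ae_eqe_mul2l => /=.
  apply: integral_ae_eq => //=.
  + exact: Radon_Nikodym_SigmaFinite.f_integrable.
  + by apply/measurable_EFinP; exact: measurable_normal_pdf.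
  + by move=> E _ mE; rewrite -Radon_Nikodym_SigmaFinite.f_integral.
Qed.

Lemma gam_density (f : R -> R) : measurable_fun [set: R] f ->
  (forall x, 0 <= f x) ->
  (\int[gam]_z (f z)%:E = \int[mu]_z (f z * normal_pdf 0 1 z)%:E)%E.
Proof.
move=> mf f0; rewrite gam_density_ereal//.
exact/measurable_EFinP.
Qed.

Lemma affine_subst (g : R -> R) (x a : R) : 0 < a -> continuous g ->
  (forall y, 0 <= g y) ->
  (\int[mu]_y (g y)%:E = \int[mu]_z (g (x + a * z)%R * a)%:E)%E.
Proof.
move=> a0 cg g0; pose F (z : R^o) : R^o := x + a * z.
have dF z : is_derive z (1 : R^o) F a.
  rewrite /F; apply: is_derive_eq.
  by rewrite add0r mul1r [LHS]mulr1.
have F'E : F^`()%classic = cst a.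
  by apply/funext => z; rewrite derive1E derive_val.
rewrite (@increasing_ge0_integration_by_substitutionT R F g)//.
- by rewrite F'E; apply: eq_integral.
- by move=> u v uv; rewrite /F ltrD2l ltr_pM2l.
- by rewrite F'E => ?; exact: cvg_cst.
- by rewrite F'E; exact: is_cvg_cst.
- by rewrite F'E; exact: is_cvg_cst.
- have -> : F = (fun y => y + x) \o ( *%R a) by apply/funext => z; rewrite /F/= addrC.
  apply: (cvg_comp _ _ _ (cvg_addrr_Ny x)).
  by apply/gt0_cvgMrNy => //; exact: cvg_id.
- have -> : F = (fun y => y + x) \o ( *%R a) by apply/funext => z; rewrite /F/= addrC.
  apply: (cvg_comp _ _ _ (cvg_addrr x)).
  by apply/gt0_cvgMry => //; exact: cvg_id.
Qed.

Lemma normal_pdf1E z : normal_pdf 0 1 z = normal_peak 1 * expR (- z ^+ 2 / 2) :> R.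
Proof. by rewrite normal_pdfE ?oner_neq0// /normal_fun subr0 expr1n. Qed.

Lemma normal_pdf_scale (s z : R) : 0 < s ->
  normal_pdf 0 s z = normal_pdf 0 1 (z / s) / s.
Proof.
move=> s0; rewrite !normal_pdfE ?oner_neq0 ?gt_eqF//.
rewrite mulrAC; congr (_ * _).
  rewrite /normal_peak expr1n mul1r -mulrnAr sqrtrM ?sqr_ge0// sqrtr_sqr gtr0_norm//.
  by rewrite invfM mulrC.
rewrite /normal_fun !subr0 expr1n; congr expR.
by field; rewrite gt_eqF.
Qed.

(** Completing the square. On the left is the joint density of z and w = az + bz'; on the right, the
    density of w times that of z given w, whose mean is aw / (a^2 + b^2) and whose standard
    deviation is b / sqrt(a^2 + b^2). *)
Lemma normal_pdf_conv (a b w z : R) : 0 < a -> 0 < b ->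
  normal_pdf 0 1 z * (normal_pdf 0 1 ((w - a * z) / b) / b) =
  normal_pdf 0 (Num.sqrt (a ^+ 2 + b ^+ 2)) w *
  normal_pdf (a * w / (a ^+ 2 + b ^+ 2)) (b / Num.sqrt (a ^+ 2 + b ^+ 2)) z.
Proof.
move=> a0 b0; set c := Num.sqrt _.
have c2 : c ^+ 2 = a ^+ 2 + b ^+ 2 by rewrite sqr_sqrtr// addr_ge0 ?sqr_ge0.
have c0 : 0 < c by rewrite sqrtr_gt0 ltr_pwDl ?exprn_gt0// sqr_ge0.
have bc0 : 0 < b / c by rewrite divr_gt0.
rewrite [normal_pdf 0 c w]normal_pdf_scale//.
have -> u m : normal_pdf m (b / c) u = normal_pdf 0 1 ((u - m) / (b / c)) / (b / c).
  by rewrite -normal_pdf_scale// !normal_pdfE ?gt_eqF// /normal_fun subr0.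
rewrite !normal_pdf1E.
set k := normal_peak 1.
transitivity (k ^+ 2 / b * (expR (- z ^+ 2 / 2) * expR (- ((w - a * z) / b) ^+ 2 / 2))).
  by field; rewrite gt_eqF.
transitivity (k ^+ 2 / b * (expR (- (w / c) ^+ 2 / 2) *
    expR (- ((z - a * w / (a ^+ 2 + b ^+ 2)) / (b / c)) ^+ 2 / 2))); last first.
  by field; rewrite !gt_eqF.
rewrite -!expRD; congr (_ * expR _).
rewrite !expr_div_n c2.
by field; rewrite !gt_eqF//= -c2 exprn_gt0.
Qed.

Lemma continuous_pdf1 : continuous (normal_pdf (0:R) 1).
Proof. by apply: continuous_normal_pdf; rewrite oner_neq0. Qed.

(** After exchanging the integrals by Tonelli's theorem, z is integrated against its conditional
    density given the sum, which has mass 1. *)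
Lemma ge0_gam_conv (q : R -> R) (x a b : R) : 0 < a -> 0 < b ->
  continuous q -> (forall y, 0 <= q y) ->
  (\int[gam]_z \int[gam]_z' (q (x + a * z + b * z')%R)%:E =
   \int[gam]_z (q (x + Num.sqrt (a ^+ 2 + b ^+ 2) * z)%R)%:E)%E.
Proof.
move=> a0 b0 cq q0; set c := Num.sqrt _.
have c0 : 0 < c by rewrite sqrtr_gt0 ltr_pwDl ?exprn_gt0// sqr_ge0.
have mq : measurable_fun [set: R] q by exact: continuous_measurable_fun.
have maff (u v : R) : measurable_fun [set: R] (fun z : R => u + v * z).
  by apply: measurable_funD => //; exact: measurable_funM.
pose n := normal_pdf (0:R) 1.
have mn : measurable_fun [set: R] n by exact: measurable_normal_pdf.
have n0 y : 0 <= n y by exact: normal_pdf_ge0.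
have cn' (u v : R) : continuous (fun y : R => n ((y - u) / v)).
  move=> y; apply: (cvg_comp (fun y : R => (y - u) / v) n _ (@continuous_pdf1 _)).
  by apply: cvgM; [apply: cvgB; [exact: cvg_id|exact: cvg_cst]|exact: cvg_cst].
have inner (u : R) : (\int[gam]_z' (q (u + b * z')%R)%:E =
    \int[mu]_y (q y * (n ((y - u) / b) / b))%:E)%E.
  rewrite gam_density//; last exact: measurableT_comp (maff _ _).
  rewrite (@affine_subst (fun y => q y * (n ((y - u) / b) / b)) u b)//.
  - apply: eq_integral => z _ /=; congr EFin.
    have -> : (u + b * z - u) / b = z by field; rewrite gt_eqF.
    by rewrite -[RHS]mulrA divfK ?gt_eqF.
  - move=> y; apply: cvgM; first exact: cq.
    by apply: cvgM; [exact: cn'|exact: cvg_cst].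
  - by move=> y; apply: mulr_ge0 => //; apply: divr_ge0; [exact: n0|exact: ltW].
have outer : (\int[gam]_z (q (x + c * z)%R)%:E =
    \int[mu]_y (q y * (n ((y - x) / c) / c))%:E)%E.
  rewrite gam_density//; last exact: measurableT_comp (maff _ _).
  rewrite (@affine_subst (fun y => q y * (n ((y - x) / c) / c)) x c)//.
  - apply: eq_integral => z _ /=; congr EFin.
    have -> : (x + c * z - x) / c = z by field; rewrite gt_eqF.
    by rewrite -[RHS]mulrA divfK ?gt_eqF.
  - move=> y; apply: cvgM; first exact: cq.
    by apply: cvgM; [exact: cn'|exact: cvg_cst].
  - by move=> y; apply: mulr_ge0 => //; apply: divr_ge0; [exact: n0|exact: ltW].
rewrite outer.
pose H (zy : R * R) : R := q zy.2 * (n zy.1 * (n ((zy.2 - x - a * zy.1) / b) / b)).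
have H0 zy : 0 <= H zy.
  apply: mulr_ge0 => //; apply: mulr_ge0; first exact: n0.
  by apply: divr_ge0; [exact: n0|exact: ltW].
have mH : measurable_fun [set: R * R] H.
  have m1 := @measurable_fst _ _ R R; have m2 := @measurable_snd _ _ R R.
  apply: measurable_funM; first exact: (measurableT_comp mq m2).
  apply: measurable_funM; first exact: (measurableT_comp mn m1).
  apply: measurable_funM => //; apply: (measurableT_comp mn).
  apply: measurable_funM => //; apply: measurable_funB; last exact: measurable_funM.
  exact: measurable_funB.
have mHE : measurable_fun [set: R * R] (EFin \o H) by exact/measurable_EFinP.
transitivity (\int[mu]_z \int[mu]_y (H (z, y))%:E)%E.
  pose F (z : R) := (\int[mu]_y (q y * (n ((y - (x + a * z)) / b) / b))%:E)%E.
  pose G (zy : R * R) := q zy.2 * (n ((zy.2 - (x + a * zy.1)) / b) / b).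
  have mG : measurable_fun [set: R * R] (EFin \o G).
    have m1 := @measurable_fst _ _ R R; have m2 := @measurable_snd _ _ R R.
    apply/measurable_EFinP; apply: measurable_funM; first exact: (measurableT_comp mq m2).
    apply: measurable_funM => //; apply: (measurableT_comp mn).
    apply: measurable_funM => //; apply: measurable_funB => //.
    by apply: measurable_funD => //; exact: measurable_funM.
  have G0 zy : (0 <= (EFin \o G) zy)%E.
    rewrite lee_fin; apply: mulr_ge0 => //.
    by apply: divr_ge0; [exact: n0|exact: ltW].
  have mF : measurable_fun [set: R] F.
    exact: (@measurable_fun_fubini_tonelli_F _ _ _ _ _ mu (EFin \o G) mG G0).
  transitivity (\int[gam]_z F z)%E.
    by apply: eq_integral => z _; rewrite inner.
  rewrite gam_density_ereal//; last first.
    by move=> z; apply: integral_ge0 => y _; exact: (G0 (z, y)).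
  apply: eq_integral => z _; rewrite -ge0_integralZr//.
  - apply: eq_integral => y _; rewrite -EFinM; congr EFin.
    by rewrite /H /= opprD addrA -!mulrA; congr (_ * _); rewrite [RHS]mulrC -mulrA.
  - exact: (measurableT_comp mG (measurable_pair1 z)).
  - by move=> y _; exact: (G0 (z, y)).
  - by rewrite lee_fin normal_pdf_ge0.
transitivity (\int[mu]_y \int[mu]_z (H (z, y))%:E)%E.
  exact: (@fubini_tonelli _ _ _ _ _ mu mu (EFin \o H) mHE H0).
apply: eq_integral => y _ /=.
transitivity (\int[mu]_z ((q y * (n ((y - x) / c) / c))%:E *
   (normal_pdf (a * (y - x) / (a ^+ 2 + b ^+ 2)) (b / c) z)%:E))%E.
  apply: eq_integral => z _; rewrite -EFinM; congr EFin.
  rewrite /H /= -!mulrA; congr (_ * _).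
  by rewrite normal_pdf_conv// -/c [normal_pdf 0 c _]normal_pdf_scale// -mulrA (mulrA a).
rewrite ge0_integralZl//.
- by rewrite integral_normal_pdf mule1.
- by apply/measurable_EFinP; exact: measurable_normal_pdf.
- by move=> z _; rewrite lee_fin normal_pdf_ge0.
- rewrite lee_fin; apply: mulr_ge0 => //.
  by apply: divr_ge0; [exact: n0|exact: ltW].
Qed.

(** The factor exp(tz) translates the normal density by t, up to the constant exp(t^2 / 2). The mean
    of [gam] is deduced from this identity and its variance from [gam_expR_sq]. *)
Lemma gam_expR t : (\int[gam]_z (expR (t * z))%:E = (expR (t ^+ 2 / 2))%:E)%E.
Proof.
rewrite gam_density//.
  transitivity (\int[mu]_z ((expR (t ^+ 2 / 2))%:E * (normal_pdf t 1 z)%:E))%E.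
    apply: eq_integral => z _; rewrite -EFinM; congr EFin.
    rewrite normal_pdf1E normal_pdfE ?oner_neq0// /normal_fun expr1n.
    rewrite mulrCA [RHS]mulrCA -!expRD; congr (_ * expR _); by field.
  rewrite ge0_integralZl//.
  - by rewrite integral_normal_pdf mule1.
  - by apply/measurable_EFinP; exact: measurable_normal_pdf.
  - by move=> z _; rewrite lee_fin normal_pdf_ge0.
by apply: measurableT_comp => //; exact: measurable_funM.
Qed.

(** The integrand times the standard density is the density with standard deviation 1/r, divided by
    r. *)
Lemma gam_expR_sq (r : R) : 0 < r ->
  (\int[gam]_z (expR (- (r ^+ 2 - 1) * z ^+ 2 / 2))%:E = (r^-1)%:E)%E.
Proof.
move=> r0; rewrite gam_density//.
  transitivity (\int[mu]_z ((r^-1)%:E * (normal_pdf 0 r^-1 z)%:E))%E.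
    apply: eq_integral => z _; rewrite -EFinM; congr EFin.
    rewrite [in RHS]normal_pdf_scale ?invr_gt0// invrK !normal_pdf1E.
    rewrite [RHS]mulrCA mulVf ?gt_eqF// mulr1 mulrCA -expRD; congr (_ * expR _).
    by field.
  rewrite ge0_integralZl//.
  - by rewrite integral_normal_pdf mule1.
  - by apply/measurable_EFinP; exact: measurable_normal_pdf.
  - by move=> z _; rewrite lee_fin normal_pdf_ge0.
  - by rewrite lee_fin invr_ge0 ltW.
apply: measurableT_comp => //; apply: measurable_funM => //.
by apply: measurable_funM => //; exact: measurable_funX.
Qed.

Lemma L1_gam_expR t : L1 gam (fun z : R => expR (t * z)).
Proof.
apply/integrableP; split.
  apply/measurable_EFinP; apply: measurableT_comp => //; exact: measurable_funM.
under eq_integral => z _ do rewrite /= ger0_norm ?expR_ge0//.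
by rewrite gam_expR ltry.
Qed.

Lemma L1_gam_norm3 : L1 gam (fun z : R => `|z| ^+ 3).
Proof.
(* The factor is 3!, from |z|^3 / 3! <= exp |z| <= exp z + exp (-z). *)
apply: (@L1_le _ _ _ gam _ (fun z : R => 6 * (expR (1 * z) + expR (- 1 * z)))).
- exact: measurable_norm3.
- by apply: L1Zl; apply: L1D; exact: L1_gam_expR.
move=> z; rewrite mul1r mulN1r ger0_norm ?exprn_ge0//.
have := @expR_ge1Dxn R `|z| 2 (normr_ge0 z).
have -> : (3`!)%:R = 6 :> R by [].
have : expR `|z| <= expR z + expR (- z).
  by case: (ger0P z) => _; rewrite ?lerDl ?lerDr expR_ge0.
lra.
Qed.

Lemma L2_gam_id : L2 gam (@id R).
Proof.
split; first exact: measurable_id.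
apply: (@L1_le _ _ _ gam _ (fun z : R => 1 + `|z| ^+ 3)).
- exact: measurable_sq.
- by apply: L1D; [exact: L1_cst|exact: L1_gam_norm3].
move=> z; rewrite normrX; have := normr_ge0 z; set u := `|z| => u0.
have [u1|u1] := leP u 1; have := exprn_ge0 3 u0; nra.
Qed.

Lemma L1_gam_id : L1 gam (@id R). Proof. exact: L2_L1 L2_gam_id. Qed.

Lemma Ex_gam_expR t : Ex gam (fun z : R => expR (t * z)) = expR (t ^+ 2 / 2).
Proof. by rewrite /Ex /Rintegral gam_expR. Qed.

(** From 1 + tz <= exp(tz), integration gives 1 + t E z <= exp(t^2 / 2) <= 1 / (1 - t^2 / 2), so t E
    z <= t^2 for |t| <= 1; small t of both signs force E z = 0. *)
Lemma Ex_gam_id : Ex gam (@id R) = 0.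
Proof.
have H t : 1 + t * Ex gam (@id R) <= expR (t ^+ 2 / 2).
  rewrite -Ex_gam_expR -[X in X + _](Ex_cst gam 1) -ExZl; last exact: L1_gam_id.
  rewrite -ExD; [|exact: L1_cst|exact: L1Zl L1_gam_id].
  apply: le_Ex => [||z]; [|exact: L1_gam_expR|exact: expR_ge1Dx].
  by apply: L1D; [exact: L1_cst|exact: L1Zl L1_gam_id].
have K t : t ^+ 2 <= 1 -> t * Ex gam (@id R) <= t ^+ 2.
  move=> t1; have := H t; have := expR_ge1Dx (- (t ^+ 2 / 2)).
  rewrite expRN; set e := expR _ => e1 e2.
  have e0 : 0 < e by exact: expR_gt0.
  have : (1 - t ^+ 2 / 2) * e <= 1.
    by rewrite -[leRHS](mulVf (x := e)) ?gt_eqF// ler_pM2r//.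
  nra.
apply/eqP; rewrite eq_le; apply/andP; split.
  apply/ler_addgt0Pr => e e0; rewrite add0r.
  pose t := Num.min 1 e.
  have t0 : 0 < t by rewrite lt_min ltr01.
  have t1 : t <= 1 by rewrite ge_min lexx.
  have te : t <= e by rewrite ge_min lexx orbT.
  have /K : t ^+ 2 <= 1 by rewrite expr_le1// ltW.
  by rewrite expr2 ler_pM2l//; lra.
rewrite -[leRHS]opprK oppr_ge0.
apply/ler_addgt0Pr => e e0; rewrite add0r.
pose t := Num.min 1 e.
have t0 : 0 < t by rewrite lt_min ltr01.
have t1 : t <= 1 by rewrite ge_min lexx.
have te : t <= e by rewrite ge_min lexx orbT.
have /K : (- t) ^+ 2 <= 1 by rewrite sqrrN expr_le1// ltW.
rewrite sqrrN mulNr -mulrN expr2 ler_pM2l//; lra.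
Qed.

(** The same tangent-line argument with [gam_expR_sq]: 1 - (r^2 - 1) v / 2 <= 1 / r for every r > 0.
    Taking r slightly below 1 excludes v > 1, and r slightly above 1 excludes v < 1. *)
Lemma Ex_gam_sq : Ex gam (fun z : R => z ^+ 2) = 1.
Proof.
set v := Ex _ _; have v0 : 0 <= v by exact: Ex_sqr_ge0.
have H r : 0 < r -> 1 + - (r ^+ 2 - 1) / 2 * v <= r^-1.
  move=> r0; rewrite -[X in X + _](Ex_cst gam 1) /v -ExZl; last exact: L1_sqr L2_gam_id.
  rewrite -ExD; [|exact: L1_cst|apply: L1Zl; exact: L1_sqr L2_gam_id].
  have -> : r^-1 = Ex gam (fun z : R => expR (- (r ^+ 2 - 1) * z ^+ 2 / 2)).
    by rewrite /Ex /Rintegral gam_expR_sq.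
  apply: le_Ex => [||z].
  - by apply: L1D; [exact: L1_cst|apply: L1Zl; exact: L1_sqr L2_gam_id].
  - apply/integrableP; split.
      apply/measurable_EFinP; apply: measurableT_comp => //.
      by apply: measurable_funM => //; apply: measurable_funM => //; exact: measurable_sq.
    under eq_integral => z _ do rewrite /= ger0_norm ?expR_ge0//.
    by rewrite gam_expR_sq// ltry.
  - by rewrite (le_trans _ (expR_ge1Dx _))// lerD2l mulrAC.
have K r : 0 < r -> 2 * (r - 1) <= r * (r + 1) * (r - 1) * v.
  move=> r0; have := H r r0; rewrite -(ler_pM2l r0) mulfV ?gt_eqF//; nra.
apply/eqP; rewrite eq_le; apply/andP; split; rewrite leNgt; apply/negP => v1.
  pose e := Num.min (1 / 2) ((v - 1) / (4 * v)).
  have vv : 0 < 4 * v by lra.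
  have e0 : 0 < e by rewrite lt_min !divr_gt0//; lra.
  have e1 : e <= 1 / 2 by rewrite ge_min lexx.
  have e2 : e * (4 * v) <= v - 1 by rewrite -ler_pdivlMr// ge_min lexx orbT.
  have r0 : 0 < 1 - e by lra.
  have := K _ r0.
  move=> Kr; have : (1 - e) * (2 - e) * v * e <= 2 * e by lra.
  rewrite ler_pM2r//; nra.
pose e := (1 - v) / 2.
have r0 : 0 < 1 + e by rewrite /e; lra.
have e0 : 0 < e by rewrite /e; lra.
have := K _ r0.
have -> : 1 + e - 1 = e by ring.
rewrite (_ : (1 + e) * (1 + e + 1) * e * v = (1 + e) * (2 + e) * v * e); last by ring.
rewrite ler_pM2r//; have -> : v = 1 - 2 * e by rewrite /e; field.
nra.
Qed.

Lemma measurable_gam (f : R * R -> R) (C : R) :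
  measurable_fun [set: R * R] f -> (forall z, `|f z| <= C) ->
  measurable_fun [set: R] (fun z : R => Ex gam (fun z' : R => f (z, z'))).
Proof.
move=> mf fC; have mf' : measurable_fun [set: R * R] (EFin \o f).
  exact/measurable_EFinP.
have lf : (gam \x gam)%E.-integrable [set: R * R] (EFin \o f).
  apply/integrable12ltyP => //.
  apply: (@le_lt_trans _ _ (\int[gam]_x \int[gam]_y C%:E)%E); last first.
    under eq_integral => x _ do rewrite integral_cst//= probability_setT mule1.
    by rewrite integral_cst//= probability_setT mule1 ltry.
  apply: ge0_le_integral => //.
  - by move=> x _; apply: integral_ge0.
  - apply: (@measurable_fun_fubini_tonelli_F _ _ _ _ _ gam (abse \o (EFin \o f))) => //.
    exact: measurableT_comp.
    by move=> xy; exact: abse_ge0.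
  - move=> x _; apply: ge0_le_integral => //.
    + by apply: measurableT_comp => //; exact: measurableT_comp mf' (measurable_pair1 x).
    + by move=> y _; rewrite lee_fin; exact: le_trans (fC (x, y)).
have := measurable_fubini_F lf.
by move=> /(measurableT_comp (@fine_measurable _ setT measurableT)).
Qed.

(** Reduces to the nonnegative case by adding the bound [C] to [q]. The scales a = 0 and b = 0 are
    set apart because they have no density. *)
Lemma gam_conv (q : R -> R) (x a b C : R) : 0 <= a -> 0 <= b ->
  continuous q -> (forall y, `|q y| <= C) ->
  Ex gam (fun z : R => Ex gam (fun z' : R => q (x + a * z + b * z'))) =
  Ex gam (fun z : R => q (x + Num.sqrt (a ^+ 2 + b ^+ 2) * z)).
Proof.
move=> a0 b0 cq qC.
have mq : measurable_fun [set: R] q by exact: continuous_measurable_fun.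
move: a0; rewrite le_eqVlt => /predU1P[<-|a0].
  rewrite expr0n /= add0r sqrtr_sqr ger0_norm//.
  under eq_Ex => z do under eq_Ex => z' do rewrite mul0r addr0.
  by rewrite Ex_cst.
move: b0; rewrite le_eqVlt => /predU1P[<-|b0].
  rewrite expr0n /= addr0 sqrtr_sqr gtr0_norm//.
  under eq_Ex => z.
    under eq_Ex => z' do rewrite mul0r addr0.
    rewrite Ex_cst; over.
  by [].
have lq (u v : R) : L1 gam (fun z : R => q (u + v * z)).
  apply: (@L1_bounded _ _ _ gam _ C) => // .
  by apply: measurableT_comp => //; apply: measurable_funD => //; exact: measurable_funM.
pose q' y := q y + C.
have cq' : continuous q' by move=> y; apply: cvgD; [exact: cq|exact: cvg_cst].
have q'0 y : 0 <= q' y by have := qC y; rewrite /q' ler_norml => /andP[]; lra.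
have lq' u v : L1 gam (fun z : R => q' (u + v * z)) by apply: L1D => //; exact: L1_cst.
have := @ge0_gam_conv q' x a b a0 b0 cq' q'0.
under eq_integral => z _ do rewrite -(EFin_Ex (lq' _ _)).
rewrite -(EFin_Ex (lq' _ _)).
have Eq' u v : Ex gam (fun z : R => q' (u + v * z)) = Ex gam (fun z : R => q (u + v * z)) + C.
  by rewrite ExD ?Ex_cst//; exact: L1_cst.
under eq_integral => z _ do rewrite Eq'.
rewrite Eq' => /(congr1 fine) /=.
set F := fun z : R => _.
have lF : L1 gam (fun z : R => Ex gam (fun z' : R => q (x + a * z + b * z'))).
  apply: (@L1_bounded _ _ _ gam _ C) => [|z].
    apply: (@measurable_gam (fun zy : R * R => q (x + a * zy.1 + b * zy.2)) C) => //.
    apply: (measurableT_comp mq); apply: measurable_funD.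
      apply: measurable_funD => //; apply: measurable_funM => //; exact: measurable_fst.
    by apply: measurable_funM => //; exact: measurable_snd.
  by apply: Ex_norm_le => //; exact: L1_meas (lq _ _).
rewrite -/(Rintegral _ _ _) => E.
have : Ex gam (fun z : R => Ex gam (fun z' : R => q (x + a * z + b * z')) + C) =
  Ex gam (fun z : R => q (x + Num.sqrt (a ^+ 2 + b ^+ 2) * z)) + C by exact: E.
by rewrite ExD ?Ex_cst//; [move=> /addIr|exact: L1_cst].
Qed.

End gaussian.

(** * Test functions with a second-order expansion *)

Section taylor_class.
Context (R : realType).
Local Notation gm := (gam R).
Implicit Types (q : R -> R) (D s x y h : R).

Definition lip D q := forall x h, `|q (x + h) - q x| <= D * `|h|.

(* q1 and q2 play the role of the first two derivatives of q. *)
Record TC D (q q1 q2 : R -> R) : Prop := {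
  tc0 : forall x, `|q x| <= D;
  tc1 : forall x, `|q1 x| <= D;
  tc2 : forall x, `|q2 x| <= D;
  tcT : forall x h, `|q (x + h) - q x - q1 x * h - q2 x * h ^+ 2 / 2| <=
          D * `|h| ^+ 3;
  tcL0 : lip D q;
  tcL1 : lip D q1;
  tcL2 : lip D q2 }.

Lemma lip_continuous D q : lip D q -> continuous q.
Proof.
move=> lq x; apply/cvgrPdist_le => e e0.
have D1 : 0 < `|D| + 1 by rewrite ltr_wpDl.
have e'0 : 0 < e / (`|D| + 1) by exact: divr_gt0.
have /cvgrPdist_le/(_ _ e'0) N : y @[y --> x] --> x by exact: cvg_id.
near=> y.
rewrite distrC -{1}(subrKC x y) (le_trans (lq _ _))//.
apply: (@le_trans _ _ ((`|D| + 1) * `|y - x|)).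
  by apply: ler_wpM2r => //; rewrite (le_trans (ler_norm D))// lerDl.
rewrite mulrC -ler_pdivlMr// distrC; near: y; exact: N.
Unshelve. all: by end_near. Qed.

Lemma lip_measurable D q : lip D q -> measurable_fun [set: R] q.
Proof. by move=> /lip_continuous; exact: continuous_measurable_fun. Qed.

(* A semigroup in s^2 that solves the heat equation up to third order (gsm_gsm, gsm_heat). *)
Definition gsm s q x := Ex gm (fun z : R => q (x + s * z)).

Lemma measurable_affine (x s : R) : measurable_fun [set: R] (fun z : R => x + s * z).
Proof. by apply: measurable_funD => //; exact: measurable_funM. Qed.

Lemma L1_gsm D q s x : measurable_fun [set: R] q -> (forall x, `|q x| <= D) ->
  L1 gm (fun z : R => q (x + s * z)).
Proof.
move=> mq qD; apply: (@L1_bounded _ _ _ gm _ D) => //.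
exact: measurableT_comp mq (measurable_affine x s).
Qed.

Lemma gsm_bound D q s x : measurable_fun [set: R] q -> (forall x, `|q x| <= D) ->
  `|gsm s q x| <= D.
Proof.
move=> mq qD; apply: Ex_norm_le => //.
exact: measurableT_comp mq (measurable_affine x s).
Qed.

Lemma gsm_lip D q s : (forall x, `|q x| <= D) -> lip D q -> lip D (gsm s q).
Proof.
move=> qD lq x h; have mq := lip_measurable lq.
rewrite /gsm -ExB; [|exact: L1_gsm..].
apply: Ex_norm_le => [|z].
  by apply: measurable_funB; exact: measurableT_comp mq (measurable_affine _ s).
by rewrite addrAC; exact: lq.
Qed.

(** Each clause is a bound on an average of translates, so the constant [D] does not grow. This is
    why one error bound serves all replacement steps. *)
Lemma gsm_TC D s q q1 q2 : TC D q q1 q2 -> TC D (gsm s q) (gsm s q1) (gsm s q2).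
Proof.
move=> [b0 b1 b2 bT l0 l1 l2].
have m0 := lip_measurable l0; have m1 := lip_measurable l1.
have m2 := lip_measurable l2.
split; [by move=> x; exact: gsm_bound|by move=> x; exact: gsm_bound|by move=> x; exact: gsm_bound| |exact: gsm_lip|exact: gsm_lip|exact: gsm_lip].
move=> x h; rewrite /gsm.
have L0 y := @L1_gsm _ _ s y m0 b0; have L1' := @L1_gsm _ _ s x m1 b1.
have L2' := @L1_gsm _ _ s x m2 b2.
have E1 : Ex gm (fun z : R => q1 (x + s * z)) * h = Ex gm (fun z : R => h * q1 (x + s * z)).
  by rewrite ExZl// mulrC.
have E2 : Ex gm (fun z : R => q2 (x + s * z)) * h ^+ 2 / 2 =
    Ex gm (fun z : R => h ^+ 2 / 2 * q2 (x + s * z)).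
  by rewrite ExZl//; ring.
rewrite E1 E2 -ExB// -ExB; [|exact: L1B|exact: L1Zl].
rewrite -ExB; [|by apply: L1B; [exact: L1B|exact: L1Zl]|exact: L1Zl].
apply: Ex_norm_le => [|z].
  apply: (@L1_meas _ _ _ gm).
  by apply: L1B; [apply: L1B; [exact: L1B|exact: L1Zl]|exact: L1Zl].
rewrite (_ : _ - _ = q (x + s * z + h) - q (x + s * z) - q1 (x + s * z) * h -
  q2 (x + s * z) * h ^+ 2 / 2); first exact: bT.
by rewrite (addrAC x h); ring.
Qed.

Definition m3 : R := Ex gm (fun z : R => `|z| ^+ 3).

Lemma m3_ge0 : 0 <= m3. Proof. by apply: Ex_ge0 => z; exact: exprn_ge0. Qed.

(** Taylor's expansion under the integral: the linear term vanishes because the mean is 0 and the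
    quadratic one gives s^2 / 2 because the variance is 1. *)
Lemma gsm_heat D q q1 q2 s x : 0 <= s -> TC D q q1 q2 ->
  `|gsm s q x - q x - s ^+ 2 / 2 * q2 x| <= D * m3 * s ^+ 3.
Proof.
move=> s0 [b0 b1 b2 bT l0 l1 l2]; have m0 := lip_measurable l0.
have Lq := @L1_gsm _ _ s x m0 b0.
pose r := fun z : R => q (x + s * z) - q x - q1 x * s * z - q2 x * s ^+ 2 / 2 * z ^+ 2.
have L2z : L1 gm (fun z : R => z ^+ 2) by exact: L1_sqr (@L2_gam_id R).
have Lr1 : L1 gm (fun z : R => q (x + s * z) - q x) by apply: L1B => //; exact: L1_cst.
have Lr2 : L1 gm (fun z : R => q (x + s * z) - q x - q1 x * s * z).
  by apply: L1B => //; apply: L1Zl; exact: L1_gam_id.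
have Lr : L1 gm r by apply: L1B => //; exact: L1Zl.
have -> : gsm s q x - q x - s ^+ 2 / 2 * q2 x = Ex gm r.
  rewrite /r ExB//; last exact: L1Zl.
  rewrite ExB//; last by apply: L1Zl; exact: L1_gam_id.
  rewrite ExB//; last exact: L1_cst.
  rewrite Ex_cst !ExZl//; last exact: L1_gam_id.
  by rewrite Ex_gam_id Ex_gam_sq /gsm; ring.
rewrite (le_trans (le_norm_Ex Lr))//.
apply: (@le_trans _ _ (Ex gm (fun z : R => D * s ^+ 3 * `|z| ^+ 3))).
  apply: le_Ex => [||z].
  - exact: L1_norm.
  - by apply: L1Zl; exact: L1_gam_norm3.
  have -> : r z = q (x + s * z) - q x - q1 x * (s * z) - q2 x * (s * z) ^+ 2 / 2.
    by rewrite /r; ring.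
  by rewrite (le_trans (bT _ _))// normrM (ger0_norm s0) exprMn mulrA.
rewrite ExZl; last exact: L1_gam_norm3.
by rewrite mulrAC.
Qed.

Lemma gsm_gsm D q s1 s2 x : 0 <= s1 -> 0 <= s2 -> (forall x, `|q x| <= D) -> lip D q ->
  gsm s1 (gsm s2 q) x = gsm (Num.sqrt (s1 ^+ 2 + s2 ^+ 2)) q x.
Proof.
by move=> s10 s20 qD lq; rewrite /gsm (gam_conv _ _ _ _ qD)//; exact: lip_continuous lq.
Qed.

Lemma gsm0 q x : gsm 0 q x = q x.
Proof. by rewrite /gsm; under eq_Ex do rewrite mul0r addr0; rewrite Ex_cst. Qed.

(** Continuity in the standard deviation; used for the convergence of the total variance and for the
    change of variance caused by truncation. *)
Lemma gsm_scale_lip D q s1 s2 x : (forall x, `|q x| <= D) -> lip D q ->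
  `|gsm s1 q x - gsm s2 q x| <= D * `|s1 - s2| * Ex gm (fun z : R => `|z|).
Proof.
move=> qD lq; have mq := lip_measurable lq.
have L s := @L1_gsm _ _ s x mq qD.
have Lz : L1 gm (fun z : R => `|z|) by apply: L1_norm; exact: L1_gam_id.
rewrite /gsm -ExB// (le_trans (le_norm_Ex _))//; first exact: L1B.
rewrite -ExZl//; apply: le_Ex => [||z].
- by apply: L1_norm; exact: L1B.
- exact: L1Zl.
rewrite -mulrA -normrM mulrBl.
have -> : x + s1 * z = x + s2 * z + (s1 * z - s2 * z) by ring.
exact: lq.
Qed.

End taylor_class.

(** * Second-order expansions of products over the coordinates *)

Section multivariate_taylor.
Context (R : realType).
Implicit Types (w u : nat -> R) (F : (nat -> R) -> R).

(** The quantification over all measurable spaces makes the property apply to the sigma-algebra of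
    the past as well, where it yields adaptedness. *)
Definition mfunctional F := forall d (T : measurableType d) (V : nat -> T -> R),
  (forall j, measurable_fun [set: T] (V j)) ->
  measurable_fun [set: T] (fun t : T => F (fun j => V j t)).

Definition mlip (C : R) F := forall w u (e : R), 0 <= e <= 1 ->
  (forall j, `|u j| <= e) -> `|F (fun j => w j + u j) - F w| <= C * e.

(* g and H play the role of the gradient and the Hessian of f, and f' that of f smoothed by
   independent N(0, eta^2) noise in each coordinate (mtH). *)
Record MT (p : nat) (C eta : R) (f f' : (nat -> R) -> R)
    (g : nat -> (nat -> R) -> R) (H : nat -> nat -> (nat -> R) -> R) : Prop := {
  mt0 : forall w, `|f w| <= C;
  mt1 : forall j w, `|g j w| <= C;
  mt2 : forall i j w, `|H i j w| <= C;
  mtL0 : mlip C f;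
  mtL1 : forall j, mlip C (g j);
  mtL2 : forall i j, mlip C (H i j);
  mtm0 : mfunctional f;
  mtm0' : mfunctional f';
  mtm1 : forall j, mfunctional (g j);
  mtm2 : forall i j, mfunctional (H i j);
  mt0' : forall w, `|f' w| <= C;
  mtT : forall w u (e : R), 0 <= e <= 1 -> (forall j, `|u j| <= e) ->
    `|f (fun j => w j + u j) - f w - \sum_(j < p) g j w * u j -
      (\sum_(i < p) \sum_(j < p) H i j w * u i * u j) / 2| <= C * e ^+ 3;
  mtH : forall w, `|f' w - f w - eta ^+ 2 / 2 * \sum_(i < p) H i i w| <= C * eta ^+ 3
}.

Lemma mlipM C D F G : 0 <= C -> 0 <= D -> (forall w, `|F w| <= C) -> (forall w, `|G w| <= D) ->
  mlip C F -> mlip D G -> mlip (2 * C * D) (fun w => F w * G w).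
Proof.
move=> C0 D0 bF bG lF lG w u e e01 ue.
rewrite (_ : _ - _ = F (fun j => w j + u j) * (G (fun j => w j + u j) - G w) +
  (F (fun j => w j + u j) - F w) * G w); last by ring.
rewrite (le_trans (ler_normD _ _))// !normrM.
rewrite (_ : 2 * C * D * e = C * (D * e) + C * e * D); last by ring.
by apply: lerD; apply: ler_pM => //; [exact: lG|exact: lF].
Qed.

Lemma mlip_coord D q p : 0 <= D -> lip D q -> mlip D (fun w => q (w p)).
Proof. by move=> D0 lq w u e _ ue; rewrite (le_trans (lq _ _))// ler_wpM2l. Qed.

Lemma mfunctionalM F G : mfunctional F -> mfunctional G ->
  mfunctional (fun w => F w * G w).
Proof. by move=> mF mG d T V mV; apply: measurable_funM; [exact: mF|exact: mG]. Qed.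

Lemma mfunctional_coord q p : measurable_fun [set: R] q -> mfunctional (fun w => q (w p)).
Proof. by move=> mq d T V mV; exact: measurableT_comp mq (mV p). Qed.

Lemma mlip_le C C' F : C <= C' -> mlip C F -> mlip C' F.
Proof.
move=> CC lF w u e e01 ue; rewrite (le_trans (lF _ _ _ e01 ue))//.
by rewrite ler_wpM2r//; case/andP: e01.
Qed.

(** The constant depends on [p] and [D] only, which matters because the test functions change at
    every replacement step. By induction on the number of factors: the expansions of the product so
    far and of the new factor are multiplied, and e <= 1 absorbs the terms of order above 3. *)
Lemma MT_prod (p : nat) (D : R) : 0 <= D -> exists2 C : R, 0 <= C &
  forall (eta : R) (q q1 q2 q' : nat -> R -> R), 0 <= eta <= 1 ->
  (forall j, TC D (q j) (q1 j) (q2 j)) ->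
  (forall j, measurable_fun [set: R] (q' j)) ->
  (forall j x, `|q' j x| <= D) ->
  (forall j x, `|q' j x - q j x - eta ^+ 2 / 2 * q2 j x| <= D * eta ^+ 3) ->
  exists g H, MT p C eta (fun w => \prod_(j < p) q j (w j))
    (fun w => \prod_(j < p) q' j (w j)) g H.
Proof.
move=> D0; elim: p => [|p [C C0 IH]].
  exists 1 => // eta q q1 q2 q' eta01 tq mq' bq' hq.
  exists (fun _ _ => 0), (fun _ _ _ => 0).
  have e3 (e : R) : 0 <= e <= 1 -> 0 <= 1 * e ^+ 3.
    by move=> /andP[e0 _]; rewrite mul1r exprn_ge0.
  have c0 : mlip 1 (fun=> 0 : R).
    by move=> w u e /andP[e0 _] _; rewrite subrr normr0 mul1r.
  split => //.
  - by move=> w; rewrite big_ord0 normr1.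
  - by move=> j w; rewrite normr0.
  - by move=> i j w; rewrite normr0.
  - by move=> w u e /andP[e0 _] _; rewrite !big_ord0 subrr normr0 mul1r.
  - by move=> d T V mV; under eq_fun do rewrite big_ord0; exact: measurable_cst.
  - by move=> d T V mV; under eq_fun do rewrite big_ord0; exact: measurable_cst.
  - by move=> j d T V mV; exact: measurable_cst.
  - by move=> i j d T V mV; exact: measurable_cst.
  - by move=> w; rewrite big_ord0 normr1.
  - by move=> w u e e01 _; rewrite !big_ord0 subrr sub0r mul0r subr0 oppr0 normr0 e3.
  - by move=> w; rewrite !big_ord0 subrr mulr0 subr0 normr0 e3.
(* The factor covers both remainders: the Taylor remainder needs 4 + p/2 + 3 p^2 / 4 and the
   smoothing remainder 2 + 5p/4. *)
pose K := C * D * (5 + 2 * p%:R + p%:R ^+ 2).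
have p0 : 0 <= p%:R :> R by [].
have CD0 : 0 <= C * D by exact: mulr_ge0.
have CDp : 0 <= C * D * p%:R by exact: mulr_ge0.
have CDpp : 0 <= C * D * p%:R ^+ 2 by rewrite mulr_ge0// sqr_ge0.
have KE : K = 5 * (C * D) + 2 * (C * D * p%:R) + C * D * p%:R ^+ 2 by rewrite /K; ring.
have K1 : C * D <= K by lra.
have K2 : 2 * C * D <= K by lra.
have K0 : 0 <= K by lra.
exists K => // eta q q1 q2 q' eta01 tq mq' bq' hq.
have [g [H M]] := IH eta q q1 q2 q' eta01 tq mq' bq' hq.
case: (tq p) => b0 b1 b2 bT l0 l1 l2.
have m0 := lip_measurable l0; have m1 := lip_measurable l1.
have m2 := lip_measurable l2.
set f := (fun w => \prod_(j < p) q j (w j)) in M.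
set f' := (fun w => \prod_(j < p) q' j (w j)) in M.
exists (fun j w => if (j < p)%N then g j w * q p (w p) else f w * q1 p (w p)).
exists (fun i j w => if (i < p)%N then
    if (j < p)%N then H i j w * q p (w p) else g i w * q1 p (w p)
  else if (j < p)%N then g j w * q1 p (w p) else f w * q2 p (w p)).
case: M => M0 M1 M2 ML0 ML1 ML2 Mm0 Mm0' Mm1 Mm2 M0' MTT MH.
have bM F G w : `|F w| <= C -> `|G| <= D -> `|F w * G| <= K :> R.
  by move=> HF HG; rewrite normrM (le_trans _ K1)// ler_pM.
have lM F r : (forall w, `|F w| <= C) -> mlip C F -> (forall x, `|r x| <= D) -> lip D r ->
    mlip K (fun w => F w * r (w p)).
  move=> bF lF br lr; apply: (mlip_le K2); apply: mlipM => //.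
  exact: mlip_coord.
split => //.
- by move=> w; rewrite big_ord_recr/=; exact: (bM f).
- by move=> j w; case: ifP => _; [exact: (bM (g j))|exact: (bM f)].
- move=> i j w; case: ifP => _; case: ifP => _.
  + exact: (bM (H i j)).
  + exact: (bM (g i)).
  + exact: (bM (g j)).
  + exact: (bM f).
- move=> w u e; rewrite !big_ord_recr/=.
  exact: (lM f (q p)).
- by move=> j; case: (j < p)%N; [exact: (lM (g j))|exact: (lM f)].
- move=> i j; case: (i < p)%N; case: (j < p)%N.
  + exact: (lM (H i j)).
  + exact: (lM (g i)).
  + exact: (lM (g j)).
  + exact: (lM f).
- move=> d T V mV; under eq_fun do rewrite big_ord_recr/=.
  have h := mfunctionalM Mm0 (mfunctional_coord p m0).
  exact: (h _ _ _ mV).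
- move=> d T V mV; under eq_fun do rewrite big_ord_recr/=.
  have h := mfunctionalM Mm0' (mfunctional_coord p (mq' p)).
  exact: (h _ _ _ mV).
- by move=> j; case: (j < p)%N; apply: mfunctionalM => //; exact: mfunctional_coord.
- by move=> i j; case: (i < p)%N; case: (j < p)%N; apply: mfunctionalM => //; exact: mfunctional_coord.
- by move=> w; rewrite big_ord_recr/=; exact: (bM f').
- move=> w u e e01 ue; have /andP[e0 e1] := e01.
  rewrite !big_ord_recr/= ltnn -/(f w) -/(f (fun j => w j + u j)).
  set G := \sum_(j < p) g j w * u j.
  set Q := \sum_(i < p) \sum_(j < p) H i j w * u i * u j.
  have -> : \sum_(i < p) (if (i < p)%N then g i w * q p (w p) else f w * q1 p (w p)) * u i
      = G * q p (w p).
    by rewrite /G mulr_suml; apply: eq_bigr => i _; rewrite ltn_ord; ring.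
  have -> : \sum_(i < p) \sum_(j < p.+1) (if (i < p)%N then
       if (j < p)%N then H i j w * q p (w p) else g i w * q1 p (w p)
       else if (j < p)%N then g j w * q1 p (w p) else f w * q2 p (w p)) * u i * u j =
     Q * q p (w p) + G * (q1 p (w p) * u p).
    rewrite /Q /G !mulr_suml -big_split/=; apply: eq_bigr => i _.
    rewrite big_ord_recr/= ltn_ord ltnn mulr_suml; congr (_ + _); last by ring.
    by apply: eq_bigr => j _; rewrite ltn_ord; ring.
  have -> : \sum_(i < p) (if (i < p)%N then g i w * q1 p (w p) else f w * q2 p (w p)) * u p * u i
     = G * (q1 p (w p) * u p).
    by rewrite /G mulr_suml; apply: eq_bigr => i _; rewrite ltn_ord; ring.
  have Gb : `|G| <= p%:R * C * e.
    rewrite (le_trans (ler_norm_sum _ _ _))// -mulrA mulr_natl -[X in _ *+ X]card_ord -sumr_const.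
    by apply: ler_sum => i _; rewrite normrM ler_pM.
  have Qb : `|Q| <= p%:R ^+ 2 * C * e ^+ 2.
    rewrite (le_trans (ler_norm_sum _ _ _))// expr2 -!mulrA mulr_natl -[X in _ *+ X]card_ord -sumr_const.
    apply: ler_sum => i _.
    rewrite (le_trans (ler_norm_sum _ _ _))// mulr_natl -[X in _ *+ X]card_ord -sumr_const.
    by apply: ler_sum => j _; rewrite !normrM -mulrA expr2; apply: ler_pM => //; apply: ler_pM.
  have A3 := MTT w u e e01 ue; rewrite -/G -/Q in A3.
  have A0 := M0 (fun j => w j + u j).
  move: A3 A0; set A := f (fun j => w j + u j) => A3 A0.
  have B3 := le_trans (bT (w p) (u p)) (ler_wpM2l D0 (lerXn2r 3 (normr_ge0 _) e0 (ue p))).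
  move: B3; set B := q p (w p + u p) => B3.
  have x0 := b0 (w p); have x1 := b1 (w p); have x2 := b2 (w p).
  have up := ue p.
  move: (f w) (M0 w) (q p (w p)) (q1 p (w p)) (q2 p (w p)) (u p) A3 B3 x0 x1 x2 up.
  move=> fw fw0 y y1 y2 h A3 B3 x0 x1 x2 up.
  set P := fw + G + Q / 2.
  set S := y + y1 * h + y2 * h ^+ 2 / 2.
  have AP : `|A - P| <= C * e ^+ 3.
    by rewrite (_ : A - P = A - fw - G - Q / 2)//; rewrite /P; ring.
  have BS : `|B - S| <= D * e ^+ 3.
    by rewrite (_ : B - S = B - y - y1 * h - y2 * h ^+ 2 / 2)//; rewrite /S; ring.
  have h1 : `|h| <= 1 by exact: le_trans e1.
  have h2e : `|h ^+ 2| <= e ^+ 2 by rewrite normrX lerXn2r ?nnegrE.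
  have e21 : e ^+ 2 <= 1 by rewrite expr_le1.
  have h22 : `|h ^+ 2 / 2| <= 1.
    have h20 : 0 <= h ^+ 2 by exact: sqr_ge0.
    by move: h2e; rewrite !ger0_norm ?divr_ge0//; clear -e21; lra.
  have Sb : `|S| <= 3 * D.
    rewrite /S (le_trans (ler_normD _ _))// (_ : 3 * D = D + D + D); last by ring.
    apply: lerD; first rewrite (le_trans (ler_normD _ _))//.
      by apply: lerD => //; rewrite normrM -[leRHS]mulr1 ler_pM.
    by rewrite -mulrA normrM -[leRHS]mulr1 ler_pM.
  (* [P] and [S] are the second-order Taylor polynomials of the two factors; the last bracket is the
     part of their product of order 3 and 4. *)
  rewrite (_ : _ - _ = A * (B - S) + (A - P) * S +
    (G * (y2 * h ^+ 2) / 2 + Q * (y1 * h) / 2 + Q * (y2 * h ^+ 2) / 4)); last first.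
    by rewrite /P /S; field.
  have e30 : 0 <= e ^+ 3 by exact: exprn_ge0.
  have T1 : `|A * (B - S)| <= C * D * e ^+ 3 by rewrite normrM -mulrA ler_pM.
  have T2 : `|(A - P) * S| <= 3 * (C * D) * e ^+ 3.
    by rewrite normrM (_ : _ * e ^+ 3 = C * e ^+ 3 * (3 * D)); [rewrite ler_pM|ring].
  have yh2 : `|y2 * h ^+ 2| <= D * e ^+ 2 by rewrite normrM ler_pM.
  have yh1 : `|y1 * h| <= D * e by rewrite normrM ler_pM.
  have T3 : `|G * (y2 * h ^+ 2)| <= C * D * p%:R * e ^+ 3.
    rewrite normrM (_ : _ * e ^+ 3 = p%:R * C * e * (D * e ^+ 2)); [by rewrite ler_pM|ring].
  have T4 : `|Q * (y1 * h)| <= C * D * p%:R ^+ 2 * e ^+ 3.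
    rewrite normrM (_ : _ * e ^+ 3 = p%:R ^+ 2 * C * e ^+ 2 * (D * e)); [by rewrite ler_pM|ring].
  have T5 : `|Q * (y2 * h ^+ 2)| <= C * D * p%:R ^+ 2 * e ^+ 3.
    rewrite normrM (@le_trans _ _ (p%:R ^+ 2 * C * e ^+ 2 * (D * e)))//.
      rewrite ler_pM// (le_trans yh2)// ler_wpM2l// expr2 ler_piMr//.
    by rewrite le_eqVlt; apply/orP; left; apply/eqP; ring.
  rewrite KE; move: T1 T2 T3 T4 T5; rewrite !ler_norml.
  have X1 : 0 <= C * D * e ^+ 3 by exact: mulr_ge0.
  have X2 : 0 <= C * D * p%:R * e ^+ 3 by exact: mulr_ge0.
  have X3 : 0 <= C * D * p%:R ^+ 2 * e ^+ 3 by exact: mulr_ge0.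
  move: (A * (B - S)) ((A - P) * S) (G * (y2 * h ^+ 2)) (Q * (y1 * h)) (Q * (y2 * h ^+ 2)).
  move=> t1 t2 t3 t4 t5 /andP[lo1 up1] /andP[lo2 up2] /andP[lo3 up3] /andP[lo4 up4] /andP[lo5 up5].
  clear -X1 X2 X3 lo1 up1 lo2 up2 lo3 up3 lo4 up4 lo5 up5.
  by apply/andP; split; lra.
- move=> w; have /andP[e0 e1] := eta01.
  rewrite !big_ord_recr/= ltnn -/(f w) -/(f' w).
  have -> : \sum_(i < p) (if (i < p)%N then
      if (i < p)%N then H i i w * q p (w p) else g i w * q1 p (w p)
      else if (i < p)%N then g i w * q1 p (w p) else f w * q2 p (w p)) =
    (\sum_(i < p) H i i w) * q p (w p).
    by rewrite mulr_suml; apply: eq_bigr => i _; rewrite ltn_ord.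
  set h := \sum_(i < p) H i i w.
  have hb : `|h| <= p%:R * C.
    rewrite (le_trans (ler_norm_sum _ _ _))// mulr_natl -[X in _ *+ X]card_ord -sumr_const.
    by apply: ler_sum.
  have r3 := MH w; rewrite -/h in r3.
  have s3 := hq p (w p).
  move: (f w) (f' w) (M0 w) r3 (q p (w p)) (q' p (w p)) (q2 p (w p)) s3 (b0 (w p)) (bq' p (w p)) (b2 (w p)).
  move=> a a' ab r3 y y' y2 s3 yb y'b y2b.
  set r := a' - a - _ in r3; set s := y' - y - _ in s3.
  (* [r] and [s] are the smoothing remainders of the two factors; the first term is the product of
     the two second-order terms, of order eta^4. *)
  rewrite (_ : _ - _ = (eta ^+ 2 / 2 * h) * (eta ^+ 2 / 2 * y2) + r * y' +
     (a + eta ^+ 2 / 2 * h) * s); last by rewrite /r /s; field.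
  have e21 : eta ^+ 2 <= 1 by rewrite expr_le1.
  have E30 : 0 <= eta ^+ 3 by exact: exprn_ge0.
  have E43 : eta ^+ 4 <= eta ^+ 3 by rewrite exprSr ler_piMr.
  have T1 : `|eta ^+ 2 / 2 * h * (eta ^+ 2 / 2 * y2)| <= C * D * p%:R * eta ^+ 3 / 4.
    rewrite (_ : _ * _ = eta ^+ 4 / 4 * (h * y2)); last by field.
    rewrite normrM ger0_norm ?divr_ge0 ?exprn_ge0//.
    rewrite (_ : C * D * p%:R * eta ^+ 3 / 4 = eta ^+ 3 / 4 * (p%:R * C * D)); last by field.
    apply: ler_pM => //; first by rewrite divr_ge0// exprn_ge0.
      by rewrite ler_pM2r// invr_gt0.
    by rewrite normrM ler_pM.
  have T2 : `|r * y'| <= C * D * eta ^+ 3.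
    by rewrite normrM (_ : _ * eta ^+ 3 = C * eta ^+ 3 * D); [rewrite ler_pM|ring].
  have T3 : `|(a + eta ^+ 2 / 2 * h) * s| <= (C * D + C * D * p%:R) * eta ^+ 3.
    rewrite normrM (_ : _ * eta ^+ 3 = (C + p%:R * C) * (D * eta ^+ 3)); last by ring.
    apply: ler_pM => //; rewrite (le_trans (ler_normD _ _))// lerD//.
    rewrite normrM ger0_norm ?divr_ge0 ?sqr_ge0// -[leRHS]mul1r ler_pM//.
      by rewrite divr_ge0// sqr_ge0.
    lra.
  rewrite KE; move: T1 T2 T3; rewrite !ler_norml.
  have X1 : 0 <= C * D * eta ^+ 3 by exact: mulr_ge0.
  have X2 : 0 <= C * D * p%:R * eta ^+ 3 by exact: mulr_ge0.
  have X3 : 0 <= C * D * p%:R ^+ 2 * eta ^+ 3 by exact: mulr_ge0.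
  move: (eta ^+ 2 / 2 * h * (eta ^+ 2 / 2 * y2)) (r * y') ((a + eta ^+ 2 / 2 * h) * s).
  move=> t1 t2 t3 /andP[lo1 up1] /andP[lo2 up2] /andP[lo3 up3].
  clear -X1 X2 X3 lo1 up1 lo2 up2 lo3 up3.
  by apply/andP; split; lra.
Qed.

End multivariate_taylor.

(** * Lindeberg's method for sums of lagged products *)

Section lindeberg_step.
Context (d : measure_display) (Omega : measurableType d) (R : realType)
  (P : probability Omega R).

(* S0 is a partial sum that stops early enough for U to be uncorrelated with H i j (S0): the
   Hessian is moved from S to S0 at the price of a third-order error. *)
Lemma lindeberg_step (p : nat) (C eta e th : R) f f' g H
    (S S0 U : nat -> Omega -> R) (tau : nat -> R) :
  MT p C eta f f' g H -> 0 <= C -> 0 <= eta <= 1 -> 0 <= e -> e <= 1 ->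
  p%:R * e <= 1 ->
  (forall j, meas (S j)) -> (forall j, meas (S0 j)) -> (forall j, meas (U j)) ->
  (forall j w, `|U j w| <= e) ->
  (forall j w, `|S j w - S0 j w| <= p%:R * e) ->
  (forall j, (j < p)%N -> Ex P (fun w => g j (S ^~ w) * U j w) = 0) ->
  (forall i j, (i < p)%N -> (j < p)%N -> i != j ->
     Ex P (fun w => H i j (S0 ^~ w) * U i w * U j w) = 0) ->
  (forall i, (i < p)%N -> Ex P (fun w => H i i (S0 ^~ w) * U i w * U i w) =
     tau i * Ex P (fun w => H i i (S0 ^~ w))) ->
  (forall i, (i < p)%N -> `|tau i - eta ^+ 2| <= th) ->
  `|Ex P (fun w => f (fun j => S j w + U j w)) - Ex P (fun w => f' (S ^~ w))| <=
  C * (e ^+ 3 + p%:R ^+ 3 * e ^+ 3 / 2 + p%:R * th / 2 +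
       p%:R ^+ 2 * eta ^+ 2 * e / 2 + eta ^+ 3).
Proof.
move=> [M0 M1 M2 ML0 ML1 ML2 Mm0 Mm0' Mm1 Mm2 M0' MTT MH] C0 eta01 e0 e1 pe1
  mS mS0 mU Ue SS0 Eg Eij Eii Et.
have p0 : 0 <= p%:R :> R by [].
have pe0 : 0 <= p%:R * e by exact: mulr_ge0.
have mSU : forall j, meas (fun w => S j w + U j w).
  by move=> j; apply: measurable_funD; [exact: mS|exact: mU].
have Lf : L1 P (fun w => f (fun j => S j w + U j w)).
  by apply: (@L1_bounded _ _ _ _ _ C) => //; exact: (Mm0 _ _ _ mSU).
have LfS : L1 P (fun w => f (S ^~ w)).
  by apply: (@L1_bounded _ _ _ _ _ C) => //; exact: (Mm0 _ _ _ mS).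
have Lf' : L1 P (fun w => f' (S ^~ w)).
  by apply: (@L1_bounded _ _ _ _ _ C) => //; exact: (Mm0' _ _ _ mS).
have LgU j : L1 P (fun w => g j (S ^~ w) * U j w).
  apply: (@L1_bounded _ _ _ _ _ (C * e)).
    by apply: measurable_funM; [exact: (Mm1 _ _ _ _ mS)|exact: mU].
  by move=> w; rewrite normrM ler_pM.
have LHgen V i j : (forall k, meas (V k)) ->
    L1 P (fun w => H i j (V ^~ w) * U i w * U j w).
  move=> mV; apply: (@L1_bounded _ _ _ _ _ (C * e * e)).
    apply: measurable_funM; last exact: mU.
    by apply: measurable_funM; [exact: (Mm2 _ _ _ _ _ mV)|exact: mU].
  by move=> w; rewrite !normrM ler_pM// ler_pM.
have LHV V i : (forall k, meas (V k)) -> L1 P (fun w => H i i (V ^~ w)).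
  by move=> mV; apply: (@L1_bounded _ _ _ _ _ C) => //; exact: (Mm2 _ _ _ _ _ mV).
pose D1 := fun w => f (fun j => S j w + U j w) - f (S ^~ w) -
  \sum_(j < p) g j (S ^~ w) * U j w -
  2^-1 * (\sum_(i < p) \sum_(j < p) H i j (S ^~ w) * U i w * U j w).
have LD1 : L1 P D1.
  apply: L1B; first by apply: L1B; [exact: L1B|exact: L1_sum].
  by apply: L1Zl; apply: L1_sum => i _; apply: L1_sum => j _; exact: LHgen.
have ED1 : `|Ex P D1| <= C * e ^+ 3.
  apply: Ex_norm_le; first exact: L1_meas LD1.
  by move=> w; rewrite /D1 [2^-1 * _]mulrC; apply: MTT => //; rewrite e0.
pose HS i j := Ex P (fun w => H i j (S ^~ w) * U i w * U j w).
pose H0 i j := Ex P (fun w => H i j (S0 ^~ w) * U i w * U j w).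
have ED1E : Ex P D1 = Ex P (fun w => f (fun j => S j w + U j w)) -
    Ex P (fun w => f (S ^~ w)) - 2^-1 * \sum_(i < p) \sum_(j < p) HS i j.
  rewrite /D1 ExB//; last 2 first.
  - by apply: L1B; [exact: L1B|exact: L1_sum].
  - by apply: L1Zl; apply: L1_sum => i _; apply: L1_sum => j _; exact: LHgen.
  rewrite ExB//; [|exact: L1B|exact: L1_sum].
  rewrite ExB// ExZl; last first.
    by apply: L1_sum => i _; apply: L1_sum => j _; exact: LHgen.
  rewrite [Ex P (fun w => \sum_(j < p) _)]Ex_sum//.
  rewrite big1 ?subr0; last by move=> j _; exact: Eg.
  congr (_ - _ * _); rewrite Ex_sum; last first.
    by move=> i _; apply: L1_sum => j _; exact: LHgen.
  by apply: eq_bigr => i _; rewrite Ex_sum// => j _; exact: LHgen.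
pose D2 := fun w => f' (S ^~ w) - f (S ^~ w) -
  eta ^+ 2 / 2 * \sum_(i < p) H i i (S ^~ w).
have LD2 : L1 P D2.
  apply: L1B; first exact: L1B.
  by apply: L1Zl; apply: L1_sum => i _; exact: LHV.
have ED2 : `|Ex P D2| <= C * eta ^+ 3.
  by apply: Ex_norm_le; [exact: L1_meas LD2|move=> w; exact: MH].
pose h i := Ex P (fun w => H i i (S ^~ w)).
pose h0 i := Ex P (fun w => H i i (S0 ^~ w)).
have ED2E : Ex P D2 = Ex P (fun w => f' (S ^~ w)) - Ex P (fun w => f (S ^~ w)) -
    eta ^+ 2 / 2 * \sum_(i < p) h i.
  have LS : L1 P (fun w => \sum_(i < p) H i i (S ^~ w)).
    by apply: L1_sum => i _; exact: LHV.
  rewrite /D2 ExB; [|exact: L1B|exact: L1Zl].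
  rewrite ExB// ExZl//; congr (_ - _ * _); rewrite Ex_sum// => i _; exact: LHV.
have HSL w : exists u, (forall j, `|u j| <= p%:R * e) /\ (fun j => S0 j w + u j) = S ^~ w.
  exists (fun j => S j w - S0 j w); split; first by move=> j.
  by apply/funext => j; rewrite subrKC.
have HLip i j w : `|H i j (S ^~ w) - H i j (S0 ^~ w)| <= C * (p%:R * e).
  have [u [ub <-]] := HSL w.
  by apply: ML2 => //; rewrite pe0.
have HSH0 i j : `|HS i j - H0 i j| <= C * (p%:R * e) * (e * e).
  rewrite /HS /H0 -ExB; [|exact: LHgen|exact: LHgen].
  apply: Ex_norm_le.
    by apply: L1_meas; apply: L1B; exact: LHgen.
  move=> w; rewrite (_ : _ - _ = (H i j (S ^~ w) - H i j (S0 ^~ w)) * (U i w * U j w)); last by ring.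
  rewrite normrM; apply: ler_pM => //.
  by rewrite normrM ler_pM.
have hh0 i : `|h i - h0 i| <= C * (p%:R * e).
  rewrite /h /h0 -ExB; [|exact: LHV|exact: LHV].
  apply: Ex_norm_le => //.
  by apply: L1_meas; apply: L1B; exact: LHV.
have h0C i : `|h0 i| <= C by apply: Ex_norm_le => //; exact: (Mm2 _ _ _ _ _ mS0).
have sumH0 : \sum_(i < p) \sum_(j < p) H0 i j = \sum_(i < p) tau i * h0 i.
  apply: eq_bigr => i _; rewrite (bigD1 i)//= big1 ?addr0; first exact: Eii.
  by move=> j ji; apply: Eij => //; rewrite eq_sym.
pose A1 := \sum_(i < p) \sum_(j < p) (HS i j - H0 i j).
pose A2 := \sum_(i < p) (tau i * h0 i - eta ^+ 2 * h i).
have A1b : `|A1| <= p%:R * (p%:R * (C * (p%:R * e) * (e * e))).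
  rewrite (le_trans (ler_norm_sum _ _ _))// mulr_natl -[X in _ *+ X]card_ord -sumr_const.
  apply: ler_sum => i _.
  rewrite (le_trans (ler_norm_sum _ _ _))// mulr_natl -[X in _ *+ X]card_ord -sumr_const.
  by apply: ler_sum.
have eta20 : 0 <= eta ^+ 2 by exact: sqr_ge0.
have A2b : `|A2| <= p%:R * (th * C + eta ^+ 2 * (C * (p%:R * e))).
  rewrite (le_trans (ler_norm_sum _ _ _))// mulr_natl -[X in _ *+ X]card_ord -sumr_const.
  apply: ler_sum => i _.
  rewrite (_ : _ - _ = (tau i - eta ^+ 2) * h0 i + eta ^+ 2 * (h0 i - h i)); last by ring.
  rewrite (le_trans (ler_normD _ _))// lerD//.
    by rewrite normrM ler_pM// Et.
  by rewrite normrM ger0_norm// ler_wpM2l// distrC.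
have A1E : A1 = \sum_(i < p) \sum_(j < p) HS i j - \sum_(i < p) tau i * h0 i.
  by rewrite /A1 -sumH0 -sumrB; apply: eq_bigr => i _; rewrite sumrB.
have A2E : A2 = \sum_(i < p) tau i * h0 i - eta ^+ 2 * \sum_(i < p) h i.
  by rewrite /A2 sumrB mulr_sumr.
(* The first-order terms have mean zero. Four errors are left: the Taylor remainder [D1], the
   smoothing remainder [D2], the passage from [S] to [S0] in the quadratic form ([A1]), and the
   mismatch between the variances and Hessians of the two sides ([A2]). *)
have -> : Ex P (fun w => f (fun j => S j w + U j w)) - Ex P (fun w => f' (S ^~ w)) =
    Ex P D1 + 2^-1 * A1 + 2^-1 * A2 - Ex P D2.
  by rewrite ED1E ED2E A1E A2E; field.
move: A1b A2b ED1 ED2; rewrite !ler_norml.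
move: (Ex P D1) (Ex P D2) A1 A2 {A1E A2E ED1E ED2E} => x1 x2 x3 x4.
move=> /andP[? ?] /andP[? ?] /andP[? ?] /andP[? ?].
rewrite (_ : C * _ = C * e ^+ 3 + p%:R * (p%:R * (C * (p%:R * e) * (e * e))) / 2 +
  p%:R * (th * C + eta ^+ 2 * (C * (p%:R * e))) / 2 + C * eta ^+ 3); last by field.
by apply/andP; split; lra.
Qed.

End lindeberg_step.

Lemma TC_le (R : realType) (D D' : R) q q1 q2 : D <= D' -> TC D q q1 q2 -> TC D' q q1 q2.
Proof.
move=> DD [b0 b1 b2 bT l0 l1 l2]; split.
- by move=> x; exact: le_trans DD.
- by move=> x; exact: le_trans DD.
- by move=> x; exact: le_trans DD.
- by move=> x h; rewrite (le_trans (bT _ _))// ler_wpM2r// exprn_ge0.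
- by move=> x h; rewrite (le_trans (l0 _ _))// ler_wpM2r.
- by move=> x h; rewrite (le_trans (l1 _ _))// ler_wpM2r.
- by move=> x h; rewrite (le_trans (l2 _ _))// ler_wpM2r.
Qed.

Section bounded_clt.
Context (d : measure_display) (Omega : measurableType d) (R : realType)
  (P : probability Omega R) (X : nat -> {RV P >-> R}).
Hypothesis indepX : mutually_independent P X.
Variables (z : R -> R) (B v : R).
Hypothesis mz : measurable_fun [set: R] z.
Hypothesis zB : forall x, `|z x| <= B.
Hypothesis Ez : forall t, Ex P (z \o X t) = 0.
Hypothesis Ez2 : forall t, Ex P (fun w => z (X t w) ^+ 2) = v.

Local Notation adaptedto n := (adapted X (iota 0 n)).

Lemma adapted_z n k : (k < n)%N -> adaptedto n (fun w => z (X k w)).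
Proof. by move=> kn; apply: (adapted_comp _ mz); rewrite mem_iota. Qed.

Lemma Ex_past n (A : Omega -> R) (g : R -> R) (K K' : R) : adaptedto n A -> (forall w, `|A w| <= K) ->
  measurable_fun [set: R] g -> (forall x, `|g x| <= K') ->
  Ex P (fun w => A w * g (X n w)) = Ex P A * Ex P (fun w => g (X n w)).
Proof.
move=> aA bA mg bg.
have un : uniq (n :: iota 0 n) by rewrite /= iota_uniq mem_iota ltnn.
apply: (Ex_mul_past indepX un aA mg _ _).2.
- by apply: L1_bounded bA; exact: adapted_meas aA.
- apply: (@L1_bounded _ _ _ _ _ K'); first exact: measurableT_comp.
  by move=> w; exact: (bg (X n w)).
Qed.

Lemma meas_z t : meas (fun w => z (X t w)).
Proof. exact: measurableT_comp. Qed.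

Variables (p : nat) (T : nat) (c : nat -> nat -> R).

(** On the range that matters, p < t and j < p, so the truncated subtraction [t - j.+1] is exact and
    positive. *)
Definition incr (t j : nat) (w : Omega) : R :=
  (Num.sqrt T%:R)^-1 * c t j * (z (X t w) * z (X (t - j.+1)%N w)).

Definition psum (t j : nat) (w : Omega) : R :=
  \sum_(p.+1 <= s < t.+1) incr s j w.

Lemma adapted_psum n t j : (t < n)%N -> adaptedto n (psum t j).
Proof.
move=> tn; rewrite /psum.
(* The guard holds throughout the sum; it makes every summand measurable for the past, whatever its
   index. *)
apply: (eq_measurable_fun (fun w : past X (iota 0 n) =>
  \sum_(s <- index_iota p.+1 t.+1) (if (s < n)%N then incr s j w else 0))).
  move=> w _; rewrite big_seq [RHS]big_seq; apply: eq_bigr => s.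
  by rewrite mem_index_iota => /andP[_ st]; rewrite (leq_ltn_trans _ tn).
apply: measurable_sum => s; case sn: (s < n)%N => //.
apply: measurable_funM => //; apply: measurable_funM; first exact: adapted_z.
by apply: adapted_z; rewrite (leq_ltn_trans _ sn)// leq_subr.
Qed.

Lemma meas_incr t j : meas (incr t j).
Proof.
by apply: measurable_funM => //; apply: measurable_funM; exact: meas_z.
Qed.

Lemma meas_psum t j : meas (psum t j).
Proof. by apply: measurable_sum => s; exact: meas_incr. Qed.

Lemma psumS t j w : (p < t)%N -> psum t j w = psum t.-1 j w + incr t j w.
Proof. by move=> pt; rewrite /psum prednK ?(leq_ltn_trans _ pt)// big_nat_recr. Qed.

Variables (A : R).
Hypothesis T0 : (0 < T)%N.
Hypothesis A0 : 0 <= A.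
Hypothesis cA : forall t j, (p < t <= T)%N -> `|c t j| <= A.
Local Notation rho := ((Num.sqrt T%:R)^-1 : R).

Let rho0 : 0 <= rho. Proof. by rewrite invr_ge0. Qed.
Let rho2 : rho ^+ 2 = T%:R^-1. Proof. by rewrite exprVn sqr_sqrtr. Qed.
Let B0 : 0 <= B. Proof. exact: le_trans (zB 0). Qed.

Lemma incr_bound t j w : (p < t <= T)%N -> `|incr t j w| <= A * B ^+ 2 * rho.
Proof.
move=> ptT; rewrite /incr !normrM (ger0_norm rho0) expr2.
rewrite (_ : A * (B * B) * rho = rho * A * (B * B)); last by ring.
have h1 : rho * `|c t j| <= rho * A by rewrite ler_wpM2l// cA.
have h2 : `|z (X t w)| * `|z (X (t - j.+1)%N w)| <= B * B by exact: ler_pM.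
by apply: ler_pM => //; rewrite mulr_ge0.
Qed.

Lemma psum_lag_bound t j w : (p < t <= T)%N ->
  `|psum t.-1 j w - psum (t.-1 - p) j w| <= p%:R * (A * B ^+ 2 * rho).
Proof.
move=> /andP[pt tT].
have e0 : 0 <= A * B ^+ 2 * rho by rewrite !mulr_ge0.
have H n : (n <= t.-1)%N ->
    `|psum t.-1 j w - psum (t.-1 - n) j w| <= n%:R * (A * B ^+ 2 * rho).
  elim: n => [|n IH] nt; first by rewrite subn0 subrr normr0 mul0r.
  rewrite (_ : psum t.-1 j w - psum (t.-1 - n.+1) j w = psum t.-1 j w - psum (t.-1 - n) j w +
    (psum (t.-1 - n) j w - psum (t.-1 - n.+1) j w)); last by ring.
  rewrite (le_trans (ler_normD _ _))// -natr1 mulrDl mul1r lerD ?IH ?(ltnW nt)//.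
  have [ptn|ptn] := ltnP p (t.-1 - n); last first.
    rewrite /psum !big_geq ?subrr ?normr0//; lia.
  rewrite (psumS _ _ ptn) (_ : (t.-1 - n).-1 = (t.-1 - n.+1)%N); last by lia.
  by rewrite addrAC subrr add0r incr_bound//; lia.
by apply: H; lia.
Qed.

(** A common value, up to O(1/T), of the squared coefficients of all lags. Thanks to it a single
    Gaussian variance per step serves all coordinates. *)
Variable (r : nat -> R).
Hypothesis rA : forall t, (p < t <= T)%N -> 0 <= r t <= A ^+ 2.
Hypothesis cr : forall t j, (p < t <= T)%N -> (j < p)%N ->
  `|c t j ^+ 2 - r t| <= A / T%:R.
Variables (D D' : R) (q q1 q2 : nat -> R -> R).
Hypothesis qTC : forall j, TC D (q j) (q1 j) (q2 j).
Hypothesis DD : D <= D'.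
Hypothesis Dm3 : D * m3 R <= D'.

Let v0 : 0 <= v. Proof. by rewrite -(Ez2 0); exact: Ex_sqr_ge0. Qed.

(** Approximate variance of the increment at time [t]: one factor [v] for each of the two
    observations in the lagged product. *)
Definition vstep t := v ^+ 2 * r t / T%:R.
Definition vrem t := \sum_(t.+1 <= s < T.+1) vstep s.
(* The test functions smoothed by the variance that is still to come after time t. *)
Definition Qs t j := gsm (Num.sqrt (vrem t)) (q j).

Let vstep0 t : (p < t <= T)%N -> 0 <= vstep t.
Proof.
by move=> /rA/andP[r0 _]; rewrite /vstep divr_ge0// mulr_ge0// sqr_ge0.
Qed.

Let vrem0 t : (p <= t)%N -> 0 <= vrem t.
Proof.
move=> pt; rewrite /vrem big_nat_cond sumr_ge0// => s; rewrite andbT => /andP[ts sT].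
by apply: vstep0; lia.
Qed.

Let vremS t : (p < t <= T)%N -> vrem t.-1 = vstep t + vrem t.
Proof. by move=> /andP[pt tT]; rewrite /vrem prednK ?(leq_ltn_trans _ pt)// big_ltn. Qed.

Let D0 : 0 <= D. Proof. exact: le_trans (tc0 (qTC 0) 0). Qed.

(** One of at most T replacements, each costing O(T^(-3/2)). Going from [t] to [t.-1] trades the
    increment at [t] for a Gaussian of variance [vstep t], because [Qs t.-1] is [Qs t] smoothed once
    more. The long hypothesis is the conclusion of [MT_prod]: taking it as an assumption fixes [C]
    before [T] and [t]. *)
Lemma lindeberg_incr (C : R) t : (p < t <= T)%N -> 0 <= C ->
  (forall (eta : R) (q q1 q2 q' : nat -> R -> R), 0 <= eta <= 1 ->
  (forall j, TC D' (q j) (q1 j) (q2 j)) ->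
  (forall j, measurable_fun [set: R] (q' j)) ->
  (forall j x, `|q' j x| <= D') ->
  (forall j x, `|q' j x - q j x - eta ^+ 2 / 2 * q2 j x| <= D' * eta ^+ 3) ->
  exists g H, MT p C eta (fun w => \prod_(j < p) q j (w j))
    (fun w => \prod_(j < p) q' j (w j)) g H) ->
  A * B ^+ 2 * rho <= 1 -> p%:R * (A * B ^+ 2 * rho) <= 1 -> v * A * rho <= 1 ->
  `|Ex P (fun w => \prod_(j < p) Qs t j (psum t j w)) -
    Ex P (fun w => \prod_(j < p) Qs t.-1 j (psum t.-1 j w))| <=
  C * ((A * B ^+ 2) ^+ 3 + p%:R ^+ 3 * (A * B ^+ 2) ^+ 3 / 2 + p%:R * (v ^+ 2 * A) / 2 +
       p%:R ^+ 2 * (v * A) ^+ 2 * (A * B ^+ 2) / 2 + (v * A) ^+ 3) * rho ^+ 3.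
Proof.
move=> ptT C0 HMT e1 pe1 va1; have /andP[pt tT] := ptT.
have n1 : (t.-1 < t)%N by clear -pt; lia.
have n2 : (t.-1 - p < t)%N by clear -pt; lia.
have n3 i : (t - i.+1 < t)%N by clear -pt; lia.
have n4 i : (i < p)%N -> (t.-1 - p < t - i.+1)%N by clear -pt; lia.
have n5 i j : (i < j)%N -> (j < p)%N -> (t - j.+1 < t - i.+1)%N by clear -pt; lia.
set e := A * B ^+ 2 * rho in e1 pe1.
have e0 : 0 <= e by rewrite !mulr_ge0.
have /andP[r0 r1] := rA ptT.
pose eta := Num.sqrt (vstep t).
have eta0 : 0 <= eta by exact: sqrtr_ge0.
have eta2 : eta ^+ 2 = vstep t by rewrite sqr_sqrtr// vstep0.
have etaE : eta <= v * A * rho.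
  rewrite -(ler_pXn2r (n := 2)) ?nnegrE ?mulr_ge0// eta2 /vstep !exprMn rho2.
  by rewrite ler_wpM2r// ler_wpM2l// sqr_ge0.
have eta1 : eta <= 1 by exact: le_trans va1.
have QTC j : TC D (Qs t j) (gsm (Num.sqrt (vrem t)) (q1 j)) (gsm (Num.sqrt (vrem t)) (q2 j)).
  exact: gsm_TC.
have QE j : Qs t.-1 j = gsm eta (Qs t j).
  apply/funext => x; rewrite /Qs (gsm_gsm _ eta0 _ (tc0 (qTC j)) (tcL0 (qTC j)))//.
  by rewrite eta2 sqr_sqrtr ?vrem0 ?(ltnW pt)// vremS.
have [||||g [H M]] := HMT eta (fun j => Qs t j) (fun j => gsm (Num.sqrt (vrem t)) (q1 j))
    (fun j => gsm (Num.sqrt (vrem t)) (q2 j)) (fun j => Qs t.-1 j) _ (fun j => TC_le DD (QTC j)).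
- by rewrite eta0.
- by move=> j; rewrite QE; exact: lip_measurable (tcL0 (gsm_TC eta (QTC j))).
- by move=> j x; rewrite QE (le_trans _ DD)//; exact: (tc0 (gsm_TC eta (QTC j))).
- move=> j x; rewrite QE (le_trans (gsm_heat _ eta0 (QTC j)))//.
  by rewrite ler_wpM2r// exprn_ge0.
clear HMT.
have m0 := mtm0 M; have m1 := mtm1 M; have m2 := mtm2 M.
have ag j : adaptedto t (fun w => g j (psum t.-1 ^~ w)).
  apply: (m1 j _ _ (fun k (w : past X (iota 0 t)) => psum t.-1 k w)) => k.
  exact: adapted_psum.
have aH i j n : (t.-1 - p < n)%N -> adaptedto n (fun w => H i j (psum (t.-1 - p) ^~ w)).
  move=> pn; apply: (m2 i j _ _ (fun k (w : past X (iota 0 n)) => psum (t.-1 - p) k w)) => k.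
  exact: adapted_psum.
have mz2 : measurable_fun [set: R] (fun x => z x ^+ 2) by exact: measurable_funX.
have bz2 x : `|z x ^+ 2| <= B ^+ 2 by rewrite normrX lerXn2r ?nnegrE.
pose K i j w := H i j (psum (t.-1 - p) ^~ w).
have KC i j w : `|K i j w| <= C by exact: (mt2 M).
(* The factor z (X t)^2 is independent of everything else and integrates to [v]. *)
have E3 i j : (i < p)%N -> (j < p)%N ->
    Ex P (fun w => K i j w * incr t i w * incr t j w) =
    rho ^+ 2 * c t i * c t j * v *
    Ex P (fun w => K i j w * z (X (t - i.+1)%N w) * z (X (t - j.+1)%N w)).
  move=> ip jp.
  rewrite (@eq_Ex _ _ _ _ _ (fun w => (rho ^+ 2 * c t i * c t j) *
    (K i j w * z (X (t - i.+1)%N w) * z (X (t - j.+1)%N w) * z (X t w) ^+ 2))); last first.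
    by move=> w; rewrite /incr; ring.
  have aKzz : adaptedto t (fun w => K i j w * z (X (t - i.+1)%N w) * z (X (t - j.+1)%N w)).
    apply: measurable_funM; last exact: adapted_z.
    by apply: measurable_funM; [exact: aH|exact: adapted_z].
  have bKzz w : `|K i j w * z (X (t - i.+1)%N w) * z (X (t - j.+1)%N w)| <= C * B * B.
    by rewrite !normrM ler_pM// ler_pM.
  rewrite ExZl; last first.
    apply: (@L1_bounded _ _ _ _ _ (C * B * B * B ^+ 2)); last first.
      by move=> w; rewrite normrM ler_pM.
    apply: measurable_funM; first exact: adapted_meas aKzz.
    by apply: measurable_funX; exact: meas_z.
  by rewrite (Ex_past aKzz bKzz mz2 bz2) Ez2; ring.
(* The sum stopped at t - 1 - p involves no index beyond t - 1 - p, and every lagged index t - i - 1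
   with i < p is larger. So the more recent of two distinct lagged variables is independent of the
   other factors, and it is centred. *)
have E2 i j : (i < p)%N -> (j < p)%N -> (i < j)%N -> forall K' : Omega -> R,
    (forall n, (t.-1 - p < n)%N -> adaptedto n K') -> (forall w, `|K' w| <= C) ->
    Ex P (fun w => K' w * z (X (t - j.+1)%N w) * z (X (t - i.+1)%N w)) = 0.
  move=> ip jp ij K' aK' bK'.
  have aKz : adaptedto (t - i.+1) (fun w => K' w * z (X (t - j.+1)%N w)).
    by apply: measurable_funM; [apply: aK'; exact: n4|apply: adapted_z; exact: n5].
  have bKz w : `|K' w * z (X (t - j.+1)%N w)| <= C * B by rewrite normrM ler_pM.
  rewrite (Ex_past aKz bKz mz zB).
  by have := Ez (t - i.+1)%N; rewrite /comp => ->; rewrite mulr0.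
have EL : Ex P (fun w => \prod_(j < p) Qs t j (psum t j w)) =
    Ex P (fun w => \prod_(j < p) Qs t j (psum t.-1 j w + incr t j w)).
  by apply: eq_Ex => w; apply: eq_bigr => j _; rewrite psumS.
rewrite {}EL; apply: (@le_trans _ _ (C * (e ^+ 3 + p%:R ^+ 3 * e ^+ 3 / 2 +
    p%:R * (v ^+ 2 * A * rho ^+ 3) / 2 + p%:R ^+ 2 * eta ^+ 2 * e / 2 + eta ^+ 3))).
  apply: (@lindeberg_step _ _ _ P p C eta e (v ^+ 2 * A * rho ^+ 3)
    (fun w => \prod_(j < p) Qs t j (w j)) (fun w => \prod_(j < p) Qs t.-1 j (w j)) g H
    (psum t.-1) (psum (t.-1 - p)) (incr t) (fun i => v ^+ 2 * c t i ^+ 2 / T%:R)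
    M C0 _ e0 e1 pe1).
  - by rewrite eta0.
  - by move=> j; exact: meas_psum.
  - by move=> j; exact: meas_psum.
  - by move=> j; exact: meas_incr.
  - by move=> j w; exact: incr_bound.
  - by move=> j w; exact: psum_lag_bound.
  - move=> j jp.
    rewrite (@eq_Ex _ _ _ _ _ (fun w => (rho * c t j * (g j (psum t.-1 ^~ w) *
      z (X (t - j.+1)%N w))) * z (X t w))); last first.
      by move=> w; rewrite /incr; ring.
    have aA : adaptedto t (fun w => rho * c t j * (g j (psum t.-1 ^~ w) * z (X (t - j.+1)%N w))).
      apply: measurable_funM; first exact: measurable_cst.
      by apply: measurable_funM; [exact: ag|exact: adapted_z].
    have bA w : `|rho * c t j * (g j (psum t.-1 ^~ w) * z (X (t - j.+1)%N w))| <=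
        rho * A * (C * B).
      rewrite !normrM (ger0_norm rho0); apply: ler_pM; rewrite ?mulr_ge0//.
        by rewrite ler_wpM2l// cA.
      by apply: ler_pM => //; exact: (mt1 M).
    rewrite (Ex_past aA bA mz zB).
    by have := Ez t; rewrite /comp => ->; rewrite mulr0.
  - move=> i j ip jp ij; rewrite -/(K i j) E3//.
    rewrite (_ : Ex P _ = 0) ?mulr0//.
    have [ij'|ji] := ltnP i j.
      rewrite -[RHS](E2 _ _ ip jp ij' (K i j))//; last by move=> n; exact: aH.
      by apply: eq_Ex => w; ring.
    have ji' : (j < i)%N by rewrite ltn_neqAle eq_sym ij.
    by apply: (E2 _ _ jp ip ji' (K i j)) => // n; exact: aH.
  - move=> i ip; rewrite -/(K i i) E3//.
    rewrite (@eq_Ex _ _ _ _ _ (fun w => K i i w * z (X (t - i.+1)%N w) ^+ 2)); last first.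
      by move=> w; ring.
    have aK : adaptedto (t - i.+1) (K i i) by apply: aH; exact: n4.
    by rewrite (Ex_past aK (KC i i) mz2 bz2) Ez2 rho2; ring.
  - move=> i ip; rewrite eta2 /vstep -mulrBl -mulrBr.
    have T1 : 1 <= T%:R :> R by rewrite ler1n.
    rewrite 2!normrM (ger0_norm (sqr_ge0 v)) (@ger0_norm _ T%:R^-1) ?invr_ge0//.
    rewrite -rho2 -[leLHS]mulrA -[leRHS]mulrA ler_wpM2l ?sqr_ge0//.
    apply: (@le_trans _ _ (A / T%:R * rho ^+ 2)); first by rewrite ler_wpM2r ?sqr_ge0// cr.
    rewrite -rho2 -mulrA ler_wpM2l// -exprD ler_wiXn2l//.
    by rewrite invf_le1 ?sqrtr_gt0 ?ltr0n// -[leLHS]sqrtr1 ler_wsqrtr.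
rewrite -[leRHS]mulrA ler_wpM2l//.
have eta2A : eta ^+ 2 <= (v * A * rho) ^+ 2 by rewrite lerXn2r ?nnegrE ?mulr_ge0.
have eta3A : eta ^+ 3 <= (v * A * rho) ^+ 3 by rewrite lerXn2r ?nnegrE ?mulr_ge0.
have H1 : p%:R ^+ 2 * eta ^+ 2 * e / 2 <= p%:R ^+ 2 * (v * A * rho) ^+ 2 * e / 2.
  by rewrite ler_wpM2r ?invr_ge0// ler_wpM2r// ler_wpM2l ?sqr_ge0.
rewrite [leRHS](_ : _ = e ^+ 3 + p%:R ^+ 3 * e ^+ 3 / 2 + p%:R * (v ^+ 2 * A * rho ^+ 3) / 2
    + p%:R ^+ 2 * (v * A * rho) ^+ 2 * e / 2 + (v * A * rho) ^+ 3); last first.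
  by rewrite /e; move: (rho) => x; field.
by rewrite lerD// lerD.
Qed.

End bounded_clt.

Section bounded_clt_limit.
Context (d : measure_display) (Omega : measurableType d) (R : realType)
  (P : probability Omega R) (X : nat -> {RV P >-> R}).
Hypothesis indepX : mutually_independent P X.
Variables (z : R -> R) (B v : R).
Hypothesis mz : measurable_fun [set: R] z.
Hypothesis zB : forall x, `|z x| <= B.
Hypothesis Ez : forall t, Ex P (z \o X t) = 0.
Hypothesis Ez2 : forall t, Ex P (fun w => z (X t w) ^+ 2) = v.

Lemma cvg_invsqrt : (Num.sqrt (T%:R : R))^-1 @[T --> \oo] --> (0 : R).
Proof.
have : Num.sqrt ((T%:R : R)^-1) @[T --> \oo] --> Num.sqrt (0 : R).
  apply: continuous_cvg; first exact: sqrt_continuous.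
  apply/gtr0_cvgV0; last exact: cvgr_idn.
  by near=> n; rewrite ltr0n; near: n; exact: nbhs_infty_gt.
rewrite sqrtr0; apply: cvg_trans; apply: near_eq_cvg; near=> T.
by rewrite sqrtrV.
Unshelve. all: by end_near. Qed.

(** Telescoping from t = T down to t = p: at t = T no variance is left and the smoothing is trivial,
    at t = p the sums are empty and the product is the deterministic Gaussian mean. The T steps of
    size T^(-3/2) add up to O(T^(-1/2)). *)
Lemma bounded_clt (p : nat) (c : nat -> nat -> nat -> R) (r : nat -> nat -> R)
    (A D s2 : R) (q q1 q2 : nat -> R -> R) : 0 <= A ->
  (forall T t j, (p < t <= T)%N -> `|c T t j| <= A) ->
  (forall T t, (p < t <= T)%N -> 0 <= r T t <= A ^+ 2) ->
  (forall T t j, (p < t <= T)%N -> (j < p)%N -> `|c T t j ^+ 2 - r T t| <= A / T%:R) ->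
  (forall j, TC D (q j) (q1 j) (q2 j)) ->
  \sum_(p.+1 <= t < T.+1) v ^+ 2 * r T t / T%:R @[T --> \oo] --> s2 ->
  Ex P (fun w => \prod_(j < p) q j (psum X z p T (c T) T j w)) @[T --> \oo] -->
  \prod_(j < p) gsm (Num.sqrt s2) (q j) 0.
Proof.
move=> A0 cA rA cr qTC rs.
have D0 : 0 <= D by exact: le_trans (tc0 (qTC 0%N) 0).
have v0 : 0 <= v by rewrite -(Ez2 0%N); exact: Ex_sqr_ge0.
have m30 := m3_ge0 R.
(* Dominates [D] and also [D * m3 R], the constant in the remainder of [gsm_heat]. *)
pose D' := D * (1 + m3 R).
have DD : D <= D' by rewrite /D' mulrDr mulr1 lerDl mulr_ge0.
have Dm3 : D * m3 R <= D' by rewrite /D' mulrDr mulr1 lerDr.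
have [C C0 HC] := @MT_prod R p D' (le_trans D0 DD).
pose rho (T : nat) := (Num.sqrt (T%:R : R))^-1.
have rho0 T : 0 <= rho T by rewrite invr_ge0.
pose L := C * ((A * B ^+ 2) ^+ 3 + p%:R ^+ 3 * (A * B ^+ 2) ^+ 3 / 2 + p%:R * (v ^+ 2 * A) / 2 +
       p%:R ^+ 2 * (v * A) ^+ 2 * (A * B ^+ 2) / 2 + (v * A) ^+ 3).
have main : Ex P (fun w => \prod_(j < p) q j (psum X z p T (c T) T j w)) -
    \prod_(j < p) Qs v T (r T) q p j 0 @[T --> \oo] --> 0.
  have rL : L * rho T @[T --> \oo] --> 0.
    by rewrite -[X in _ --> X](mulr0 L); apply: cvgMr; exact: cvg_invsqrt.
  have small (k : R) : \forall T \near \oo, k * rho T <= 1.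
    have : k * rho T @[T --> \oo] --> 0.
      by rewrite -[X in _ --> X](mulr0 k); apply: cvgMr; exact: cvg_invsqrt.
    by move=> /cvgr_lt /(_ _ ltr01); apply: filterS => T /ltW.
  apply/norm_cvg0P; apply: (squeeze_cvgr _ (cvg_cst 0) rL).
  near=> T; rewrite normr_ge0 /=.
  have pT : (p < T)%N by near: T; exact: nbhs_infty_gt.
  have T0 : (0 < T)%N by exact: leq_ltn_trans pT.
  have e1 : A * B ^+ 2 * rho T <= 1 by near: T; exact: small.
  have e2 : p%:R * (A * B ^+ 2 * rho T) <= 1.
    by rewrite mulrA; near: T; exact: small.
  have e3 : v * A * rho T <= 1 by near: T; exact: small.
  have step t : (p < t <= T)%N ->
    `|Ex P (fun w => \prod_(j < p) Qs v T (r T) q t j (psum X z p T (c T) t j w)) -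
    Ex P (fun w => \prod_(j < p) Qs v T (r T) q t.-1 j (psum X z p T (c T) t.-1 j w))| <=
      L * rho T ^+ 3.
    move=> ptT; exact: (@lindeberg_incr _ _ _ _ _ indepX z B v mz zB Ez Ez2 p T (c T) A T0 A0
      (cA T) (r T) (rA T) (cr T) D D' q q1 q2 qTC DD Dm3).
  have tele n : (p + n <= T)%N ->
    `|Ex P (fun w => \prod_(j < p) Qs v T (r T) q (p + n)%N j (psum X z p T (c T) (p + n)%N j w)) -
    Ex P (fun w => \prod_(j < p) Qs v T (r T) q p j (psum X z p T (c T) p j w))| <=
      n%:R * (L * rho T ^+ 3).
    elim: n => [|n IH] nT; first by rewrite addn0 subrr normr0 mul0r.
    have nT' : (p + n <= T)%N by rewrite (leq_trans _ nT)// leq_add2l.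
    have ptT : (p < p + n.+1 <= T)%N by rewrite nT andbT -[ltnLHS]addn0 ltn_add2l.
    have S1 := step _ ptT; have S2 := IH nT'; move: S1 S2; rewrite addnS /= => S1 S2.
    rewrite -natr1 mulrDl mul1r (addrC (n%:R * _)).
    exact: le_trans (ler_distD _ _ _) (lerD S1 S2).
  have LT : L * rho T = T%:R * (L * rho T ^+ 3).
    rewrite (_ : T%:R * _ = L * rho T * (T%:R * rho T ^+ 2)); last by ring.
    by rewrite /rho exprVn sqr_sqrtr// mulfV ?mulr1// pnatr_eq0 -lt0n.
  have L0 : 0 <= L * rho T ^+ 3.
    by apply: le_trans (normr_ge0 _) (step p.+1 _); rewrite ltnSn.
  have := tele (T - p)%N; rewrite subnKC ?(ltnW pT)// => /(_ (leqnn T)) TE.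
  rewrite LT (le_trans _ (ler_wpM2r _ (_ : (T - p)%:R <= T%:R)))//.
  - rewrite (le_trans _ TE)// le_eqVlt; apply/orP; left; apply/eqP; congr `| _ - _ |.
      apply: eq_Ex => w; apply: eq_bigr => j _.
      by rewrite /Qs /vrem big_geq// sqrtr0 gsm0.
    rewrite -[LHS](Ex_cst P); apply: eq_Ex => w; apply: eq_bigr => j _.
    by rewrite [in RHS]/psum big_geq.
  - by rewrite ler_nat leq_subr.
have lim2 : \prod_(j < p) Qs v T (r T) q p j 0 @[T --> \oo] --> \prod_(j < p) gsm (Num.sqrt s2) (q j) 0.
  apply: cvg_big => [|j _]; first exact: mul_continuous.
  have cs : Num.sqrt (vrem v T (r T) p) @[T --> \oo] --> Num.sqrt s2.
    by apply: continuous_cvg => //; exact: sqrt_continuous.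
  have k0 : D * `|Num.sqrt (vrem v T (r T) p) - Num.sqrt s2| * Ex (gam R) (fun z : R => `|z|)
      @[T --> \oo] --> 0.
    rewrite -[X in _ --> X](mul0r (Ex (gam R) (fun z : R => `|z|))).
    apply: cvgMl; rewrite -[X in _ --> X](mulr0 D); apply: cvgMr.
    by apply/norm_cvg0P; apply/subr_cvg0.
  apply/subr_cvg0.
  apply/norm_cvg0P; apply: (squeeze_cvgr _ (cvg_cst 0) k0).
  near=> T; rewrite normr_ge0 /=.
  exact: gsm_scale_lip (tc0 (qTC j)) (tcL0 (qTC j)).
exact: (cvg_sub0 main lim2).
Unshelve. all: by end_near. Qed.

End bounded_clt_limit.

(** * Quadratic forms in independent variables *)

Section quadratic_forms.
Context (d : measure_display) (Omega : measurableType d) (R : realType)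
  (P : probability Omega R) (X : nat -> {RV P >-> R}).
Hypothesis indepX : mutually_independent P X.

Local Notation adaptedto n := (adapted X (iota 0 n)).

Lemma Ex_mul_next n (f : Omega -> R) (g : R -> R) : adaptedto n f ->
  measurable_fun [set: R] g -> L1 P f -> L1 P (g \o X n) ->
  L1 P (fun w => f w * g (X n w)) /\
  Ex P (fun w => f w * g (X n w)) = Ex P f * Ex P (g \o X n).
Proof.
move=> af mg lf lg; apply: (Ex_mul_past indepX _ af mg lf lg).
by rewrite /= iota_uniq mem_iota ltnn.
Qed.

Section forms.
Variables (al be : R -> R) (va vb : R).
Hypothesis mal : measurable_fun [set: R] al.
Hypothesis mbe : measurable_fun [set: R] be.
Hypothesis Lal : forall t, L2 P (al \o X t).
Hypothesis Lbe : forall t, L2 P (be \o X t).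
Hypothesis Eal : forall t, Ex P (al \o X t) = 0.
Hypothesis Ebe : forall t, Ex P (be \o X t) = 0.
Hypothesis Eal2 : forall t, Ex P (fun w => al (X t w) ^+ 2) = va.
Hypothesis Ebe2 : forall t, Ex P (fun w => be (X t w) ^+ 2) = vb.

Definition lin (c : nat -> R) n w := \sum_(0 <= l < n) c l * be (X l w).

(** A strictly lower triangular form, so that [al (X t)] is fresh with respect to the linear form
    that it multiplies. Two functions [al] and [be] are allowed because truncation replaces one
    factor at a time. *)
Definition tri (c : nat -> nat -> R) n w :=
  \sum_(0 <= t < n) al (X t w) * lin (c t) t w.

Lemma adapted_lin c n : adaptedto n (lin c n).
Proof.
apply: (eq_measurable_fun (fun w : past X (iota 0 n) =>
  \sum_(l <- index_iota 0 n) (if (l < n)%N then c l * be (X l w) else 0))).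
  move=> w _; rewrite /lin big_seq [RHS]big_seq; apply: eq_bigr => l.
  by rewrite mem_index_iota => /andP[_ ->].
apply: measurable_sum => l; case ln: (l < n)%N => //.
apply: measurable_funM => //; apply: (adapted_comp _ mbe).
by rewrite mem_iota.
Qed.

Lemma L2_lin c n : L2 P (lin c n).
Proof. by apply: L2_sum => l _; apply: L2Zl; exact: Lbe. Qed.

Lemma Ex_lin_sq c n :
  Ex P (fun w => lin c n w ^+ 2) = vb * \sum_(0 <= l < n) c l ^+ 2.
Proof.
elim: n => [|n IH].
  rewrite big_geq// mulr0 -[RHS](Ex_cst P); apply: eq_Ex => w.
  by rewrite /lin big_geq// expr0n.
rewrite big_nat_recr//= mulrDr -IH.
rewrite (@eq_Ex _ _ _ _ _ (fun w => (lin c n w + c n * be (X n w)) ^+ 2)); last first.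
  by move=> w; rewrite /lin big_nat_recr.
have Lb : L2 P (fun w => c n * be (X n w)) by apply: L2Zl; exact: Lbe.
rewrite Ex_sqrD//; last exact: L2_lin.
have [_ E] := Ex_mul_next (@adapted_lin c n) mbe (L2_L1 (L2_lin c n)) (L2_L1 (Lbe n)).
rewrite (@eq_Ex _ _ _ P (fun w => _ * (c n * _)) (fun w => c n * (lin c n w * be (X n w)))); last first.
  by move=> w; rewrite mulrCA.
rewrite ExZl; last by apply: L2_mul; [exact: L2_lin|exact: Lbe].
rewrite E Ebe !mulr0 addr0; congr (_ + _).
under eq_Ex do rewrite exprMn.
by rewrite ExZl ?Ebe2 1?mulrC//; exact: L1_sqr (Lbe n).
Qed.

Lemma adapted_tri c n m : (n <= m)%N -> adaptedto m (tri c n).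
Proof.
move=> nm; apply: (eq_measurable_fun (fun w : past X (iota 0 m) =>
  \sum_(t <- index_iota 0 n) (if (t < n)%N then al (X t w) *
    \sum_(l <- index_iota 0 t) (if (l < t)%N then c t l * be (X l w) else 0) else 0))).
  move=> w _; rewrite /tri big_seq [RHS]big_seq; apply: eq_bigr => t.
  rewrite mem_index_iota => /andP[_ ->]; congr (_ * _).
  rewrite /lin big_seq [RHS]big_seq; apply: eq_bigr => l.
  by rewrite mem_index_iota => /andP[_ ->].
apply: measurable_sum => t; case tn: (t < n)%N => //.
apply: measurable_funM.
  by apply: (adapted_comp _ mal); rewrite mem_iota (leq_trans tn).
apply: measurable_sum => l; case lt: (l < t)%N => //.
apply: measurable_funM => //; apply: (adapted_comp _ mbe).
by rewrite mem_iota (ltn_trans lt)// (leq_trans tn).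
Qed.

Lemma L2_tri_term c n : L2 P (fun w => al (X n w) * lin c n w) /\
  Ex P (fun w => (al (X n w) * lin c n w) ^+ 2) = va * vb * \sum_(0 <= l < n) c l ^+ 2.
Proof.
have a2 : adaptedto n (fun w => lin c n w ^+ 2).
  by apply: measurable_funX; exact: adapted_lin.
have [l2 E2] := Ex_mul_next a2 (measurable_funX 2 mal) (L1_sqr (L2_lin c n)) (L1_sqr (Lal n)).
split.
  split; first by apply: measurable_funM; [exact: (Lal n).1|exact: (L2_lin c n).1].
  by move: l2; congr L1; apply/funext => w; rewrite exprMn mulrC.
under eq_Ex do rewrite exprMn mulrC.
by rewrite E2 Ex_lin_sq Eal2; ring.
Qed.

Lemma L2_tri c n : L2 P (tri c n).
Proof. by apply: L2_sum => t _; exact: (L2_tri_term (c t) t).1. Qed.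

(** The rows are martingale differences, hence orthogonal. *)
Lemma Ex_tri_sq c n : Ex P (fun w => tri c n w ^+ 2) =
  va * vb * \sum_(0 <= t < n) \sum_(0 <= l < t) c t l ^+ 2.
Proof.
elim: n => [|n IH].
  rewrite big_geq// mulr0 -[RHS](Ex_cst P); apply: eq_Ex => w.
  by rewrite /tri big_geq// expr0n.
rewrite big_nat_recr//= mulrDr -IH.
rewrite (@eq_Ex _ _ _ _ _ (fun w => (tri c n w + al (X n w) * lin (c n) n w) ^+ 2)); last first.
  by move=> w; rewrite /tri big_nat_recr.
have [Lt Et] := L2_tri_term (c n) n.
rewrite Ex_sqrD//; last exact: L2_tri.
rewrite Et.
have aa : adaptedto n (fun w => tri c n w * lin (c n) n w).
  by apply: measurable_funM; [exact: adapted_tri|exact: adapted_lin].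
have la : L1 P (fun w => tri c n w * lin (c n) n w).
  by apply: L2_mul; [exact: L2_tri|exact: L2_lin].
have [_ E] := Ex_mul_next aa mal la (L2_L1 (Lal n)).
rewrite (@eq_Ex _ _ _ P (fun w => tri c n w * _) (fun w => tri c n w * lin (c n) n w * al (X n w))); last first.
  by move=> w; ring.
by rewrite E Eal !mulr0 addr0.
Qed.

(* The lagged product sum is the triangular form whose only nonzero
   coefficient in row t is at the column t - j - 1. *)
Lemma Ex_lag_sq (c : nat -> R) (j p T : nat) : (j < p)%N ->
  let S := fun w => \sum_(p.+1 <= t < T.+1) c t * (al (X t w) * be (X (t - j.+1)%N w)) in
  L2 P S /\ Ex P (fun w => S w ^+ 2) = va * vb * \sum_(p.+1 <= t < T.+1) c t ^+ 2.
Proof.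
move=> jp S.
pose c' t l := if (p < t)%N && (l == t - j.+1)%N then c t else 0.
have lc w t : (p < t)%N -> lin (c' t) t w = c t * be (X (t - j.+1)%N w).
  move=> pt; rewrite /lin (bigD1_seq (t - j.+1)%N) ?iota_uniq//=; last first.
    by rewrite mem_index_iota /= ltn_subrL/= (leq_ltn_trans _ pt).
  rewrite /c' pt eqxx /= big1 ?addr0// => l /negbTE ->.
  by rewrite mul0r.
have l0 w t : (t <= p)%N -> lin (c' t) t w = 0.
  by move=> tp; rewrite /lin big1// => l _; rewrite /c' ltnNge tp /= mul0r.
have split0 (F : nat -> R) : (forall t, (t <= p)%N -> F t = 0) ->
    \sum_(0 <= t < T.+1) F t = \sum_(p.+1 <= t < T.+1) F t.
  move=> F0; have [Tp|pT] := leqP T p.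
    rewrite [RHS]big_geq// big_nat_cond big1// => t /andP[/andP[_ tT] _].
    by rewrite F0// -ltnS (leq_trans tT).
  have -> : \sum_(0 <= t < T.+1) F t =
      \sum_(0 <= t < p.+1) F t + \sum_(p.+1 <= t < T.+1) F t.
    by rewrite -big_cat_nat//= ltnS ltnW.
  rewrite [X in X + _]big_nat_cond big1 ?add0r//.
  by move=> t /andP[/andP[_ tp] _]; rewrite F0.
have SE w : S w = tri c' T.+1 w.
  rewrite /tri split0; last by move=> t tp; rewrite l0// mulr0.
  rewrite /S big_nat_cond [RHS]big_nat_cond; apply: eq_bigr => t /andP[/andP[pt _] _].
  by rewrite lc//; ring.
split.
  by have := L2_tri c' T.+1; congr L2; apply/funext => w; rewrite SE.
under eq_Ex do rewrite SE.
rewrite Ex_tri_sq split0; last first.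
  by move=> t tp; rewrite big1// => l _; rewrite /c' ltnNge tp /= expr0n.
congr (_ * _); rewrite big_nat_cond [RHS]big_nat_cond; apply: eq_bigr => t /andP[/andP[pt _] _].
rewrite (bigD1_seq (t - j.+1)%N) ?iota_uniq//=; last first.
  by rewrite mem_index_iota /= ltn_subrL/= (leq_ltn_trans _ pt).
rewrite /c' pt eqxx /= big1 ?addr0// => l /negbTE ->.
by rewrite expr0n.
Qed.

End forms.

Section square_form.
Variables (z : R -> R) (v : R).
Hypothesis mz : measurable_fun [set: R] z.
Hypothesis Lz : forall t, L2 P (z \o X t).
Hypothesis Ez : forall t, Ex P (z \o X t) = 0.
Hypothesis Ez2 : forall t, Ex P (fun w => z (X t w) ^+ 2) = v.

Lemma sum_sq_split (F : nat -> nat -> R) n :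
  \sum_(0 <= t < n) \sum_(0 <= l < n) F t l =
  \sum_(0 <= t < n) F t t + \sum_(0 <= t < n) \sum_(0 <= l < t) (F t l + F l t).
Proof.
elim: n => [|n IH]; first by rewrite !big_geq// addr0.
rewrite big_nat_recr//= [in RHS]big_nat_recr//= [X in _ = _ + X]big_nat_recr//=.
under eq_bigr do rewrite big_nat_recr//=.
rewrite big_split/= IH big_nat_recr//= [X in _ = _ + (_ + X)]big_split/=; ring.
Qed.

(** The diagonal involves the squares of z, which need not be square integrable, and is bounded in
    L1. The rest is triangular after symmetrisation and is bounded in L2, the factor 2 coming from
    (k_tl + k_lt)^2 <= 2 (k_tl^2 + k_lt^2). *)
Lemma quad_form_L1 (k : nat -> nat -> R) n :
  let Q := fun w => \sum_(0 <= t < n) \sum_(0 <= l < n) k t l * (z (X t w) * z (X l w)) in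
  L1 P Q /\ Ex P (fun w => `|Q w|) <= v * \sum_(0 <= t < n) `|k t t| +
    v * Num.sqrt (2 * \sum_(0 <= t < n) \sum_(0 <= l < n) k t l ^+ 2).
Proof.
move=> Q.
pose c t l := k t l + k l t.
have QE w : Q w = \sum_(0 <= t < n) k t t * z (X t w) ^+ 2 + tri z z c n w.
  rewrite /Q sum_sq_split; congr (_ + _); apply: eq_bigr => t _.
  by rewrite /lin mulr_sumr; apply: eq_bigr => l _; rewrite /c; ring.
have v0 : 0 <= v by rewrite -(Ez2 0); exact: Ex_sqr_ge0.
have Lsq t : L1 P (fun w => z (X t w) ^+ 2) by exact: L1_sqr (Lz t).
have Ld : L1 P (fun w => \sum_(0 <= t < n) k t t * z (X t w) ^+ 2).
  by apply: L1_sum => t _; exact: L1Zl.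
have Lt := L2_tri mz mz Lz Lz Ez Ez2 Ez2 c n.
have Et := Ex_tri_sq mz mz Lz Lz Ez Ez Ez2 Ez2 c n.
have LQ : L1 P Q.
  by have := L1D Ld (L2_L1 Lt); congr L1; apply/funext => w; rewrite QE.
split=> //.
apply: (@le_trans _ _ (Ex P (fun w => \sum_(0 <= t < n) `|k t t| * z (X t w) ^+ 2 +
    `|tri z z c n w|))).
  apply: le_Ex => [||w]; first exact: L1_norm.
    apply: L1D; last exact: L1_norm (L2_L1 Lt).
    by apply: L1_sum => t _; exact: L1Zl.
  rewrite QE (le_trans (ler_normD _ _))// lerD2r (le_trans (ler_norm_sum _ _ _))//.
  by apply: ler_sum => t _; rewrite normrM (ger0_norm (sqr_ge0 _)).
rewrite ExD; [|by apply: L1_sum => t _; exact: L1Zl|exact: L1_norm (L2_L1 Lt)].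
apply: lerD.
  rewrite Ex_sum; last by move=> t _; exact: L1Zl.
  rewrite mulr_sumr le_eqVlt; apply/orP; left; apply/eqP; apply: eq_bigr => t _.
  by rewrite ExZl// Ez2 mulrC.
rewrite -[X in X * Num.sqrt _](ger0_norm v0) -sqrtr_sqr -sqrtrM ?sqr_ge0//.
apply: Ex_norm_le_sqrt => //; rewrite Et -expr2 ler_wpM2l ?sqr_ge0//.
rewrite sum_sq_split mulrDr mulr_sumr.
apply: (@le_trans _ _ (\sum_(0 <= t < n) 2 * \sum_(0 <= l < t) (k t l ^+ 2 + k l t ^+ 2))).
  apply: ler_sum => t _; rewrite mulr_sumr; apply: ler_sum => l _; rewrite /c.
  by have := sqr_ge0 (k t l - k l t); nra.
rewrite [X in _ <= _ + X]mulr_sumr lerDr sumr_ge0// => t _.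
by rewrite mulr_ge0// sqr_ge0.
Qed.

End square_form.

End quadratic_forms.

(** * Approximation of the innovations by bounded centred variables *)

Section truncation.
Context (d : measure_display) (Omega : measurableType d) (R : realType)
  (P : probability Omega R) (X : nat -> {RV P >-> R}).
Hypothesis idX : identically_distributed P X.
Variables (z : R -> R).
Hypothesis mz : measurable_fun [set: R] z.
Hypothesis Lz : forall t, L2 P (z \o X t).
Hypothesis Ez : forall t, Ex P (z \o X t) = 0.

(** Clipping at a high level is close in L2 by dominated convergence. Recentring the clipped
    variable cannot increase the error: it amounts to subtracting from the difference its own
    mean. *)
Lemma truncation (e : R) : 0 < e -> exists (y : R -> R) (B : R),
  [/\ measurable_fun [set: R] y, forall x, `|y x| <= B,
    forall t, Ex P (y \o X t) = 0 &
    forall t, Ex P (fun w => (z (X t w) - y (X t w)) ^+ 2) <= e].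
Proof.
move=> e0.
pose clip (n : nat) (x : R) := Num.max (- n%:R) (Num.min n%:R (z x)).
have mclip n : measurable_fun [set: R] (clip n).
  by apply: measurable_maxr => //; exact: measurable_minr.
have bclip n x : `|clip n x| <= n%:R.
  rewrite /clip ler_norml le_max lexx /= ge_max ge_min lexx /= andbT.
  by rewrite (@le_trans _ _ 0)// oppr_le0.
have Lclip n t : L2 P (clip n \o X t).
  apply: (@L2_bounded _ _ _ _ _ n%:R); first exact: measurableT_comp.
  by move=> w; exact: bclip.
have clipE n x : `|z x| <= n%:R -> clip n x = z x.
  rewrite ler_norml /clip => /andP[z1 z2].
  by rewrite (min_idPr z2) (max_idPr z1).
have clipD n x : (z x - clip n x) ^+ 2 <= z x ^+ 2.
  rewrite /clip; have n0 : 0 <= n%:R :> R by [].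
  move: (z x) (n%:R : R) n0 => u N N0.
  have [uN|uN] := leP N u; rewrite ?(min_idPl uN) ?(min_idPr (ltW uN)).
    by have [h|h] := leP (- N) N; nra.
  by have [h|h] := leP (- N) u; nra.
have lim0 : Ex P (fun w => (z (X 0%N w) - clip n (X 0%N w)) ^+ 2) @[n --> \oo] --> 0.
  rewrite -[X in _ --> X](Ex_cst P).
  apply: (@Ex_lim _ _ _ _ _ (fun w => z (X 0%N w) ^+ 2)).
  - move=> n; apply: measurable_funX; apply: measurable_funB.
      exact: measurableT_comp mz _.
    exact: measurableT_comp (mclip n) _.
  - exact: measurable_cst.
  - exact: L1_sqr (Lz 0%N).
  - move=> w; apply: cvg_near_cst; near=> n.
    rewrite clipE ?subrr ?expr0n//.
    near: n; exact: nbhs_infty_ger.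
  - by move=> n w; rewrite ger0_norm ?sqr_ge0.
have /cvgrPdist_le /(_ _ e0) [N _ /(_ N (leqnn N))] := lim0.
rewrite /= sub0r normrN ger0_norm ?Ex_sqr_ge0// => HN.
pose m := Ex P (clip N \o X 0%N).
have Em t : Ex P (clip N \o X t) = m.
  by apply: (Ex_id idX) => //; exact: L2_L1.
exists (fun x => clip N x - m), (N%:R + `|m|); split.
- exact: measurable_funB.
- by move=> x; rewrite (le_trans (ler_normB _ _))// lerD2r.
- by move=> t; rewrite /comp ExB ?Ex_cst ?Em ?subrr//; [exact: L2_L1 (Lclip N t)|exact: L1_cst].
- move=> t; rewrite (le_trans _ HN)//.
  have Ld s : L2 P (fun w => z (X s w) - clip N (X s w)) by apply: L2B; [exact: Lz|exact: Lclip].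
  have mg : measurable_fun [set: R] (fun x => (z x - clip N x) ^+ 2).
    by apply: measurable_funX; exact: measurable_funB.
  have -> : Ex P (fun w => (z (X 0%N w) - clip N (X 0%N w)) ^+ 2) =
      Ex P (fun w => (z (X t w) - clip N (X t w)) ^+ 2).
    by apply: (@Ex_id _ _ _ _ _ _ idX 0%N t (fun x => (z x - clip N x) ^+ 2)) => //; exact: L1_sqr (Ld 0%N).
  have Edm : Ex P (fun w => z (X t w) - clip N (X t w)) = - m.
    rewrite ExB; [|exact: L2_L1 (Lz t)|exact: L2_L1 (Lclip N t)].
    by have := Ez t; have := Em t; rewrite /comp => -> ->; rewrite sub0r.
  rewrite (@eq_Ex _ _ _ _ _ (fun w => (z (X t w) - clip N (X t w) + m) ^+ 2)); last first.
    by move=> w; ring.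
  rewrite Ex_sqrD//; last exact: L2_cst.
  rewrite Ex_cst; have -> : Ex P (fun w => (z (X t w) - clip N (X t w)) * m) =
      Ex P (fun w => m * (z (X t w) - clip N (X t w))).
    by apply: eq_Ex => w; rewrite mulrC.
  rewrite ExZl ?Edm; last exact: L2_L1.
  by have := sqr_ge0 m; nra.
Unshelve. all: by end_near. Qed.

End truncation.

(** * Central limit theorem for lagged products *)

Lemma prod_lip (R : realType) (K : R) (p : nat) (a b : nat -> R) : 1 <= K ->
  (forall j, `|a j| <= K) -> (forall j, `|b j| <= K) ->
  `|\prod_(j < p) a j - \prod_(j < p) b j| <= K ^+ p * \sum_(j < p) `|a j - b j|.
Proof.
move=> K1 aK bK; have K0 : 0 <= K by exact: le_trans K1.
have Pb n : `|\prod_(j < n) b j| <= K ^+ n.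
  rewrite normr_prod -[X in _ ^+ X]card_ord -prodr_const.
  by apply: ler_prod => j _; rewrite normr_ge0 bK.
elim: p => [|p IH]; first by rewrite !big_ord0 subrr normr0 mulr0.
rewrite !big_ord_recr/=.
set A := \prod_(_ < p) a _ in IH *; set B := \prod_(_ < p) b _ in IH *.
rewrite (_ : A * a p - B * b p = (A - B) * a p + B * (a p - b p)); last by ring.
rewrite (le_trans (ler_normD _ _))// !normrM mulrDr lerD//.
  by rewrite exprSr mulrAC ler_pM.
by rewrite ler_wpM2r// (le_trans (Pb p))// exprSr ler_peMr// exprn_ge0.
Qed.

Section transfer.
Context (d : measure_display) (Omega : measurableType d) (R : realType)
  (P : probability Omega R).

(** Outside an exceptional set the difference is small, and on it the difference is at most 2K;
    hence the level e / (4 (K + 1)) for its probability. *)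
Lemma op1_Ex (f g : nat -> Omega -> R) (K : R) (N0 : nat) :
  (forall n, (N0 <= n)%N -> meas (f n)) -> (forall n, (N0 <= n)%N -> meas (g n)) ->
  (forall n w, `|f n w| <= K) -> (forall n w, `|g n w| <= K) ->
  op1 P (fun n w => f n w - g n w) ->
  Ex P (f n) - Ex P (g n) @[n --> \oo] --> 0.
Proof.
move=> mf mg fK gK fg; apply/cvgrPdist_le => e e0.
have K0 : 0 <= K by exact: le_trans (normr_ge0 _) (fK 0%N point).
have e20 : 0 < e / 2 by lra.
have r0 : 0 < e / (4 * (K + 1)) by rewrite divr_gt0// mulr_gt0//; lra.
have [N HN] := fg _ _ e20 r0.
near=> n.
have N0n : (N0 <= n)%N by near: n; exact: nbhs_infty_ge.
have [|A [mA PA fgA]] := HN n; first by near: n; exact: nbhs_infty_ge.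
have lf : L1 P (f n) by exact: (L1_bounded P (mf n N0n) (fK n)).
have lg : L1 P (g n) by exact: (L1_bounded P (mg n N0n) (gK n)).
rewrite sub0r normrN -ExB// (le_trans (le_norm_Ex (L1B lf lg)))//.
have lA := L1_indic P mA.
apply: (@le_trans _ _ (Ex P (fun w => e / 2 + 2 * K * \1_A w))).
  apply: le_Ex => [||w].
  - exact: L1_norm (L1B lf lg).
  - by apply: L1D; [exact: L1_cst|exact: L1Zl].
  rewrite indicE; have [wA|wA] := boolP (w \in A); last first.
    by rewrite mulr0 addr0 fgA//; move: wA; rewrite notin_setE.
  rewrite mulr1 (le_trans (ler_normB _ _))//.
  by have := fK n w; have := gK n w; lra.
rewrite ExD; [|exact: L1_cst|exact: L1Zl].
rewrite Ex_cst ExZl// Ex_indic//.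
have PA' : fine (P A) <= e / (4 * (K + 1)).
  by rewrite -lee_fin fineK// fin_num_measure.
have : 2 * K * fine (P A) <= 2 * K * (e / (4 * (K + 1))) by rewrite ler_wpM2l// mulr_ge0.
have -> : 2 * K * (e / (4 * (K + 1))) = e / 2 * (K / (K + 1)) by field; lra.
have : K / (K + 1) <= 1 by rewrite ler_pdivrMr; lra.
have := e20; nra.
Unshelve. all: by end_near. Qed.

End transfer.

Lemma sum_sq_coef (R : realType) (p T : nat) (c : nat -> nat -> R) j (A : R) : (0 < T)%N ->
  (forall t, (p < t <= T)%N -> `|c t j| <= A) ->
  \sum_(p.+1 <= t < T.+1) ((Num.sqrt T%:R)^-1 * c t j) ^+ 2 <= A ^+ 2.
Proof.
move=> T0 cA; have T0' : 0 < T%:R :> R by rewrite ltr0n.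
apply: (@le_trans _ _ (\sum_(p.+1 <= t < T.+1) A ^+ 2 / T%:R)).
  rewrite big_nat_cond [leRHS]big_nat_cond; apply: ler_sum => t /andP[/andP[pt tT] _].
  have ct : `|c t j| <= A by apply: cA; rewrite pt.
  have -> : ((Num.sqrt T%:R)^-1 * c t j) ^+ 2 = c t j ^+ 2 / T%:R.
    by rewrite exprMn exprVn sqr_sqrtr ?ltW// mulrC.
  rewrite ler_pM2r ?invr_gt0//.
  by rewrite -(real_normK (num_real _)) lerXn2r ?nnegrE// (le_trans _ ct).
rewrite sumr_const_nat subSS -[X in X <= _]mulr_natr mulrAC ler_pdivrMr// ler_wpM2l ?sqr_ge0//.
by rewrite ler_nat leq_subr.
Qed.

Section lag_clt.
Context (d : measure_display) (Omega : measurableType d) (R : realType)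
  (P : probability Omega R) (X : nat -> {RV P >-> R}).
Hypothesis indepX : mutually_independent P X.
Hypothesis idX : identically_distributed P X.
Variables (z : R -> R) (v : R).
Hypothesis mz : measurable_fun [set: R] z.
Hypothesis Lz : forall t, L2 P (z \o X t).
Hypothesis Ez : forall t, Ex P (z \o X t) = 0.
Hypothesis Ez2 : forall t, Ex P (fun w => z (X t w) ^+ 2) = v.

Lemma L2_psum p T c j : (j < p)%N -> L2 P (psum X z p T c T j).
Proof.
move=> jp; have := (Ex_lag_sq indepX mz mz Lz Lz Ez Ez Ez2 Ez2
  (fun t => (Num.sqrt T%:R)^-1 * c t j) T jp).1.
by congr L2.
Qed.

Lemma Ex_psum_sq (p T : nat) c j (A : R) : (j < p)%N -> (0 < T)%N ->
  (forall t, (p < t <= T)%N -> `|c t j| <= A) ->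
  Ex P (fun w => psum X z p T c T j w ^+ 2) <= v ^+ 2 * A ^+ 2.
Proof.
move=> jp T0 cA; have [_ E] := (Ex_lag_sq indepX mz mz Lz Lz Ez Ez Ez2 Ez2
  (fun t => (Num.sqrt T%:R)^-1 * c t j) T jp).
have E' : Ex P (fun w => psum X z p T c T j w ^+ 2) = v * v *
  \sum_(p.+1 <= t < T.+1) ((Num.sqrt T%:R)^-1 * c t j) ^+ 2 := E.
by rewrite E' -expr2 ler_wpM2l ?sqr_ge0// sum_sq_coef.
Qed.

End lag_clt.

Section lag_clt2.
Context (d : measure_display) (Omega : measurableType d) (R : realType)
  (P : probability Omega R) (X : nat -> {RV P >-> R}).
Hypothesis indepX : mutually_independent P X.
Hypothesis idX : identically_distributed P X.

Variables (z y : R -> R) (v vy : R).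
Hypothesis mz : measurable_fun [set: R] z.
Hypothesis Lz : forall t, L2 P (z \o X t).
Hypothesis Ez : forall t, Ex P (z \o X t) = 0.
Hypothesis Ez2 : forall t, Ex P (fun w => z (X t w) ^+ 2) = v.
Hypothesis my : measurable_fun [set: R] y.
Hypothesis Ly : forall t, L2 P (y \o X t).
Hypothesis Ey : forall t, Ex P (y \o X t) = 0.
Hypothesis Ey2 : forall t, Ex P (fun w => y (X t w) ^+ 2) = vy.

(** With u = z - y, the product zz' - yy' equals uz' + yu', and each term gives a lagged form with
    uncorrelated summands. The bound is uniform in [T]. *)
Lemma psum_trunc (e : R) (p T : nat) (c : nat -> nat -> R) j (A : R) :
  (j < p)%N -> (0 < T)%N ->
  (forall t, (p < t <= T)%N -> `|c t j| <= A) ->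
  (forall t, Ex P (fun w => (z (X t w) - y (X t w)) ^+ 2) = e) ->
  L2 P (fun w => psum X z p T c T j w - psum X y p T c T j w) /\
  Ex P (fun w => (psum X z p T c T j w - psum X y p T c T j w) ^+ 2) <=
    2 * (v + vy) * e * A ^+ 2.
Proof.
move=> jp T0 cA Ed.
pose u x := z x - y x.
have mu : measurable_fun [set: R] u by exact: measurable_funB.
have Lu t : L2 P (u \o X t) by exact: L2B (Lz t) (Ly t).
have Eu t : Ex P (u \o X t) = 0.
  rewrite /u /comp ExB; [|exact: L2_L1 (Lz t)|exact: L2_L1 (Ly t)].
  by have := Ez t; have := Ey t; rewrite /comp => -> ->; rewrite subrr.
pose c' t := (Num.sqrt T%:R)^-1 * c t j.
have [L1' E1] := Ex_lag_sq indepX mu mz Lu Lz Eu Ez Ed Ez2 c' T jp.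
have [L2' E2] := Ex_lag_sq indepX my mu Ly Lu Ey Eu Ey2 Ed c' T jp.
move: L1' E1 L2' E2.
set S1 := (fun w => \sum_(p.+1 <= t < T.+1) c' t * (u _ * z _)).
set S2 := (fun w => \sum_(p.+1 <= t < T.+1) c' t * (y _ * u _)).
move=> L1' E1 L2' E2.
have SE w : psum X z p T c T j w - psum X y p T c T j w = S1 w + S2 w.
  rewrite /psum /S1 /S2 -sumrB -big_split/=; apply: eq_bigr => t _.
  by rewrite /incr /c' /u; ring.
have e0 : 0 <= e by rewrite -(Ed 0); exact: Ex_sqr_ge0.
have v0 : 0 <= v by rewrite -(Ez2 0); exact: Ex_sqr_ge0.
have vy0 : 0 <= vy by rewrite -(Ey2 0); exact: Ex_sqr_ge0.
split.
  by have := L2D L1' L2'; congr L2; apply/funext => w; rewrite SE.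
under eq_Ex do rewrite SE.
rewrite (le_trans (Ex_sqrD_le L1' L2'))// E1 E2.
have := @sum_sq_coef R p T c j A T0 cA.
rewrite -/(c' _); set s := \sum_(_ <= _ < _) _ => sA.
have ve : 0 <= e * v by exact: mulr_ge0.
have vye : 0 <= vy * e by exact: mulr_ge0.
have := ler_wpM2l ve sA; have := ler_wpM2l vye sA.
lra.
Qed.

End lag_clt2.

Section lag_clt3.
Context (d : measure_display) (Omega : measurableType d) (R : realType)
  (P : probability Omega R) (X : nat -> {RV P >-> R}).
Hypothesis indepX : mutually_independent P X.
Hypothesis idX : identically_distributed P X.
Variables (z : R -> R) (v : R).
Hypothesis mz : measurable_fun [set: R] z.
Hypothesis Lz : forall t, L2 P (z \o X t).
Hypothesis Ez : forall t, Ex P (z \o X t) = 0.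
Hypothesis Ez2 : forall t, Ex P (fun w => z (X t w) ^+ 2) = v.

(** Extends [bounded_clt] to square integrable [z]. For a truncation with squared L2 error e, both
    the expectations and the Gaussian limits differ from the truncated ones by a multiple of sqrt e
    that does not depend on [T]. *)
Lemma lag_clt (p : nat) (c : nat -> nat -> nat -> R) (r : nat -> nat -> R)
    (A D s : R) (q q1 q2 : nat -> R -> R) : 0 <= A ->
  (forall T t j, (p < t <= T)%N -> `|c T t j| <= A) ->
  (forall T t, (p < t <= T)%N -> 0 <= r T t <= A ^+ 2) ->
  (forall T t j, (p < t <= T)%N -> (j < p)%N -> `|c T t j ^+ 2 - r T t| <= A / T%:R) ->
  (forall j, TC D (q j) (q1 j) (q2 j)) ->
  0 <= s ->
  \sum_(p.+1 <= t < T.+1) r T t / T%:R @[T --> \oo] --> s ->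
  Ex P (fun w => \prod_(j < p) q j (psum X z p T (c T) T j w)) @[T --> \oo] -->
  \prod_(j < p) gsm (v * Num.sqrt s) (q j) 0.
Proof.
move=> A0 cA rA cr qTC s0 rs.
have D0 : 0 <= D by exact: le_trans (tc0 (qTC 0%N) 0).
have v0 : 0 <= v by rewrite -(Ez2 0%N); exact: Ex_sqr_ge0.
pose K := Num.max 1 D.
have K1 : 1 <= K by rewrite le_max lexx.
have KD : D <= K by rewrite le_max lexx orbT.
have K0 : 0 <= K by exact: le_trans K1.
pose m1 := Ex (gam R) (fun z : R => `|z|).
have m10 : 0 <= m1 by exact: Ex_ge0.
(* From vy <= 2v + 2, the quantity v + vy is at most 3v + 2, and the second moment of z + y at most
   6v + 4. The first term of the bracket accounts for the change of the sums, the second for that of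
   the Gaussian scale. *)
pose L := K ^+ p * p%:R * D * (Num.sqrt (2 * (3 * v + 2)) * A +
  Num.sqrt s * Num.sqrt (6 * v + 4) * m1).
have L0 : 0 <= L.
  by rewrite mulr_ge0 ?mulr_ge0 ?exprn_ge0// addr_ge0// ?mulr_ge0 ?sqrtr_ge0.
apply/cvgrPdist_le => eps eps0.
pose e := Num.min 1 ((eps / (2 * (L + 1))) ^+ 2).
have e0 : 0 < e by rewrite lt_min ltr01 exprn_gt0// divr_gt0// mulr_gt0// ltr_wpDl.
have e1 : e <= 1 by rewrite ge_min lexx.
have Le : L * Num.sqrt e <= eps / 2.
  have : Num.sqrt e <= eps / (2 * (L + 1)).
    have h0 : 0 <= eps / (2 * (L + 1)) by apply: divr_ge0; lra.
    rewrite -(ger0_norm h0) -sqrtr_sqr ler_wsqrtr//.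
    by rewrite ge_min lexx orbT.
  move=> /(ler_wpM2l L0); have -> : L * (eps / (2 * (L + 1))) = eps / 2 * (L / (L + 1)).
    by field; lra.
  have : L / (L + 1) <= 1 by rewrite ler_pdivrMr; lra.
  nra.
have [y [B [my yB Ey Eyz]]] := truncation idX mz Lz Ez e0.
have Ly t : L2 P (y \o X t).
  by apply: (@L2_bounded _ _ _ _ _ B); [exact: measurableT_comp|move=> w; exact: yB].
pose vy := Ex P (fun w => y (X 0%N w) ^+ 2).
have vy0 : 0 <= vy by exact: Ex_sqr_ge0.
have Ey2 t : Ex P (fun w => y (X t w) ^+ 2) = vy.
  by apply: (@Ex_id _ _ _ _ _ _ idX t 0%N (fun x => y x ^+ 2)); [exact: measurable_funX|exact: L1_sqr (Ly t)].
have Lzy t : L2 P (fun w => z (X t w) - y (X t w)) by exact: L2B (Lz t) (Ly t).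
pose e' := Ex P (fun w => (z (X 0%N w) - y (X 0%N w)) ^+ 2).
have e'0 : 0 <= e' by exact: Ex_sqr_ge0.
have Ed t : Ex P (fun w => (z (X t w) - y (X t w)) ^+ 2) = e'.
  apply: (@Ex_id _ _ _ _ _ _ idX t 0%N (fun x => (z x - y x) ^+ 2)); last exact: L1_sqr (Lzy t).
  by apply: measurable_funX; exact: measurable_funB.
have e'e : e' <= e by exact: Eyz.
have vyv : vy <= 2 * v + 2.
  have := Ex_sqrD_le (Lz 0%N) (L2Zl (-1) (Lzy 0%N)).
  rewrite (@eq_Ex _ _ _ _ _ (fun w => y (X 0%N w) ^+ 2)); last by move=> w; rewrite /=; ring.
  rewrite -/vy => /le_trans; apply.
  have -> : Ex P (fun x => (-1 * (z (X 0%N x) - y (X 0%N x))) ^+ 2) = e'.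
    by apply: eq_Ex => w; ring.
  have -> : Ex P (fun w => (z \o X 0%N) w ^+ 2) = v by exact: Ez2.
  lra.
have dv : `|vy - v| <= Num.sqrt e * Num.sqrt (6 * v + 4).
  have Lzy' : L2 P (fun w => z (X 0%N w) + y (X 0%N w)) by exact: L2D (Lz 0%N) (Ly 0%N).
  rewrite distrC -(Ez2 0%N) /vy -ExB; [|exact: L1_sqr (Lz 0%N)|exact: L1_sqr (Ly 0%N)].
  rewrite (@eq_Ex _ _ _ _ _ (fun w => (z (X 0%N w) - y (X 0%N w)) * (z (X 0%N w) + y (X 0%N w)))); last first.
    by move=> w; ring.
  rewrite (le_trans (le_norm_Ex (L2_mul (Lzy 0%N) Lzy')))//.
  rewrite (le_trans (Ex_mul_norm_le (Lzy 0%N) Lzy'))// ler_pM ?sqrtr_ge0//.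
    by rewrite ler_wsqrtr.
  rewrite ler_wsqrtr// (le_trans (Ex_sqrD_le (Lz 0%N) (Ly 0%N)))//.
  by have := Ez2 0%N; rewrite /comp -/vy => ->; lra.
have rs' : \sum_(p.+1 <= t < T.+1) vy ^+ 2 * r T t / T%:R @[T --> \oo] --> vy ^+ 2 * s.
  under eq_fun do (under eq_bigr do rewrite -mulrA; rewrite -mulr_sumr).
  exact: cvgMr.
have := bounded_clt indepX my yB Ey Ey2 A0 cA rA cr qTC rs'.
have eps20 : 0 < eps / 2 by lra.
move=> /cvgrPdist_le /(_ _ eps20) clt.
near=> T.
have T0 : (0 < T)%N by near: T; exact: nbhs_infty_gt.
have : `|\prod_(j < p) gsm (Num.sqrt (vy ^+ 2 * s)) (q j) 0 -
  Ex P (fun w => \prod_(j < p) q j (psum X y p T (c T) T j w))| <= eps / 2.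
  by near: T; exact: clt.
set G := \prod_(j < p) _; set Ey' := Ex P _ => Hy.
set G' := \prod_(j < p) _; set Ez' := Ex P _.
have HG : `|G' - G| <= K ^+ p * p%:R * D * (Num.sqrt s * Num.sqrt (6 * v + 4) * m1) * Num.sqrt e.
  rewrite (le_trans (@prod_lip _ K p (fun j => gsm (v * Num.sqrt s) (q j) 0)
    (fun j => gsm (Num.sqrt (vy ^+ 2 * s)) (q j) 0) K1 _ _))//.
  - by move=> j; rewrite (le_trans _ KD)//; exact: (tc0 (gsm_TC _ (qTC j))).
  - by move=> j; rewrite (le_trans _ KD)//; exact: (tc0 (gsm_TC _ (qTC j))).
  rewrite (_ : _ * Num.sqrt e = K ^+ p * (p%:R * (D * (Num.sqrt e * Num.sqrt (6 * v + 4) *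
    Num.sqrt s * m1)))); last by ring.
  rewrite ler_wpM2l ?exprn_ge0// mulr_natl -[X in _ *+ X]card_ord -sumr_const.
  apply: ler_sum => j _.
  rewrite (le_trans (gsm_scale_lip _ _ _ (tc0 (qTC j)) (tcL0 (qTC j))))//.
  rewrite sqrtrM ?sqr_ge0// sqrtr_sqr (ger0_norm vy0) -mulrBl normrM distrC.
  rewrite (ger0_norm (sqrtr_ge0 _)) -/m1 -[leLHS]mulrA ler_wpM2l// ler_wpM2r//.
  by rewrite ler_wpM2r// sqrtr_ge0.
have HE : `|Ey' - Ez'| <= K ^+ p * p%:R * D * (Num.sqrt (2 * (3 * v + 2)) * A) * Num.sqrt e.
  have mq j : measurable_fun [set: R] (q j) by exact: lip_measurable (tcL0 (qTC j)).
  have Lprod u : measurable_fun [set: R] u ->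
      L1 P (fun w => \prod_(j < p) q j (psum X u p T (c T) T j w)).
    move=> mu; apply: (@L1_bounded _ _ _ _ _ (K ^+ p)).
      by apply: measurable_prod => j _; apply: (measurableT_comp (mq j)); exact: meas_psum.
    move=> w; rewrite normr_prod -[X in _ ^+ X]card_ord -prodr_const.
    by apply: ler_prod => j _; rewrite normr_ge0 (le_trans _ KD)//; exact: (tc0 (qTC j)).
  have H j : (j < p)%N -> _ := fun jp => psum_trunc indepX mz Lz Ez Ez2 my Ly Ey Ey2 jp T0
    (fun t => cA T t j) Ed.
  have Ld (j : 'I_p) : L1 P (fun w => `|psum X z p T (c T) T j w - psum X y p T (c T) T j w|).
    by apply: L1_norm; apply: L2_L1; exact: (H j (ltn_ord j)).1.
  rewrite distrC /Ez' /Ey' -ExB; [|exact: Lprod|exact: Lprod].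
  rewrite (le_trans (le_norm_Ex (L1B (Lprod _ mz) (Lprod _ my))))//.
  apply: (@le_trans _ _ (Ex P (fun w => K ^+ p * D *
      \sum_(j < p) `|psum X z p T (c T) T j w - psum X y p T (c T) T j w|))).
    apply: le_Ex => [||w].
    - exact: L1_norm (L1B (Lprod _ mz) (Lprod _ my)).
    - by apply: L1Zl; apply: L1_sum.
    rewrite (le_trans (@prod_lip _ K p (fun j => q j (psum X z p T (c T) T j w))
      (fun j => q j (psum X y p T (c T) T j w)) K1 _ _))//.
    - by move=> j; rewrite (le_trans _ KD)//; exact: (tc0 (qTC j)).
    - by move=> j; rewrite (le_trans _ KD)//; exact: (tc0 (qTC j)).
    rewrite -mulrA ler_wpM2l ?exprn_ge0// mulr_sumr; apply: ler_sum => j _.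
    by rewrite -{1}(subrKC (psum X y p T (c T) T j w) (psum X z p T (c T) T j w)); exact: (tcL0 (qTC j)).
  rewrite ExZl; last exact: L1_sum.
  rewrite Ex_sum// (_ : _ * Num.sqrt e = K ^+ p * D *
    (p%:R * (Num.sqrt (2 * (3 * v + 2)) * A * Num.sqrt e))); last by ring.
  rewrite ler_wpM2l ?mulr_ge0 ?exprn_ge0// mulr_natl -[X in _ *+ X]card_ord -sumr_const.
  apply: ler_sum => j _.
  have [L2d E2d] := H j (ltn_ord j).
  rewrite (le_trans (Ex_norm_le_sqrt L2d E2d))//.
  rewrite (_ : _ * _ * Num.sqrt e = Num.sqrt (2 * (3 * v + 2) * e * A ^+ 2)); last first.
    have h1 : 0 <= 2 * (3 * v + 2) by lra.
    have h2 : 0 <= 2 * (3 * v + 2) * e by rewrite mulr_ge0// ltW.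
    by rewrite [RHS](sqrtrM _ h2) sqrtr_sqr (ger0_norm A0) (sqrtrM _ h1) mulrAC.
  rewrite ler_wsqrtr// ler_wpM2r ?sqr_ge0//; nra.
rewrite (le_trans _ (_ : eps / 2 + eps / 2 <= eps))//; last lra.
have -> : G' - Ez' = (G' - G) + (G - Ey') + (Ey' - Ez') by ring.
rewrite (le_trans (ler_normD _ _))//.
have := ler_normD (G' - G) (G - Ey').
have : K ^+ p * p%:R * D * (Num.sqrt (2 * (3 * v + 2)) * A) * Num.sqrt e +
  K ^+ p * p%:R * D * (Num.sqrt s * Num.sqrt (6 * v + 4) * m1) * Num.sqrt e = L * Num.sqrt e.
  by rewrite /L; ring.
lra.
Unshelve. all: by end_near. Qed.

End lag_clt3.

(** * Smooth approximation of a step function of the squared positive part *)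

Section smooth_functions.
Context (R : realType).
Implicit Types (q : R -> R) (D s x y h : R).

Lemma TC_cst c : TC `|c| (fun=> c : R) (fun=> 0) (fun=> 0).
Proof.
split=> [x|x|x|x h|x h|x h|x h]; rewrite ?subrr ?mul0r ?subr0 ?normr0 ?normr_ge0//.
Qed.

(** The delicate term of the remainder is the product of a first-order remainder and an increment.
    For |h| <= 1 the former is O(h^2); for |h| > 1 it is only O(|h|), but then h^2 <= |h|^3. *)
Lemma TCM D E q q1 q2 p p1 p2 : TC D q q1 q2 -> TC E p p1 p2 ->
  TC (20 * D * E) (fun x => q x * p x) (fun x => q1 x * p x + q x * p1 x)
    (fun x => q2 x * p x + 2 * (q1 x * p1 x) + q x * p2 x).
Proof.
move=> [a0 a1 a2 aT aL0 aL1 aL2] [b0 b1 b2 bT bL0 bL1 bL2].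
have D0 : 0 <= D by exact: le_trans (a0 0).
have E0 : 0 <= E by exact: le_trans (b0 0).
have DE : 0 <= D * E by exact: mulr_ge0.
have M u w x : `|u| <= D -> `|w| <= E -> `|u * w| <= D * E :> R.
  by move=> hu hw; rewrite normrM ler_pM.
have LM u w : (forall x, `|u x| <= D) -> lip D u -> (forall x, `|w x| <= E) -> lip E w ->
    lip (2 * (D * E)) (fun x => u x * w x).
  move=> hu lu hw lw x h.
  rewrite (_ : _ - _ = u (x + h) * (w (x + h) - w x) + (u (x + h) - u x) * w x); last by ring.
  rewrite (le_trans (ler_normD _ _))// !normrM.
  rewrite (_ : 2 * (D * E) * `|h| = D * (E * `|h|) + D * `|h| * E); last by ring.
  by apply: lerD; apply: ler_pM => //; first [exact: lw|exact: lu].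
have LD B C u w : lip B u -> lip C w -> lip (B + C) (fun x => u x + w x).
  move=> lu lw x h; rewrite (_ : _ - _ = (u (x + h) - u x) + (w (x + h) - w x)); last by ring.
  by rewrite (le_trans (ler_normD _ _))// mulrDl lerD// ?lu ?lw.
have LW (B C : R) (u : R -> R) : B <= C -> lip B u -> lip C u.
  by move=> BC lu x h; rewrite (le_trans (lu x h))// ler_wpM2r.
have L00 := LM _ _ a0 aL0 b0 bL0; have L01 := LM _ _ a0 aL0 b1 bL1.
have L10 := LM _ _ a1 aL1 b0 bL0; have L11 := LM _ _ a1 aL1 b1 bL1.
have L20 := LM _ _ a2 aL2 b0 bL0; have L02 := LM _ _ a0 aL0 b2 bL2.
split.
- by move=> x; rewrite (le_trans (M _ _ x (a0 x) (b0 x)))//; lra.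
- move=> x; rewrite (le_trans (ler_normD _ _))//.
  by have := M _ _ x (a1 x) (b0 x); have := M _ _ x (a0 x) (b1 x); lra.
- move=> x; rewrite (le_trans (ler_normD _ _))//.
  have := ler_normD (q2 x * p x) (2 * (q1 x * p1 x)).
  rewrite (normrM 2) (ger0_norm (_ : 0 <= 2))//.
  have := M _ _ x (a2 x) (b0 x); have := M _ _ x (a0 x) (b2 x).
  by have := M _ _ x (a1 x) (b1 x); lra.
- move=> x h.
  have Hq := aT x h; have Hp := bT x h.
  have Lq := aL0 x h; have Lp := bL0 x h.
  set r := q (x + h) - q x - _ - _ in Hq; set t := p (x + h) - p x - _ - _ in Hp.
  set A := q (x + h) - q x in Lq; set B := p (x + h) - p x in Lp.
  have h0 := normr_ge0 h; have h30 : 0 <= `|h| ^+ 3 by exact: exprn_ge0.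
  have hh : `|h| ^+ 2 = h ^+ 2 by rewrite real_normK// num_real.
  rewrite (_ : _ - _ = r * p x + q x * t + (A - q1 x * h) * B + q1 x * h * (B - p1 x * h)); last first.
    by rewrite /r /t /A /B; field.
  have Ah : `|A - q1 x * h| <= 2 * D * `|h|.
    rewrite (le_trans (ler_normB _ _))// normrM.
    by have := ler_wpM2r h0 (a1 x); lra.
  have Bh : `|B - p1 x * h| <= 2 * E * `|h|.
    rewrite (le_trans (ler_normB _ _))// normrM.
    by have := ler_wpM2r h0 (b1 x); lra.
  have [h1|h1] := leP `|h| 1.
    have Ah2 : `|A - q1 x * h| <= 2 * D * `|h| ^+ 2.
      rewrite (_ : A - q1 x * h = r + q2 x * h ^+ 2 / 2); last by rewrite /r /A; ring.
      rewrite (le_trans (ler_normD _ _))// -mulrA normrM normrM (ger0_norm (sqr_ge0 h)) -hh.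
      have := ler_wpM2r (sqr_ge0 `|h|) (a2 x).
      have : D * `|h| ^+ 3 <= D * `|h| ^+ 2.
        by rewrite ler_wpM2l// exprSr ler_piMr// sqr_ge0.
      rewrite (ger0_norm (_ : 0 <= 2^-1))//.
      by have := mulr_ge0 D0 (sqr_ge0 `|h|); move: Hq; lra.
    have Bh2 : `|B - p1 x * h| <= 2 * E * `|h| ^+ 2.
      rewrite (_ : B - p1 x * h = t + p2 x * h ^+ 2 / 2); last by rewrite /t /B; ring.
      rewrite (le_trans (ler_normD _ _))// -mulrA normrM normrM (ger0_norm (sqr_ge0 h)) -hh.
      have := ler_wpM2r (sqr_ge0 `|h|) (b2 x).
      have : E * `|h| ^+ 3 <= E * `|h| ^+ 2.
        by rewrite ler_wpM2l// exprSr ler_piMr// sqr_ge0.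
      rewrite (ger0_norm (_ : 0 <= 2^-1))//.
      by have := mulr_ge0 E0 (sqr_ge0 `|h|); move: Hp; lra.
    have T1 : `|r * p x| <= D * E * `|h| ^+ 3.
      by rewrite normrM (_ : _ * `|h| ^+ 3 = D * `|h| ^+ 3 * E); [rewrite ler_pM|ring].
    have T2 : `|q x * t| <= D * E * `|h| ^+ 3.
      by rewrite normrM -mulrA ler_pM.
    have T3 : `|(A - q1 x * h) * B| <= 2 * (D * E * `|h| ^+ 3).
      by rewrite normrM (_ : 2 * _ = 2 * D * `|h| ^+ 2 * (E * `|h|)); [rewrite ler_pM|ring].
    have T4 : `|q1 x * h * (B - p1 x * h)| <= 2 * (D * E * `|h| ^+ 3).
      rewrite normrM (_ : 2 * _ = D * `|h| * (2 * E * `|h| ^+ 2)); last by ring.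
      by rewrite ler_pM// normrM ler_pM.
    rewrite (le_trans (ler_normD _ _))//.
    have := ler_normD (r * p x + q x * t) ((A - q1 x * h) * B).
    have := ler_normD (r * p x) (q x * t).
    have X := mulr_ge0 DE h30.
    rewrite (_ : 20 * D * E * `|h| ^+ 3 = 20 * (D * E * `|h| ^+ 3)); last by ring.
    lra.
  have h2 : `|h| ^+ 2 <= `|h| ^+ 3 by rewrite [leRHS]exprSr ler_peMr// ?sqr_ge0// ltW.
  have T1 : `|r * p x| <= D * E * `|h| ^+ 3.
    by rewrite normrM (_ : _ * `|h| ^+ 3 = D * `|h| ^+ 3 * E); [rewrite ler_pM|ring].
  have T2 : `|q x * t| <= D * E * `|h| ^+ 3 by rewrite normrM -mulrA ler_pM.
  have X2 : D * E * `|h| ^+ 2 <= D * E * `|h| ^+ 3 by rewrite ler_wpM2l.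
  have T3 : `|(A - q1 x * h) * B| <= 2 * (D * E * `|h| ^+ 2).
    by rewrite normrM (_ : 2 * _ = 2 * D * `|h| * (E * `|h|)); [rewrite ler_pM|ring].
  have T4 : `|q1 x * h * (B - p1 x * h)| <= 2 * (D * E * `|h| ^+ 2).
    rewrite normrM (_ : 2 * _ = D * `|h| * (2 * E * `|h|)); last by ring.
    by rewrite ler_pM// normrM ler_pM.
  rewrite (le_trans (ler_normD _ _))//.
  have := ler_normD (r * p x + q x * t) ((A - q1 x * h) * B).
  have := ler_normD (r * p x) (q x * t).
  have X := mulr_ge0 DE h30.
  rewrite (_ : 20 * D * E * `|h| ^+ 3 = 20 * (D * E * `|h| ^+ 3)); last by ring.
  lra.
- by apply: LW L00; lra.
- by apply: LW (LD _ _ _ _ L10 L01); lra.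
- apply: LW (LD _ _ _ _ (LD _ _ _ _ L20 (_ : lip (4 * (D * E)) _)) L02); first lra.
  move=> x h; rewrite -mulrBr normrM (ger0_norm (_ : 0 <= 2))//.
  by have := L11 x h; lra.
Qed.

Definition pos (t : R) := Num.max t 0.
(* Cubic spline equal to 0 for t <= 0 and to t - 1 for t >= 2, and its derivatives. *)
Definition spline t := (pos t ^+ 3 - 2 * pos (t - 1) ^+ 3 + pos (t - 2) ^+ 3) / 6.
Definition spline1 t := (pos t ^+ 2 - 2 * pos (t - 1) ^+ 2 + pos (t - 2) ^+ 2) / 2.
Definition spline2 t := pos t - 2 * pos (t - 1) + pos (t - 2).

Lemma pos_lip t h : `|pos (t + h) - pos t| <= `|h|.
Proof.
rewrite /pos; case: (lerP t 0) => t0; case: (lerP (t + h) 0) => th;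
  case: (lerP 0 h) => h0; rewrite ?(ger0_norm h0) ?(ltr0_norm h0) ler_norml;
  apply/andP; split; lra.
Qed.

(** The cube of the positive part is twice differentiable with Lipschitz second derivative, so its
    cubic Taylor bound persists across the knot. *)
Lemma pos_taylor t h :
  `|pos (t + h) ^+ 3 - pos t ^+ 3 - 3 * pos t ^+ 2 * h - 3 * pos t * h ^+ 2| <= `|h| ^+ 3.
Proof.
rewrite /pos; case: (lerP t 0) => t0; case: (lerP (t + h) 0) => th.
- by rewrite !expr0n /= !(mulr0, mul0r, subr0) normr0 exprn_ge0.
- have h0 : 0 < h by lra.
  rewrite !expr0n /= !(mulr0, mul0r, subr0) !gtr0_norm ?exprn_gt0//.
  by rewrite lerXn2r ?nnegrE ?(ltW th) ?(ltW h0)//; lra.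
- have h0 : h < 0 by lra.
  rewrite expr0n /= (ltr0_norm h0) ler_norml.
  have e : (t + h) ^+ 3 = t ^+ 3 + 3 * t ^+ 2 * h + 3 * t * h ^+ 2 + h ^+ 3 by ring.
  have k : 0 <= - (t + h) by lra.
  have k3 : 0 <= (- (t + h)) ^+ 3 by exact: exprn_ge0.
  have k4 : (- (t + h)) ^+ 3 <= (- h) ^+ 3 by rewrite lerXn2r ?nnegrE//; lra.
  have e2 : (- (t + h)) ^+ 3 = - (t + h) ^+ 3 by ring.
  have e3 : (- h) ^+ 3 = - h ^+ 3 by ring.
  by apply/andP; split; lra.
- rewrite (_ : _ - _ = h ^+ 3); last by ring.
  by rewrite normrX.
Qed.

(** As a second difference of pos^3 / 6, the spline is the average of pos (t - x - y) over x and y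
    in [0, 1]; the bound 1 is the mean of x + y. *)
Lemma spline_near t : `|spline t - pos t| <= 1.
Proof.
rewrite /spline /pos ler_norml.
case: (lerP t 0) => t0; case: (lerP (t - 1) 0) => t1; case: (lerP (t - 2) 0) => t2;
  try lra; rewrite ?expr0n /=.
- have : t ^+ 3 <= t by rewrite exprS ler_piMr ?(ltW t0)//; apply: exprn_ile1; lra.
  have : 0 <= t ^+ 3 by rewrite exprn_ge0// ltW.
  by move=> *; apply/andP; split; lra.
- have e : 0 <= (2 - t) ^+ 3 by apply: exprn_ge0; lra.
  have e1 : (2 - t) ^+ 3 <= 1 by apply: exprn_ile1; lra.
  have E : t ^+ 3 - 2 * (t - 1) ^+ 3 = 6 * (t - 1) + (2 - t) ^+ 3 by ring.
  by rewrite E; apply/andP; split; lra.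
Qed.

Lemma spline1_bound t : `|spline1 t| <= 1.
Proof.
rewrite /spline1 /pos ler_norml.
case: (lerP t 0) => t0; case: (lerP (t - 1) 0) => t1; case: (lerP (t - 2) 0) => t2;
  try lra; rewrite ?expr0n /=; apply/andP; split; nra.
Qed.

Lemma spline2_bound t : `|spline2 t| <= 1.
Proof.
rewrite /spline2 /pos ler_norml.
case: (lerP t 0) => t0; case: (lerP (t - 1) 0) => t1; case: (lerP (t - 2) 0) => t2;
  apply/andP; split; lra.
Qed.

Lemma spline2_lip t h : `|spline2 (t + h) - spline2 t| <= 4 * `|h|.
Proof.
rewrite (_ : _ - _ = (pos (t + h) - pos t) - 2 * (pos (t - 1 + h) - pos (t - 1)) +
  (pos (t - 2 + h) - pos (t - 2))); last by rewrite /spline2 !(addrAC _ _ h); ring.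
rewrite (le_trans (ler_normD _ _))//.
have := ler_normB (pos (t + h) - pos t) (2 * (pos (t - 1 + h) - pos (t - 1))).
rewrite (normrM 2) (ger0_norm (_ : 0 <= 2))//.
have := pos_lip t h; have := pos_lip (t - 1) h; have := pos_lip (t - 2) h; lra.
Qed.

Lemma spline_taylor t h :
  `|spline (t + h) - spline t - spline1 t * h - spline2 t * h ^+ 2 / 2| <= `|h| ^+ 3.
Proof.
pose r u := pos (u + h) ^+ 3 - pos u ^+ 3 - 3 * pos u ^+ 2 * h - 3 * pos u * h ^+ 2.
rewrite (_ : _ - _ = (r t - 2 * r (t - 1) + r (t - 2)) / 6); last first.
  by rewrite /r /spline /spline1 /spline2 !(addrAC _ _ h); field.
rewrite normrM (ger0_norm (_ : 0 <= 6^-1))//.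
have := ler_normD (r t - 2 * r (t - 1)) (r (t - 2)).
have := ler_normB (r t) (2 * r (t - 1)).
rewrite (normrM 2) (ger0_norm (_ : 0 <= 2))//.
have := pos_taylor t h; have := pos_taylor (t - 1) h; have := pos_taylor (t - 2) h.
rewrite -/(r _) -/(r _) -/(r _); have := exprn_ge0 3 (normr_ge0 h); lra.
Qed.

End smooth_functions.

Section soft_clip.
Context (R : realType).
Implicit Types (q : R -> R) (D s x y h : R).

(** The Lipschitz bounds of [q] and [q1] follow from the expansion if |h| <= 1 and from boundedness
    otherwise. For [q1], the expansions at x with step h and at x + h with step -h are added, which
    eliminates the values of [q]. *)
Lemma TC_of_taylor D q q1 q2 : (forall x, `|q x| <= D) -> (forall x, `|q1 x| <= D) ->
  (forall x, `|q2 x| <= D) ->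
  (forall x h, `|q (x + h) - q x - q1 x * h - q2 x * h ^+ 2 / 2| <= D * `|h| ^+ 3) ->
  lip D q2 -> TC (3 * D) q q1 q2.
Proof.
move=> b0 b1 b2 bT l2.
have D0 : 0 <= D by exact: le_trans (b0 0).
have D3 : D <= 3 * D by lra.
have T1 x h : `|q1 x * h| <= D * `|h| by rewrite normrM ler_wpM2r.
have T2 x h : `|q2 x * h ^+ 2 / 2| <= D * `|h| ^+ 2 / 2.
  rewrite normrM normrM normrX (ger0_norm (_ : 0 <= 2^-1))// ler_wpM2r//.
  by rewrite ler_wpM2r// exprn_ge0.
have P2 h : 0 <= `|h| ^+ 2 by exact: exprn_ge0.
have h21 h : `|h| <= 1 -> `|h| ^+ 2 <= `|h| by move=> h1; rewrite expr2 ler_piMr.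
have h32 h : `|h| <= 1 -> `|h| ^+ 3 <= `|h| ^+ 2 by move=> h1; rewrite exprSr ler_piMr.
have big (u : R -> R) x h : (forall x, `|u x| <= D) -> 1 < `|h| -> `|u (x + h) - u x| <= 3 * D * `|h|.
  move=> bu h1; rewrite (le_trans (ler_normB _ _))//.
  have := bu (x + h); have := bu x; have : D <= D * `|h| by rewrite ler_peMr// ltW.
  lra.
split.
- by move=> x; exact: le_trans D3.
- by move=> x; exact: le_trans D3.
- by move=> x; exact: le_trans D3.
- by move=> x h; rewrite (le_trans (bT x h))// ler_wpM2r// exprn_ge0.
- move=> x h; have [h1|h1] := leP `|h| 1; last exact: big.
  rewrite (_ : q (x + h) - q x = (q (x + h) - q x - q1 x * h - q2 x * h ^+ 2 / 2) +
    (q1 x * h + q2 x * h ^+ 2 / 2)); last by ring.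
  rewrite (le_trans (ler_normD _ _))//.
  have := ler_normD (q1 x * h) (q2 x * h ^+ 2 / 2).
  have := T1 x h; have := T2 x h; have := bT x h.
  have := ler_wpM2l D0 (h21 h h1); have := ler_wpM2l D0 (h32 h h1).
  have := mulr_ge0 D0 (normr_ge0 h); lra.
- move=> x h; have [h1|h1] := leP `|h| 1; last exact: big.
  have [->|hn0] := eqVneq h 0; first by rewrite addr0 subrr normr0 mulr0.
  have hp : 0 < `|h| by rewrite normr_gt0.
  rewrite -(ler_pM2r hp) -normrM.
  have B1 := bT x h; have B2 := bT (x + h) (- h).
  rewrite (_ : (q1 (x + h) - q1 x) * h =
    (q (x + h) - q x - q1 x * h - q2 x * h ^+ 2 / 2) +
    (q (x + h + - h) - q (x + h) - q1 (x + h) * (- h) - q2 (x + h) * (- h) ^+ 2 / 2) +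
    (q2 x * h ^+ 2 / 2 + q2 (x + h) * h ^+ 2 / 2)); last by rewrite addrK; ring.
  set u := q (x + h) - _ - _ - _ in B1 *; set v := q (x + h + - h) - _ - _ - _ in B2 *.
  rewrite (le_trans (ler_normD _ _))//.
  have := ler_normD u v.
  have := ler_normD (q2 x * h ^+ 2 / 2) (q2 (x + h) * h ^+ 2 / 2).
  have := T2 x h; have := T2 (x + h) h.
  rewrite normrN in B2.
  have := ler_wpM2l D0 (h32 h h1).
  rewrite (_ : 3 * D * `|h| * `|h| = 3 * (D * `|h| ^+ 2)); last by ring.
  move: B1 B2; lra.
- by move=> x h; rewrite (le_trans (l2 x h))// ler_wpM2r.
Qed.

Variables (e M : R).
Hypothesis e0 : 0 < e.
Hypothesis M0 : 0 <= M.

Definition clip (w : R) := pos w - pos (w - M).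
(* Smooth version of w |-> min (max w 0) M. *)
Definition softclip (w : R) := e * (spline (w / e) - spline ((w - M) / e)).

Lemma pos_scale w : e * pos (w / e) = pos w.
Proof. by rewrite /pos maxr_pMr ?ltW// mulr0 mulrC divfK ?gt_eqF. Qed.

Lemma clip_ge0 w : 0 <= clip w.
Proof.
by move: M0; rewrite /clip /pos; case: (lerP w 0) => w0; case: (lerP (w - M) 0) => w1; lra.
Qed.

Lemma clip_leM w : clip w <= M.
Proof.
by move: M0; rewrite /clip /pos; case: (lerP w 0) => w0; case: (lerP (w - M) 0) => w1; lra.
Qed.

Lemma clip_le_pos w : clip w <= pos w.
Proof.
by move: M0; rewrite /clip /pos; case: (lerP w 0) => w0; case: (lerP (w - M) 0) => w1; lra.
Qed.

Lemma clip_pos w : clip w < M -> clip w = pos w.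
Proof.
by move: M0; rewrite /clip /pos; case: (lerP w 0) => w0; case: (lerP (w - M) 0) => w1; lra.
Qed.

Lemma softclip_near w : `|softclip w - clip w| <= 2 * e.
Proof.
rewrite /clip -(pos_scale w) -(pos_scale (w - M)) /softclip.
rewrite (_ : _ - _ = e * ((spline (w / e) - pos (w / e)) -
  (spline ((w - M) / e) - pos ((w - M) / e)))); last by ring.
rewrite normrM gtr0_norm// [leRHS]mulrC; apply: ler_wpM2l; first exact: ltW.
rewrite (le_trans (ler_normB _ _))//.
by have := spline_near (w / e); have := spline_near ((w - M) / e); lra.
Qed.

Lemma softclip_bound w : `|softclip w| <= M + 2 * e.
Proof.
rewrite -(subrK (clip w) (softclip w)) (le_trans (ler_normD _ _))//.
rewrite (ger0_norm (clip_ge0 w)).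
by have := softclip_near w; have := clip_leM w; lra.
Qed.

Lemma softclip_TC : exists D q1 q2, TC D softclip q1 q2.
Proof.
pose q1 w := spline1 (w / e) - spline1 ((w - M) / e).
pose q2 w := (spline2 (w / e) - spline2 ((w - M) / e)) / e.
(* M + 2e bounds the function, 2 the first derivative and 2/e the second one; the last summand
   covers the Taylor remainder, 2 / e^2, and the Lipschitz constant of the second derivative, 8 /
   e^2. *)
pose D := M + 2 * e + 2 + 2 / e + 8 / e ^+ 2.
have ei : 0 < e^-1 by rewrite invr_gt0.
have e2i : 0 < (e ^+ 2)^-1 by rewrite invr_gt0 exprn_gt0.
have e2' : 0 <= 2 / e by rewrite mulr_ge0// ltW.
have e8 : 0 <= 8 / e ^+ 2 by rewrite mulr_ge0// ltW.
have M0' := M0; have e0' := e0.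
exists (3 * D), q1, q2; apply: TC_of_taylor.
- by move=> x; rewrite (le_trans (softclip_bound x))// /D; lra.
- move=> x; rewrite (le_trans (ler_normB _ _))//.
  by have := spline1_bound (x / e); have := spline1_bound ((x - M) / e); rewrite /D; lra.
- move=> x; rewrite /q2 normrM (gtr0_norm ei).
  apply: (@le_trans _ _ (2 / e)); last by rewrite /D; lra.
  rewrite ler_pM2r// (le_trans (ler_normB _ _))//.
  by have := spline2_bound (x / e); have := spline2_bound ((x - M) / e); lra.
- move=> x h.
  have A := spline_taylor (x / e) (h / e); have B := spline_taylor ((x - M) / e) (h / e).
  rewrite /softclip /q1 /q2.
  have -> : (x + h) / e = x / e + h / e by rewrite mulrDl.
  have -> : (x + h - M) / e = (x - M) / e + h / e by rewrite -mulrDl addrAC.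
  set u := spline (x / e + h / e) - _ - _ - _ in A.
  set v := spline ((x - M) / e + h / e) - _ - _ - _ in B.
  rewrite (_ : _ - _ = e * (u - v)); last by rewrite /u /v; field; rewrite gt_eqF.
  rewrite normrM gtr0_norm//.
  apply: (@le_trans _ _ (e * (2 * `|h / e| ^+ 3))).
    apply: ler_wpM2l; first exact: ltW.
    by rewrite (le_trans (ler_normB _ _))//; lra.
  rewrite normrM (gtr0_norm ei) exprMn.
  rewrite (_ : e * _ = 2 / e ^+ 2 * `|h| ^+ 3); last by field; rewrite gt_eqF.
  by rewrite ler_wpM2r ?exprn_ge0// /D; lra.
- move=> x h; rewrite /q2.
  have -> : (x + h) / e = x / e + h / e by rewrite mulrDl.
  have -> : (x + h - M) / e = (x - M) / e + h / e by rewrite -mulrDl addrAC.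
  have A := spline2_lip (x / e) (h / e); have B := spline2_lip ((x - M) / e) (h / e).
  rewrite -mulrBl normrM (gtr0_norm ei).
  apply: (@le_trans _ _ (8 * `|h / e| / e)).
    rewrite ler_pM2r// (_ : _ - _ = (spline2 (x / e + h / e) - spline2 (x / e)) -
      (spline2 ((x - M) / e + h / e) - spline2 ((x - M) / e))); last by ring.
    by rewrite (le_trans (ler_normB _ _))//; lra.
  rewrite normrM (gtr0_norm ei) (_ : _ / e = 8 / e ^+ 2 * `|h|); last by field; rewrite gt_eqF.
  by rewrite ler_wpM2r// /D; lra.
Qed.

End soft_clip.

Section product_algebra.
Context (R : realType) (p : nat).
Implicit Types (F G : (nat -> R) -> R).

(* The algebra spanned by the products for which the central limit theorem is available. *)
Inductive prod_alg : ((nat -> R) -> R) -> Prop :=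
| prod_alg_prod D (q q1 q2 : nat -> R -> R) : (forall j, TC D (q j) (q1 j) (q2 j)) ->
    prod_alg (fun w => \prod_(j < p) q j (w j))
| prod_alg_add F G : prod_alg F -> prod_alg G -> prod_alg (fun w => F w + G w)
| prod_alg_scale c F : prod_alg F -> prod_alg (fun w => c * F w).

Lemma prod_alg_mul F G : prod_alg F -> prod_alg G -> prod_alg (fun w => F w * G w).
Proof.
elim => {F} [D q q1 q2 tq|F1 F2 _ IH1 _ IH2|c F _ IH].
- elim => {G} [E r r1 r2 tr|G1 G2 _ IH1 _ IH2|c G _ IH].
  + have := prod_alg_prod (fun j => TCM (tq j) (tr j)).
    by congr prod_alg; apply/funext => w; rewrite big_split.
  + by have := prod_alg_add IH1 IH2; congr prod_alg; apply/funext => w; rewrite mulrDr.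
  + by have := prod_alg_scale c IH; congr prod_alg; apply/funext => w; rewrite mulrCA.
- by move=> pG; have := prod_alg_add (IH1 pG) (IH2 pG); congr prod_alg; apply/funext => w; rewrite mulrDl.
- by move=> pG; have := prod_alg_scale c (IH pG); congr prod_alg; apply/funext => w; rewrite mulrA.
Qed.

Lemma prod_alg_cst c : prod_alg (fun=> c).
Proof.
have := prod_alg_scale c (prod_alg_prod (fun _ => TC_cst (1 : R))).
by congr prod_alg; apply/funext => w; rewrite big1 ?mulr1.
Qed.

Lemma prod_alg_exp n F : prod_alg F -> prod_alg (fun w => F w ^+ n).
Proof.
move=> pF; elim: n => [|n IH]; first exact: (prod_alg_cst 1).
by have := prod_alg_mul pF IH; congr prod_alg; apply/funext => w; rewrite exprS.
Qed.

Lemma prod_alg_sum (r : seq nat) (F : nat -> (nat -> R) -> R) :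
  (forall j, j \in r -> prod_alg (F j)) -> prod_alg (fun w => \sum_(j <- r) F j w).
Proof.
elim: r => [|j r IH] pF.
  by have := prod_alg_cst 0; congr prod_alg; apply/funext => w; rewrite big_nil.
have := prod_alg_add (pF j (mem_head _ _)) (IH (fun i ir => pF i (introT orP (or_intror ir)))).
by congr prod_alg; apply/funext => w; rewrite big_cons.
Qed.

(** A function of one coordinate is a product whose other factors are the constant 1. *)
Lemma prod_alg_coord D q q1 q2 j : (j < p)%N -> TC D q q1 q2 -> prod_alg (fun w => q (w j)).
Proof.
move=> jp tq.
pose K := Num.max D `|1 : R|.
have h i : TC K (if i == j then q else fun=> 1) (if i == j then q1 else fun=> 0)
    (if i == j then q2 else fun=> 0).
  case: eqP => _; first by apply: TC_le tq; rewrite le_max lexx.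
  by apply: TC_le (TC_cst 1); rewrite le_max lexx orbT.
have := prod_alg_prod h; congr prod_alg; apply/funext => w.
by rewrite (bigD1 (Ordinal jp))//= eqxx big1 ?mulr1// => i; rewrite -val_eqE /= => /negbTE ->.
Qed.

Lemma prod_alg_bound F : prod_alg F -> exists K, forall w, `|F w| <= K.
Proof.
elim => {F} [D q q1 q2 tq|F1 F2 _ [K1 H1] _ [K2 H2]|c F _ [K H]].
- exists (D ^+ p) => w; rewrite normr_prod -[X in _ ^+ X]card_ord -prodr_const.
  by apply: ler_prod => j _; rewrite normr_ge0; exact: (tc0 (tq j)).
- by exists (K1 + K2) => w; rewrite (le_trans (ler_normD _ _))// lerD.
- by exists (`|c| * K) => w; rewrite normrM ler_wpM2l.
Qed.

Lemma prod_alg_meas F : prod_alg F -> mfunctional F.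
Proof.
elim => {F} [D q q1 q2 tq|F1 F2 _ H1 _ H2|c F _ H] d T V mV.
- apply: measurable_prod => j _; apply: measurableT_comp; last exact: mV.
  exact: lip_measurable (tcL0 (tq j)).
- by apply: measurable_funD; [exact: H1|exact: H2].
- by apply: measurable_funM => //; exact: H.
Qed.

Definition sqpos (w : nat -> R) : R := \sum_(j < p) pos (w j) ^+ 2.

Lemma bernoulli (u : R) n : -1 <= u -> 1 + n%:R * u <= (1 + u) ^+ n.
Proof.
move=> u1; elim: n => [|n IH]; first by rewrite mul0r addr0 expr0.
rewrite exprS -natr1; have u10 : 0 <= 1 + u by lra.
have := ler_wpM2l u10 IH; have := mulr_ge0 (ler0n R n) (sqr_ge0 u); lra.
Qed.

(* (1 - y^n)^(k^n) with y = V / (k g) and al < g < be: by Bernoulli's inequality it is close to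
   1 if V / g < 1 and to 0 if V / g > 1. *)
Lemma step_poly (al be Vm e : R) : 0 <= al -> al < be -> 0 < e -> exists n N (u : R),
  0 <= u /\ forall V, 0 <= V <= Vm ->
  [/\ 0 <= (1 - (u * V) ^+ n) ^+ N <= 1,
    V <= al -> 1 - e <= (1 - (u * V) ^+ n) ^+ N &
    be <= V -> (1 - (u * V) ^+ n) ^+ N <= e].
Proof.
move=> al0 albe e0.
pose g := (al + be) / 2.
have g0 : 0 < g by rewrite /g; lra.
(* The level k g exceeds [Vm], which keeps y = V / (k g) in [0, 1]. *)
pose k := (Num.truncn (`|Vm| / g)).+1.
have kV : Vm <= k%:R * g.
  rewrite -ler_pdivrMr// (le_trans (ler_wpM2r _ (ler_norm Vm)))// ?invr_ge0 ?ltW//.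
  by rewrite truncnS_gt.
have k0 : 0 < k%:R :> R by rewrite ltr0n.
have kg : 0 < k%:R * g by exact: mulr_gt0.
have a1 : `|al / g| < 1.
  have alg : 0 <= al / g by rewrite divr_ge0// ltW.
  by rewrite (ger0_norm alg) ltr_pdivrMr// /g; lra.
have b1 : `|g / be| < 1.
  have be0 : 0 < be by lra.
  have gbe : 0 <= g / be by rewrite divr_ge0// ltW.
  by rewrite (ger0_norm gbe) ltr_pdivrMr// /g; lra.
have [N1 _ H1] : \forall n \near \oo, (al / g) ^+ n <= e.
  by move: (cvg_expr a1) => /cvgr_le /(_ _ e0).
have [N2 _ H2] : \forall n \near \oo, (g / be) ^+ n <= e.
  by move: (cvg_expr b1) => /cvgr_le /(_ _ e0).
pose n := maxn 1 (maxn N1 N2).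
have n1 : (N1 <= n)%N by rewrite /n; clear; lia.
have n2 : (N2 <= n)%N by rewrite /n; clear; lia.
have e1 := H1 n n1; have e2 := H2 n n2; move: n e1 e2 {n1 n2} => n e1 e2.
exists n, (k ^ n)%N, (k%:R * g)^-1; split; first by rewrite invr_ge0 ltW.
move=> V /andP[V0 V1].
have y0 : 0 <= (k%:R * g)^-1 * V by rewrite mulr_ge0// invr_ge0 ltW.
have y1 : (k%:R * g)^-1 * V <= 1 by rewrite mulrC ler_pdivrMr// mul1r (le_trans V1).
set y := _ * V in y0 y1 *.
have yn0 : 0 <= y ^+ n by exact: exprn_ge0.
have yn1 : y ^+ n <= 1 by exact: exprn_ile1.
have kn : (k ^ n)%:R * y ^+ n = (V / g) ^+ n.
  by rewrite natrX -exprMn /y invfM mulrA mulrA mulfV ?gt_eqF// mul1r mulrC.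
split.
- by rewrite exprn_ge0 ?subr_ge0//= exprn_ile1 ?subr_ge0// gerBl.
- move=> Val; apply: le_trans (bernoulli _ (_ : -1 <= - y ^+ n)); last lra.
  rewrite mulrN kn lerD2l lerN2 (le_trans _ e1)//.
  have [Vg ag] : 0 <= V / g /\ 0 <= al / g by split; rewrite divr_ge0// ltW.
  by rewrite lerXn2r ?nnegrE// ler_pM2r ?invr_gt0.
- move=> Vbe; set N := (k ^ n)%N.
  have be0 : 0 < be by lra.
  (* The upper bound also comes from Bernoulli: (1 - x)^N (1 + x)^N <= 1, and (1 + x)^N >= 1 + N x
     is large. *)
  have P1 : (1 - y ^+ n) ^+ N * (1 + N%:R * y ^+ n) <= 1.
    apply: (@le_trans _ _ ((1 - y ^+ n) ^+ N * (1 + y ^+ n) ^+ N)).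
      by rewrite ler_wpM2l ?exprn_ge0 ?subr_ge0// bernoulli//; lra.
    rewrite -exprMn exprn_ile1//; nra.
  have P2 : (be / g) ^+ n <= 1 + N%:R * y ^+ n.
    have [Vg ag] : 0 <= V / g /\ 0 <= be / g by split; rewrite divr_ge0// ltW.
    rewrite kn ler_wpDl// lerXn2r ?nnegrE//.
    by rewrite ler_pM2r ?invr_gt0.
  have B0 : 0 < (be / g) ^+ n by rewrite exprn_gt0// divr_gt0.
  apply: (@le_trans _ _ ((g / be) ^+ n)); last exact: e2.
  rewrite -[g / be]invf_div exprVn -[leRHS]mul1r ler_pdivlMr//.
  rewrite (le_trans _ P1)// ler_wpM2l// exprn_ge0// subr_ge0//.
Qed.

(** The sum of squares is unbounded, so coordinates are clipped at [M] with M^2 > x + de: a clipped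
    coordinate alone exceeds the threshold, and without one nothing is changed. Smoothing the clip
    costs at most de/4, which leaves the levels x + de/4 and x + 3 de/4 for [step_poly]. *)
Lemma step_fun (x de e : R) : 0 <= x -> 0 < de -> 0 < e -> exists2 F, prod_alg F &
  forall w, [/\ 0 <= F w <= 1, sqpos w <= x -> 1 - e <= F w &
    x + de < sqpos w -> F w <= e].
Proof.
move=> x0 de0 e0.
pose M := x + de + 1.
have M1 : 1 <= M by rewrite /M; lra.
have M0 : 0 <= M by lra.
have MM : x + de < M ^+ 2 by rewrite /M; nra.
pose eta := de / 4.
have eta0 : 0 < eta by rewrite /eta; lra.
have p10 : 0 < p%:R + 1 :> R by rewrite ltr_wpDl.
(* The smoothing scale: each square moves by at most 2s (2M + 2), and there are [p] of them. *)
pose s := Num.min 1 (eta / ((p%:R + 1) * (4 * M + 4))).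
have k0 : 0 < (p%:R + 1) * (4 * M + 4) by rewrite mulr_gt0//; lra.
have s0 : 0 < s by rewrite lt_min ltr01 divr_gt0.
have s1 : s <= 1 by rewrite ge_min lexx.
have sk : s * ((p%:R + 1) * (4 * M + 4)) <= eta by rewrite -ler_pdivlMr// ge_min lexx orbT.
have [D [q1 [q2 tq]]] := softclip_TC s0 M0.
pose V w := \sum_(0 <= j < p) softclip s M (w j) ^+ 2.
pose C (w : nat -> R) := \sum_(0 <= j < p) clip M (w j) ^+ 2.
have Sq w : sqpos w = \sum_(0 <= j < p) pos (w j) ^+ 2 by rewrite big_mkord.
have pV : prod_alg V.
  apply: (@prod_alg_sum (index_iota 0 p) (fun j w => softclip s M (w j) ^+ 2)) => j.
  by rewrite mem_index_iota => /andP[_ jp]; apply: prod_alg_exp; exact: prod_alg_coord jp tq.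
have VC w : `|V w - C w| <= eta.
  rewrite /V /C -sumrB (le_trans (ler_norm_sum _ _ _))//.
  apply: (@le_trans _ _ (\sum_(0 <= j < p) s * (4 * M + 4))).
    apply: ler_sum => j _; rewrite subr_sqr normrM.
    have := softclip_near M s0 (w j); have := softclip_bound s0 M0 (w j).
    have := clip_ge0 M0 (w j); have := clip_leM M0 (w j).
    move: (softclip _ _ _) (clip _ _) => u c c1 c2 hu huc.
    rewrite (_ : s * (4 * M + 4) = 2 * s * (2 * M + 2)); last by ring.
    rewrite ler_pM// (le_trans (ler_normD _ _))// (ger0_norm c2).
    by move: hu c1 s1; lra.
  rewrite sumr_const_nat subn0 (le_trans _ sk)//.
  rewrite -mulrnAr; apply: ler_wpM2l; first exact: ltW.
  by rewrite -mulr_natl; apply: ler_wpM2r; [lra|rewrite lerDl].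
have C0 w : 0 <= C w by apply: sumr_ge0 => j _; exact: sqr_ge0.
have V0 w : 0 <= V w by apply: sumr_ge0 => j _; exact: sqr_ge0.
have VM w : V w <= p%:R * (M + 2) ^+ 2.
  rewrite /V mulr_natl -[X in _ *+ X]subn0 -sumr_const_nat; apply: ler_sum => j _.
  rewrite -(real_normK (num_real _)) lerXn2r ?nnegrE//; first lra.
  by rewrite (le_trans (softclip_bound s0 M0 _))//; lra.
have CS w : C w <= sqpos w.
  rewrite Sq; apply: ler_sum => j _; rewrite lerXn2r ?nnegrE ?clip_ge0 ?clip_le_pos//.
  by rewrite /pos le_max lexx orbT.
have SC w : x + de < sqpos w -> x + de < C w.
  move=> xS; have [//|Cx] := ltP (x + de) (C w).
  suff SCw : sqpos w = C w by move: Cx; rewrite -SCw leNgt xS.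
  rewrite Sq /C big_nat [RHS]big_nat; apply: eq_bigr => j jp; rewrite -(clip_pos M0)//.
  rewrite ltNge; apply/negP => Mc.
  have : clip M (w j) ^+ 2 <= C w.
    rewrite /C (bigD1_seq j) ?iota_uniq ?mem_index_iota//= lerDl.
    by apply: sumr_ge0 => i _; exact: sqr_ge0.
  have : M ^+ 2 <= clip M (w j) ^+ 2 by rewrite lerXn2r ?nnegrE// (le_trans M0).
  lra.
have al0 : 0 <= x + eta by lra.
have albe : x + eta < x + de - eta by rewrite /eta; lra.
have [n [N [u [u0 H]]]] := @step_poly _ _ (p%:R * (M + 2) ^+ 2) _ al0 albe e0.
exists (fun w => (1 - (u * V w) ^+ n) ^+ N).
  apply: prod_alg_exp.
  have := prod_alg_add (prod_alg_cst 1) (prod_alg_scale (-1) (prod_alg_exp n (prod_alg_scale u pV))).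
  by congr prod_alg; apply/funext => w; rewrite mulN1r.
move=> w; have [|H1 H2 H3] := H (V w); first by rewrite V0 VM.
have := VC w; rewrite ler_norml => /andP[VC1 VC2].
split=> //.
- by move=> Sx; apply: H2; have := CS w; lra.
- by move=> /SC Sx; apply: H3; lra.
Qed.

End product_algebra.

(** * Convergence of distribution functions *)

Section portmanteau.
Context (R : realType) (p : nat).
Context (d : measure_display) (Omega : measurableType d) (P : probability Omega R).
Context (d' : measure_display) (Omega' : measurableType d') (P' : probability Omega' R).
Variables (x : nat -> nat -> Omega -> R) (y : nat -> Omega' -> R).
Hypothesis mx : forall n j, meas (x n j).
Hypothesis my : forall j, meas (y j).
Hypothesis xy : forall D (q q1 q2 : nat -> R -> R), (forall j, TC D (q j) (q1 j) (q2 j)) ->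
  Ex P (fun w => \prod_(j < p) q j (x n j w)) @[n --> \oo] -->
  Ex P' (fun w => \prod_(j < p) q j (y j w)).

Lemma L1_prod_alg d1 (O1 : measurableType d1) (P1 : probability O1 R) (v : nat -> O1 -> R) F :
  (forall j, meas (v j)) -> prod_alg p F -> L1 P1 (fun w => F (v ^~ w)).
Proof.
move=> mv pF; have [K FK] := prod_alg_bound pF.
by apply: (@L1_bounded _ _ _ P1 _ K) => [|w]; [exact: (prod_alg_meas pF mv)|exact: FK].
Qed.

Lemma prod_alg_cvg F : prod_alg p F ->
  Ex P (fun w => F ((x n) ^~ w)) @[n --> \oo] --> Ex P' (fun w => F (y ^~ w)).
Proof.
elim => {F} [D q q1 q2 tq|F G pF IF pG IG|c F pF IF]; first exact: xy tq.
- rewrite (ExD (L1_prod_alg P' my pF) (L1_prod_alg P' my pG)).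
  under eq_cvg do rewrite (ExD (L1_prod_alg P (mx _) pF) (L1_prod_alg P (mx _) pG)).
  exact: cvgD IF IG.
- rewrite (ExZl c (L1_prod_alg P' my pF)).
  under eq_cvg do rewrite (ExZl c (L1_prod_alg P (mx _) pF)).
  exact: cvgMr IF.
Qed.

Lemma measurable_sqpos d1 (O1 : measurableType d1) (v : nat -> O1 -> R) :
  (forall j, meas (v j)) -> meas (fun w => sqpos p (v ^~ w)).
Proof.
move=> mv; apply: measurable_sum => j; apply: measurable_funX.
by apply: measurable_maxr; [exact: mv|exact: measurable_cst].
Qed.

Lemma measurable_sqpos_le d1 (O1 : measurableType d1) (v : nat -> O1 -> R) (a : R) :
  (forall j, meas (v j)) -> measurable [set w | sqpos p (v ^~ w) <= a].
Proof.
move=> mv; have := measurable_sqpos mv measurableT (measurable_itv `]-oo, a]).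
by rewrite setTI; congr measurable; apply/seteqP; split=> w /=; rewrite in_itv.
Qed.

Lemma sqpos_prob_le (a e de : R) d1 (O1 : measurableType d1) (P1 : probability O1 R)
    (v : nat -> O1 -> R) F : (forall j, meas (v j)) -> prod_alg p F ->
  (forall w, [/\ 0 <= F w <= 1, sqpos p w <= a -> 1 - e <= F w &
    a + de < sqpos p w -> F w <= e]) -> 0 < e -> 
  fine (P1 [set w | sqpos p (v ^~ w) <= a]) - e <= Ex P1 (fun w => F (v ^~ w)) /\
  Ex P1 (fun w => F (v ^~ w)) <= fine (P1 [set w | sqpos p (v ^~ w) <= a + de]) + e.
Proof.
move=> mv pF HF e0; have LF := L1_prod_alg P1 mv pF.
have M b := measurable_sqpos_le b mv.
rewrite -(Ex_indic P1 (M a)) -(Ex_indic P1 (M (a + de))).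
have LI b := L1_indic P1 (M b); have Le := L1_cst P1 e.
have Ee := Ex_cst P1 e.
split; rewrite -{1}Ee -?(ExB (LI _) Le) -?(ExD (LI _) Le); apply: le_Ex => //.
- exact: L1B.
- move=> w; rewrite indicE; have [/andP[F0 F1] H _] := HF (v ^~ w).
  by case: (boolP (w \in _)) => [/set_mem/H|_] /=; lra.
- exact: L1D.
- move=> w; rewrite indicE; have [/andP[F0 F1] _ H] := HF (v ^~ w).
  case: (boolP (w \in _)) => [_|/negP nS] /=; first lra.
  suff /H : a + de < sqpos p (v ^~ w) by lra.
  by rewrite ltNge; apply/negP => Sa; apply: nS; exact: mem_set.
Qed.

Lemma sqpos_prob_cvg (a de e : R) : 0 <= a -> 0 < de -> 0 < e ->
  \forall n \near \oo,
    fine (P [set w | sqpos p ((x n) ^~ w) <= a]) <=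
      fine (P' [set w | sqpos p (y ^~ w) <= a + de]) + e /\
    fine (P' [set w | sqpos p (y ^~ w) <= a]) <=
      fine (P [set w | sqpos p ((x n) ^~ w) <= a + de]) + e.
Proof.
move=> a0 de0 e0; have e3 : 0 < e / 3 by lra.
have [F pF HF] := step_fun p a0 de0 e3.
have [_ B2] := sqpos_prob_le P' my pF HF e3; have [A2 _] := sqpos_prob_le P' my pF HF e3.
have /cvgrPdist_le /(_ _ e3) := prod_alg_cvg pF.
apply: filterS => n; rewrite ler_norml => /andP[C1 C2].
have [A1 B1] := sqpos_prob_le P (mx n) pF HF e3.
split; lra.
Qed.

(** The two distribution functions are compared at shifted points a - r/2, a and a + r/2, and
    continuity of the limit at [a] closes the gap. As [step_fun] asks for a nonnegative level, a < 0
    and a - r/2 < 0 are treated apart: there the event is empty. *)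
Lemma sqpos_cvg (Y : nat -> {RV P >-> R}) (Y0 : {RV P' >-> R}) :
  (forall n w, Y n w = sqpos p ((x n) ^~ w)) -> (forall w, Y0 w = sqpos p (y ^~ w)) ->
  cvg_in_distribution P P' Y Y0.
Proof.
move=> EY EY0 a ca.
have sq0 (w : nat -> R) : 0 <= sqpos p w by apply: sumr_ge0 => j _; exact: sqr_ge0.
have cY n b : cdf (Y n) b = P [set w | sqpos p ((x n) ^~ w) <= b].
  by rewrite /cdf /distribution /pushforward; congr (P _); apply/seteqP; split => w /=;
    rewrite in_itv /= EY.
have cY0 b : cdf Y0 b = P' [set w | sqpos p (y ^~ w) <= b].
  by rewrite /cdf /distribution /pushforward; congr (P' _); apply/seteqP; split => w /=;
    rewrite in_itv /= EY0.
have [a0|a0] := ltP a 0.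
  have E d1 (O1 : measurableType d1) (v : nat -> O1 -> R) :
      [set w | sqpos p (v ^~ w) <= a] = set0.
    apply/seteqP; split => w //= Sw; have := sq0 (v ^~ w); lra.
  rewrite cY0 E measure0.
  have -> : (fun n => cdf (Y n) a) = (fun=> 0%E) by apply/funext => n; rewrite cY E measure0.
  exact: cvg_cst.
pose g b := fine (P' [set w | sqpos p (y ^~ w) <= b]).
have gE b : cdf Y0 b = (g b)%:E.
  by rewrite cY0 /g fineK// fin_num_measure//; exact: measurable_sqpos_le.
have cg : g b @[b --> a] --> g a.
  apply: (@fine_cvg _ _ _ _ (fun b => (g b)%:E)).
  by rewrite -gE; move: ca; rewrite /continuous_at; apply: cvg_trans; apply: near_eq_cvg; near=> b; rewrite gE.
rewrite gE; apply: cvg_EFin.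
  near=> n; rewrite cY fin_num_measure//; exact: measurable_sqpos_le.
apply/cvgrPdist_le => e e0; have e2 : 0 < e / 2 by lra.
have /cvgrPdist_le /(_ _ e2) /nbhs_ballP [r /= r0 Hr] := cg.
have r2 : 0 < r / 2 by lra.
have gr b : `|a - b| < r -> `|g a - g b| <= e / 2 by move=> ab; apply: Hr.
have Hup := sqpos_prob_cvg a0 r2 e2.
have Hlow : \forall n \near \oo, g (a - r / 2) <= fine (P [set w | sqpos p ((x n) ^~ w) <= a]) + e / 2.
  have [ar|ar] := leP 0 (a - r / 2).
    by have := sqpos_prob_cvg ar r2 e2; apply: filterS => n [_]; rewrite subrK.
  near=> n; rewrite /g (_ : [set w | _] = set0).
    by rewrite measure0/= addr_ge0// ?fine_ge0// ltW.
  by apply/seteqP; split => w //= Sw; have := sq0 (y ^~ w); lra.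
near=> n; rewrite /= cY.
have [U _] : fine (P [set w | sqpos p (x n ^~ w) <= a]) <= g (a + r / 2) + e / 2 /\ 
   fine (P' [set w | sqpos p (y ^~ w) <= a]) <=
      fine (P [set w | sqpos p ((x n) ^~ w) <= a + r / 2]) + e / 2 by near: n.
have L : g (a - r / 2) <= fine (P [set w | sqpos p (x n ^~ w) <= a]) + e / 2 by near: n.
have g1 : `|g a - g (a + r / 2)| <= e / 2.
  by apply: gr; rewrite opprD addrA subrr sub0r normrN gtr0_norm//; lra.
have g2 : `|g a - g (a - r / 2)| <= e / 2.
  by apply: gr; rewrite opprB addrA addrAC subrr add0r gtr0_norm//; lra.
move: U L g1 g2; rewrite !ler_norml => U L /andP[? ?] /andP[? ?]; apply/andP; split; lra.
Unshelve. all: by end_near.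
Qed.

End portmanteau.

Section gaussian_vector.
Context (R : realType) (d : measure_display) (Omega : measurableType d)
  (P : probability Omega R) (n : nat) (Z : 'I_n -> {RV P >-> R}).
Hypothesis gaussZ : standard_gaussian_vector P Z.

Lemma Ex_gauss (g : R -> R) j K : measurable_fun setT g -> (forall x, `|g x| <= K) ->
  Ex P (g \o Z j) = Ex (gam R) g.
Proof.
move=> mg gK.
have mg' : measurable_fun setT (EFin \o g) by exact/measurable_EFinP.
have mZ : @measurable_fun _ _ Omega (measurableTypeR R) setT (Z j) by exact: (@measurable_funPT _ _ _ _ (Z j)).
pose W := mfun_of mZ.
transitivity (fine (\int[distribution P W]_x (EFin \o g) x)%E); last first.
  congr fine; apply: eq_measure_integral => A mA _; exact: gaussZ.2.
congr fine; rewrite -[LHS](@integral_distribution _ _ _ _ _ P W (EFin \o g))//.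
apply: (@L1_bounded _ _ _ P (g \o Z j) K) => [|w]; last exact: gK.
exact: measurableT_comp.
Qed.

Lemma Ex_prod_gauss s D (q q1 q2 : nat -> R -> R) : (forall j, TC D (q j) (q1 j) (q2 j)) ->
  Ex P (fun w => \prod_(j < n) q j (s * Z j w)) = \prod_(j < n) gsm s (q j) 0.
Proof.
move=> tq.
pose g (j : 'I_n) z := q j (s * z).
have mq j := lip_measurable (tcL0 (tq j)).
have mg j : measurable_fun setT (g j).
  apply: measurableT_comp; first exact: mq.
  by apply: measurable_funM => //; exact: measurable_id.
have gK j x : `|g j x| <= D by exact: tc0 (tq j) _.
suff H (r : seq 'I_n) : uniq r ->
    [/\ adapted Z r (fun w => \prod_(j <- r) g j (Z j w)),
        forall w, `|\prod_(j <- r) g j (Z j w)| <= D ^+ size r &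
        Ex P (fun w => \prod_(j <- r) g j (Z j w)) = \prod_(j <- r) gsm s (q j) 0].
  by have [_ _] := H (index_enum _) (index_enum_uniq _).
elim: r => [_|k r IH /[dup] ukr /= /andP[kr ur]].
  split; [|by move=> w; rewrite big_nil normr1|].
    by have -> : (fun w => \prod_(j <- [::]) g j (Z j w)) = cst 1; [apply/funext => w; rewrite big_nil|exact: measurable_cst].
  by rewrite big_nil; under eq_Ex do rewrite big_nil; rewrite Ex_cst.
have [A B C] := IH ur.
have L : L1 P (fun w => \prod_(j <- r) g j (Z j w)).
  by apply: (L1_bounded P _ B); exact: adapted_meas A.
have Lk : L1 P (g k \o Z k).
  by apply: (@L1_bounded _ _ _ P _ D) => [|w]; [exact: measurableT_comp|exact: gK].
split.
- apply: (@measurable_prod _ (past Z (k :: r))) => j jr.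
  by apply: adapted_comp; [exact: jr|exact: mg].
- move=> w; rewrite big_cons normrM exprS ler_pM//.
- under eq_Ex do rewrite big_cons mulrC.
  have [_ ->] := Ex_mul_past gaussZ.1 ukr A (mg k) L Lk.
  rewrite big_cons mulrC C (Ex_gauss k (mg k) (gK k)); congr (_ * _).
  by apply: eq_Ex => z; rewrite /g add0r.
Qed.

End gaussian_vector.

(** * Riemann sums and bandwidth rates *)

Section riemann_sums.
Context (R : realType).
Notation mu := (@lebesgue_measure R).

Lemma integrable_continuous (f : R -> R) (i : interval R) a b : continuous f ->
  [set` i] `<=` `[a, b] -> mu.-integrable [set` i] (EFin \o f).
Proof.
move=> cf iab; apply: (@integrableS _ _ _ mu `[a, b]) => //.
apply: continuous_compact_integrable; first exact: segment_compact.
exact: continuous_subspaceT.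
Qed.

Section lipschitz_function.
Variables (phi : R -> R) (L : R).
Hypothesis lphi : lip L phi.

Lemma lip_le x y : `|phi y - phi x| <= L * `|y - x|.
Proof. by rewrite -{1}(subrKC x y) lphi. Qed.

Lemma integral_step a b : a <= b ->
  `|\int[mu]_(x in `]a, b]) phi x - phi b * (b - a)| <= L * (b - a) ^+ 2.
Proof.
move=> ab.
have mab : (mu `]a, b] = (b - a)%:E)%E.
  by rewrite lebesgue_measure_itv/= lte_fin; case: ltP => // ba; congr EFin; lra.
have ia : mu.-integrable `]a, b] (EFin \o phi).
  apply: (@integrable_continuous _ _ a b); first exact: lip_continuous lphi.
  by move=> x /=; rewrite !in_itv/= => /andP[/ltW -> ->].
have ic r : mu.-integrable `]a, b] (EFin \o (fun=> r)).
  apply: (@integrable_continuous _ _ a b); first by move=> ?; exact: cvg_cst.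
  by move=> x /=; rewrite !in_itv/= => /andP[/ltW -> ->].
have cstE r : \int[mu]_(x in `]a, b]) r = r * (b - a).
  transitivity (r * fine (mu `]a, b])); first exact: Rintegral_cst.
  by rewrite mab.
rewrite -cstE -RintegralB//.
have ib : mu.-integrable `]a, b] (EFin \o (fun x => phi x - phi b)).
  apply: (@integrable_continuous _ _ a b); last by move=> x /=; rewrite !in_itv/= => /andP[/ltW -> ->].
  by move=> x; apply: cvgB; [exact: (lip_continuous lphi)|exact: cvg_cst].
rewrite (le_trans (le_normr_Rintegral _ _))//.
rewrite expr2 mulrA -cstE; apply: le_Rintegral => //.
  exact: integrable_norm ib.
move=> x; rewrite /= in_itv/= => /andP[ax xb].
rewrite (le_trans (lip_le _ _))//.
have L0 : 0 <= L by have := lphi 0 1; rewrite normr1 mulr1; apply: le_trans.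
by rewrite ler_wpM2l// ler0_norm; lra.
Qed.

Lemma riemann_sum_le (T : nat) k : (0 < T)%N -> (k <= T)%N ->
  `|\int[mu]_(x in `[0, k%:R / T%:R]) phi x -
    \sum_(1 <= t < k.+1) phi (t%:R / T%:R) / T%:R| <= k%:R * (L / T%:R ^+ 2).
Proof.
move=> T0 kT; have Tp : 0 < T%:R :> R by rewrite ltr0n.
elim: k kT => [_|k IH kT].
  by rewrite big_geq// !mul0r set_itv1 Rintegral_set1 subrr normr0.
have H := IH (ltnW kT); rewrite big_nat_recr//=.
set a := k%:R / T%:R in H *; set b := k.+1%:R / T%:R.
have ab : b - a = T%:R^-1 by rewrite /a /b -mulrBl -natrB// subSnn mul1r.
have ab' : a <= b by rewrite -subr_ge0 ab invr_ge0 ltW.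
have a0 : 0 <= a by rewrite divr_ge0// ltW.
have := @Rintegral_itvB R phi (BLeft 0) (BRight b) a.
rewrite !bnd_simp => /(_ _ a0 ab').
have ib : mu.-integrable `[0, b] (EFin \o phi).
  by apply: (@integrable_continuous _ _ 0 b); first exact: lip_continuous lphi.
move=> /(_ ib) Eb.
have S := integral_step ab'.
rewrite -Eb ab in S.
rewrite exprVn in S.
rewrite -natr1 mulrDl mul1r; apply: le_trans (lerD H S).
rewrite (le_trans _ (ler_normD _ _))//; rewrite le_eqVlt; apply/orP; left; apply/eqP; congr (`|_|); ring.
Qed.

(** Sampling points may be off by p/T, so as to admit lagged points (t - sg) / T. The displacement,
    the [p] missing terms and the Riemann error give the three summands of the constant [C], and
    each costs O(1/T). *)
Lemma riemann_sum_cvg (p : nat) (M : R) (s : nat -> nat -> R) : 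
  (forall u, 0 <= u <= 1 -> `|phi u| <= M) ->
  (forall T t, (t <= T)%N -> `|s T t - t%:R / T%:R| <= p%:R / T%:R) ->
  \sum_(p.+1 <= t < T.+1) phi (s T t) / T%:R @[T --> \oo] --> \int[mu]_(x in `[0, 1]) phi x.
Proof.
move=> phiM sT; set I := \int[mu]_(x in _) _.
have L0 : 0 <= L by have := lphi 0 1; rewrite normr1 mulr1; apply: le_trans.
pose C := L * p%:R + p%:R * M + L.
suff H T : (0 < T)%N -> (p <= T)%N ->
    `|I - \sum_(p.+1 <= t < T.+1) phi (s T t) / T%:R| <= C / T%:R.
  apply/cvgrPdist_le => e e0; near=> T.
  have T0 : (0 < T)%N by near: T; exact: nbhs_infty_gt.
  have pT : (p <= T)%N by near: T; exact: nbhs_infty_ge.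
  rewrite (le_trans (H T T0 pT))// ler_pdivrMr ?ltr0n// mulrC -ler_pdivrMr//.
  rewrite (le_trans (ler_norm _))//.
  near: T; exists (Num.truncn `|C / e|).+1 => // T /= CT.
  by rewrite (le_trans (ltW (truncnS_gt _)))// ler_nat.
move=> T0 pT; have Tp : 0 < T%:R :> R by rewrite ltr0n.
have H := riemann_sum_le T0 (leqnn T); rewrite divff ?gt_eqF// -/I in H.
rewrite (@big_cat_nat _ _ _ p.+1)//= in H.
have A : `|\sum_(1 <= t < p.+1) phi (t%:R / T%:R) / T%:R| <= p%:R * M / T%:R.
  rewrite (le_trans (ler_norm_sum _ _ _))//.
  have -> : p%:R * M / T%:R = \sum_(1 <= t < p.+1) M / T%:R.
    by rewrite sumr_const_nat subn1 -mulrA mulr_natl.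
  rewrite big_nat [leRHS]big_nat; apply: ler_sum => t /andP[_ tp].
  rewrite normrM [X in _ * X]gtr0_norm ?invr_gt0// ler_pM2r ?invr_gt0//.
  apply: phiM; rewrite divr_ge0 ?ler0n//= ler_pdivrMr// mul1r ler_nat.
  by rewrite (leq_trans _ pT).
have B : `|\sum_(p.+1 <= t < T.+1) phi (t%:R / T%:R) / T%:R -
    \sum_(p.+1 <= t < T.+1) phi (s T t) / T%:R| <= L * p%:R / T%:R.
  rewrite -sumrB (le_trans (ler_norm_sum _ _ _))//.
  apply: (@le_trans _ _ (\sum_(p.+1 <= t < T.+1) L * p%:R / T%:R / T%:R)).
    rewrite big_nat [leRHS]big_nat; apply: ler_sum => t /andP[_ tT].
    rewrite -mulrBl normrM [X in _ * X]gtr0_norm ?invr_gt0// ler_pM2r ?invr_gt0//.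
    by rewrite (le_trans (lip_le _ _))// -mulrA ler_wpM2l// distrC sT.
  rewrite sumr_const_nat -mulrnAr -[leRHS]mulr1; apply: ler_wpM2l.
    by rewrite divr_ge0// mulr_ge0.
  by rewrite -mulr_natl ler_pdivrMr// mul1r ler_nat subSS leq_subr.
have -> : C / T%:R = T%:R * (L / T%:R ^+ 2) + p%:R * M / T%:R + L * p%:R / T%:R.
  by rewrite /C; field; rewrite gt_eqF.
set S1 := \sum_(1 <= t < p.+1) _ in A H *; set S2 := bigop.body _ _ _ in H B *.
set S3 := bigop.body _ _ _ in B *.
rewrite (_ : I - S3 = (I - (S1 + S2)) + S1 + (S2 - S3)); last by ring.
rewrite (le_trans (ler_normD _ _))// lerD// (le_trans (ler_normD _ _))// lerD//.
Unshelve. all: by end_near.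
Qed.

End lipschitz_function.

End riemann_sums.

Section rates.
Context (R : realType).

Lemma powR_nat_cvg0 (a : R) : 0 < a -> T%:R `^ (- a) @[T --> \oo] --> (0 : R).
Proof.
move=> a0; apply/cvgrPdist_le => e e0; near=> T.
have T0 : 0 < T%:R :> R by rewrite ltr0n; near: T; exact: nbhs_infty_gt.
rewrite sub0r normrN ger0_norm ?powR_ge0// powRN invf_ple ?posrE ?powR_gt0//.
have -> : e^-1 = (e^-1 `^ (a^-1)) `^ a.
  by rewrite -powRrM mulVf ?gt_eqF// powRr1// invr_ge0 ltW.
apply: ge0_ler_powR; rewrite ?nnegrE ?powR_ge0 ?(ltW a0) ?(ltW T0)//.
near: T; exists (Num.truncn (e^-1 `^ a^-1)).+1 => // T /= CT.
by rewrite (le_trans (ltW (truncnS_gt _)))// ler_nat.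
Unshelve. all: by end_near.
Qed.

Lemma cvg0_le (u v : nat -> R) (N : nat) : (forall n, (N <= n)%N -> 0 <= u n <= v n) ->
  v @ \oo --> 0 -> u @ \oo --> 0.
Proof.
move=> uv v0; apply: (@squeeze_cvgr _ _ _ _ (fun=> 0) v) => //; last exact: cvg_cst.
by exists N.
Qed.

Variables (b : nat -> R) (h c C : R) (p : nat).
Hypothesis c0 : 0 < c.
Hypothesis C0 : 0 < C.
Hypothesis h14 : 4^-1 < h.
Hypothesis h12 : h < 2^-1.
Hypothesis bP : forall T : nat, (p < T)%N -> c * T%:R `^ (- h) <= b T <= C * T%:R `^ (- h).

Lemma bandwidth_gt0 T : (p < T)%N -> 0 < b T.
Proof.
move=> pT; have /andP[H _] := bP pT; apply: lt_le_trans H.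
by rewrite mulr_gt0// powR_gt0// ltr0n (leq_ltn_trans _ pT).
Qed.

Lemma bandwidth_cvg0 : b @ \oo --> 0.
Proof.
apply: (@cvg0_le _ (fun T => C * T%:R `^ (- h)) p.+1) => [T pT|].
  by rewrite (ltW (bandwidth_gt0 pT)); case/andP: (bP pT).
rewrite -[X in _ --> X](mulr0 C); apply: cvgMr; apply: powR_nat_cvg0; move: h14 h12; lra.
Qed.

(** Of order T^(1/2 - 2h), and h > 1/4. This controls the squared bias. *)
Lemma sqrt_bandwidth_sq_cvg0 : Num.sqrt T%:R * b T ^+ 2 @[T --> \oo] --> 0.
Proof.
apply: (@cvg0_le _ (fun T => C ^+ 2 * T%:R `^ (- (2 * h - 2^-1))) p.+1) => [T pT|].
  have T0 : 0 < T%:R :> R by rewrite ltr0n (leq_ltn_trans _ pT).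
  have b0 := bandwidth_gt0 pT; have /andP[_ H] := bP pT.
  rewrite mulr_ge0 ?sqr_ge0 ?sqrtr_ge0//=.
  have -> : T%:R `^ (- (2 * h - 2^-1)) = Num.sqrt T%:R * (T%:R `^ (- h)) ^+ 2.
    rewrite -powR12_sqrt ?ltW// -powR_mulrn ?powR_ge0// -powRrM -powRD; last first.
      by apply/implyP => _; rewrite gt_eqF.
    by congr (_ `^ _); lra.
  rewrite [leRHS]mulrCA -exprMn; apply: ler_wpM2l; rewrite ?sqrtr_ge0// lerXn2r ?nnegrE ?(ltW b0)//.
  by rewrite mulr_ge0 ?powR_ge0// ltW.
rewrite -[X in _ --> X](mulr0 (C ^+ 2)); apply: cvgMr; apply: powR_nat_cvg0; move: h14 h12; lra.
Qed.

(** Of order T^(h - 1/2), and h < 1/2. Up to a constant, this is sqrt T times the bound on the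
    kernel weights. *)
Lemma inv_sqrt_bandwidth_cvg0 : (Num.sqrt T%:R * b T)^-1 @[T --> \oo] --> 0.
Proof.
apply: (@cvg0_le _ (fun T => c^-1 * T%:R `^ (- (2^-1 - h))) p.+1) => [T pT|].
  have T0 : 0 < T%:R :> R by rewrite ltr0n (leq_ltn_trans _ pT).
  have b0 := bandwidth_gt0 pT; have /andP[H _] := bP pT.
  have s0 : 0 < Num.sqrt T%:R :> R by rewrite sqrtr_gt0.
  rewrite invr_ge0 mulr_ge0 ?(ltW s0) ?(ltW b0)//= powRN -invfM.
  rewrite lef_pV2 ?posrE ?mulr_gt0 ?powR_gt0//.
  rewrite powRD; last by apply/implyP => _; rewrite gt_eqF.
  by rewrite powR12_sqrt ?(ltW T0)// [leLHS]mulrCA; apply: ler_wpM2l; rewrite ?(ltW s0).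
rewrite -[X in _ --> X](mulr0 c^-1); apply: cvgMr; apply: powR_nat_cvg0; move: h14 h12; lra.
Qed.

Lemma bandwidth_infty (B : R) : \forall T \near \oo, B <= T%:R * b T.
Proof.
have B0 : 0 < (`|B| + 1)^-1 by rewrite invr_gt0 ltr_pwDr.
have /cvgrPdist_le /(_ _ B0) H := inv_sqrt_bandwidth_cvg0.
near=> T.
have pT : (p < T)%N by near: T; exact: nbhs_infty_gt.
have T1 : 1 <= T%:R :> R by rewrite ler1n (leq_ltn_trans _ pT).
have T0 : 0 < T%:R :> R by lra.
have b0 := bandwidth_gt0 pT.
have s0 : 0 < Num.sqrt T%:R * b T by rewrite mulr_gt0// sqrtr_gt0.
have : `|0 - (Num.sqrt T%:R * b T)^-1| <= (`|B| + 1)^-1 by near: T.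
rewrite sub0r normrN gtr0_norm ?invr_gt0// lef_pV2 ?posrE ?ltr_pwDr//.
have : Num.sqrt T%:R * b T <= T%:R * b T.
  by rewrite ler_pM2r// -[leRHS]sqr_sqrtr ?(ltW T0)// expr2; apply: ler_peMl; rewrite ?sqrtr_ge0// -[leLHS]sqrtr1 ler_sqrt// ltW.
have := ler_norm B; lra.
Unshelve. all: by end_near.
Qed.

End rates.

(** * Kernel weights *)

Section kernel_weights.
Context (R : realType) (K : R -> R).
Hypothesis sK : smoothing_kernel K.

Lemma kernel_ge0 x : 0 <= K x.
Proof. by case: sK => -[]. Qed.

Lemma kernel_continuous : continuous K.
Proof.
case: sK => _ aK _ x; apply/cvgrPdist_lt => e e0; have [r r0 H] := aK _ e0.
apply/nbhs_ballP; exists r => //= y xy.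
have [xley|/ltW ylex] := leP x y.
- have := H [:: (x, y)]; rewrite /= !big_seq1 /= distrC; apply=> //; first by rewrite xley.
  by move: xy; rewrite /ball/= distrC ger0_norm ?subr_ge0.
- have := H [:: (y, x)]; rewrite /= !big_seq1 /=; apply=> //; first by rewrite ylex.
  by move: xy; rewrite /ball/= ger0_norm ?subr_ge0.
Qed.

Lemma kernel_support x : 1 < `|x| -> K x = 0.
Proof.
case: sK => _ _ S x1; apply/eqP/negPn/negP => Kx.
have : closure [set x | K x != 0] x by exact: subset_closure.
by rewrite S /= in_itv/= -ler_norml leNgt x1.
Qed.

Lemma kernel_bounded : exists2 B, 0 < B & forall x, K x <= B.
Proof.
have l11 : -1 <= 1 :> R by lra.
have [c _ Hc] := EVT_max l11 (continuous_subspaceT kernel_continuous).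
exists (K c + 1); first by have := kernel_ge0 c; lra.
move=> x; have [x1|x1] := ltP 1 `|x|.
  by rewrite kernel_support//; have := kernel_ge0 c; lra.
by have := Hc x; rewrite in_itv/= -ler_norml => /(_ x1); lra.
Qed.

(** The set where [K] is nonzero is dense in [-1, 1], so it meets every open subinterval; continuity
    turns the point found into an interval. *)
Lemma kernel_pos u v : -1 <= u -> u < v -> v <= 1 ->
  exists k x1 x2 : R, [/\ 0 < k, u < x1, x1 < x2, x2 < v & forall x, x1 <= x <= x2 -> k <= K x].
Proof.
move=> u1 uv v1.
have [x [Kx /=]] : exists x, [set x | K x != 0] x /\ `]u, v[%classic x.
  case: sK => _ _ S.
  have mid : `[-1, 1]%classic ((u + v) / 2) by rewrite /= in_itv/=; apply/andP; split; lra.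
  rewrite -S in mid.
  apply: mid; apply: open_nbhs_nbhs; split; first exact: itv_open.
  by rewrite /= in_itv/=; apply/andP; split; lra.
rewrite in_itv/= => /andP[ux xv].
have Kx0 : 0 < K x by rewrite lt_neqAle eq_sym Kx kernel_ge0.
have K2 : 0 < K x / 2 by lra.
have /cvgrPdist_le /(_ _ K2) /nbhs_ballP [r /= r0 Hr] := @kernel_continuous x.
pose s := Num.min (r / 2) (Num.min ((x - u) / 2) ((v - x) / 2)).
have s0 : 0 < s by rewrite !lt_min; apply/and3P; split; lra.
have [s1 s2 s3] : [/\ s <= r / 2, s <= (x - u) / 2 & s <= (v - x) / 2].
  by rewrite /s !ge_min !lexx !orbT.
exists (K x / 2), (x - s), (x + s); split=> //; try lra.
move=> y /andP[y1 y2]; have := Hr y; rewrite /ball/= ler_norml => H.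
have /H /andP[] : `|x - y| < r by rewrite ltr_norml; apply/andP; split; lra.
lra.
Qed.

(** An interval of length len >= 2 contains at least len - 1 >= len / 2 integers. *)
Lemma count_sum (F : nat -> R) (k al len : R) (p T : nat) : (forall j, 0 <= F j) -> 0 <= k ->
  p%:R <= al -> al + len <= T%:R -> 2 <= len ->
  (forall j : nat, al <= j%:R <= al + len -> k <= F j) ->
  k * (len / 2) <= \sum_(p.+1 <= j < T.+1) F j.
Proof.
move=> F0 k0 pal alT l2 kF.
have al0 : 0 <= al by exact: le_trans pal.
pose u := (Num.truncn al).+1; pose q := (Num.truncn (len - 1)).+1.
have u1 : al < u%:R by exact: truncnS_gt.
have u2 : u%:R <= al + 1 by rewrite /u -natr1 lerD2r truncn_le.
have q1 : len - 1 < q%:R by exact: truncnS_gt.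
have q2 : q%:R <= len by rewrite /q -natr1 -lerBrDr truncn_le//; lra.
have pu : (p.+1 <= u)%N by rewrite -(ltr_nat R); lra.
have uT : (u + q <= T.+1)%N by rewrite -(ler_nat R) natrD -[T.+1%:R]natr1; lra.
rewrite (@big_cat_nat _ _ _ u)//=; last by rewrite (leq_trans _ uT)// leq_addr.
rewrite (@big_cat_nat _ _ _ (u + q)%N _ T.+1)//= ?leq_addr//.
have A : k * (len / 2) <= \sum_(u <= j < u + q) F j.
  apply: (@le_trans _ _ (\sum_(u <= j < u + q) k)).
    rewrite sumr_const_nat addKn -[leRHS]mulr_natr; apply: ler_wpM2l => //; lra.
  rewrite big_nat [leRHS]big_nat; apply: ler_sum => j /andP[uj ju]; apply: kF.
  have : u%:R <= j%:R :> R by rewrite ler_nat.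
  have : j.+1%:R <= (u + q)%:R :> R by rewrite ler_nat.
  by rewrite -natr1 natrD => *; apply/andP; split; lra.
have B m n : 0 <= \sum_(m <= j < n) F j by apply: sumr_ge0 => j _.
by have := B p.+1 u; have := B (u + q)%N T.+1; lra.
Qed.

(** Near the end points one half of the kernel window leaves the range of the sum. For t >= T/2 the
    indices below [t] are used, where the argument of [K] is positive, and for t < T/2 those above
    [t]; as b <= 1/4, these half windows stay in the range. *)
Lemma kernel_denominator p : exists2 c, 0 < c & exists2 N : R, 0 < N &
  forall (T t : nat) (b : R), (0 < T)%N -> N <= T%:R * b -> b <= 4^-1 -> N <= T%:R -> (t <= T)%N ->
  c * (T%:R * b) <= \sum_(p.+1 <= j < T.+1) K ((t%:R - j%:R) / (T%:R * b)).
Proof.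
have [k1 [x1 [x2 [k10 x10 x12 x21 H1]]]] : exists k x1 x2 : R,
  [/\ 0 < k, 0 < x1, x1 < x2, x2 < 1 & forall x, x1 <= x <= x2 -> k <= K x].
  by apply: kernel_pos; lra.
have [k2 [y1 [y2 [k20 y10 y12 y21 H2]]]] : exists k x1 x2 : R,
  [/\ 0 < k, -1 < x1, x1 < x2, x2 < 0 & forall x, x1 <= x <= x2 -> k <= K x].
  by apply: kernel_pos; lra.
exists (Num.min (k1 * ((x2 - x1) / 2)) (k2 * ((y2 - y1) / 2))).
  by rewrite lt_min !mulr_gt0//; lra.
(* 4p keeps the left half window above index p when t >= T/2, and p / (-y2) does so for the right
   one when [t] is small; the terms 2 / (x2 - x1) and 2 / (y2 - y1) give the intervals of indices
   length at least 2. *)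
pose N := 4 * p%:R + 2 / (x2 - x1) + 2 / (y2 - y1) + p%:R / (- y2) + 1.
have [d1 d2 d3] : [/\ 0 <= 2 / (x2 - x1), 0 <= 2 / (y2 - y1) & 0 <= p%:R / (- y2)].
  by split; apply: divr_ge0; rewrite ?ler0n//; lra.
have p0 : 0 <= p%:R :> R by exact: ler0n.
exists N; first by rewrite /N; lra.
move=> T t b T0 nN b4 TN tT; have Tp : 0 < T%:R :> R by rewrite ltr0n.
set n := T%:R * b in nN *.
have n0 : 0 < n by rewrite (lt_le_trans _ nN)// /N; lra.
have nT : n <= T%:R / 4 by rewrite /n ler_wpM2l// ltW.
have tTR : t%:R <= T%:R :> R by rewrite ler_nat.
have t0 : 0 <= t%:R :> R by exact: ler0n.
have [Tt|Tt] := leP (T%:R / 2) (t%:R : R).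
- have x2n : x2 * n <= n by rewrite ler_piMl ?ltW.
  have x1n : 0 <= x1 * n by rewrite mulr_ge0 ?ltW.
  apply: (@le_trans _ _ (k1 * ((x2 - x1) * n / 2))).
    apply: (@le_trans _ _ (k1 * ((x2 - x1) / 2) * n)); last by rewrite le_eqVlt; apply/orP; left; apply/eqP; ring.
    by rewrite ler_pM2r// ge_min lexx.
  apply: (@count_sum _ _ (t%:R - x2 * n)) => //; first by move=> j; exact: kernel_ge0.
  + exact: ltW.
  + by move: TN; rewrite /N; lra.
  + by lra.
  + by rewrite mulrC -ler_pdivrMr; [move: nN; rewrite /N; lra|lra].
  + move=> j /andP[j1 j2]; apply: H1.
    by rewrite ler_pdivlMr// ler_pdivrMr//; apply/andP; split; lra.
- have y2n : - y1 * n <= n by rewrite ler_piMl ?ltW//; lra.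
  apply: (@le_trans _ _ (k2 * ((y2 - y1) * n / 2))).
    apply: (@le_trans _ _ (k2 * ((y2 - y1) / 2) * n)); last by rewrite le_eqVlt; apply/orP; left; apply/eqP; ring.
    by rewrite ler_pM2r// ge_min lexx orbT.
  apply: (@count_sum _ _ (t%:R - y2 * n)) => //; first by move=> j; exact: kernel_ge0.
  + exact: ltW.
  + have : p%:R / (- y2) <= n by move: nN; rewrite /N; lra.
    by rewrite ler_pdivrMr; lra.
  + by lra.
  + by rewrite mulrC -ler_pdivrMr; [move: nN; rewrite /N; lra|lra].
  + move=> j /andP[j1 j2]; apply: H2.
    by rewrite ler_pdivlMr// ler_pdivrMr//; apply/andP; split; lra.
Qed.

Lemma kernel_weights p : exists2 Ck, 0 < Ck & exists2 N : R, 0 < N &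
  forall (T t : nat) (b : R), (0 < T)%N -> N <= T%:R * b -> b <= 4^-1 -> N <= T%:R -> (t <= T)%N ->
  [/\ \sum_(p.+1 <= i < T.+1) kernel_weight K p T b t%:Z i%:Z = 1,
      forall i : nat, 0 <= kernel_weight K p T b t%:Z i%:Z <= Ck / (T%:R * b) &
      forall i : nat, T%:R * b < `|t%:R - i%:R| -> kernel_weight K p T b t%:Z i%:Z = 0].
Proof.
have [c c0 [N N0 H]] := kernel_denominator p; have [B B0 KB] := kernel_bounded.
exists (B / c); first exact: divr_gt0.
exists N => // T t b T0 nN b4 TN tT.
have n0 : 0 < T%:R * b by exact: lt_le_trans nN.
have := H _ _ _ T0 nN b4 TN tT; set D := \sum_(_ <= j < _) _ => HD.
have D0 : 0 < D by apply: lt_le_trans HD; rewrite mulr_gt0.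
have E (i : nat) : kernel_weight K p T b t%:Z i%:Z = K ((t%:R - i%:R) / (T%:R * b)) / D.
  rewrite /kernel_weight intrB; congr (_ / _); apply: eq_bigr => j _; by rewrite intrB.
split.
- under eq_bigr do rewrite E.
  by rewrite -mulr_suml divff// gt_eqF.
- move=> i; rewrite E divr_ge0 ?kernel_ge0 ?(ltW D0)//=.
  rewrite ler_pdivrMr// (le_trans (KB _))//.
  have -> : B / c / (T%:R * b) * D = B * (D / (c * (T%:R * b))).
    by clear -n0 c0; move: (T%:R * b) n0 => n n0; field; rewrite !gt_eqF.
  have cn : 0 < c * (T%:R * b) by exact: mulr_gt0.
  apply: ler_peMr; first exact: ltW.
  by rewrite (ler_pdivlMr _ _ cn) mul1r.
- move=> i ti; rewrite E kernel_support ?mul0r//.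
  by rewrite normrM normfV (gtr0_norm n0) ltr_pdivlMr// mul1r.
Qed.

End kernel_weights.

(** * The least-squares estimator *)

Section lagged_sums.
Context (R : realType).

(** Reindexing by l = t - sg, with coefficient 0 outside the range, turns lagged sums into forms
    indexed from 0 to T. *)
Lemma shift_sum (F : nat -> nat -> R) (sg p T : nat) : (sg <= p)%N ->
  \sum_(p.+1 <= t < T.+1) F t (t - sg)%N =
  \sum_(0 <= l < T.+1) if (p < l + sg <= T)%N then F (l + sg)%N l else 0.
Proof.
move=> sp; rewrite -big_mkcond/=.
rewrite -[in LHS](subnK (leqW sp)) big_addn.
rewrite (@big_nat_widen _ _ _ _ _ T.+1)/=; last by rewrite leq_subr.
rewrite (@big_nat_widenl _ _ _ _ 0)//=.
apply: eq_big => [l|l _]; last by rewrite addnK.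
apply/idP/idP => /andP[]; clear -sp; lia.
Qed.

Context (d : measure_display) (Omega : measurableType d)
  (P : probability Omega R) (X : nat -> {RV P >-> R}).
Hypothesis indepX : mutually_independent P X.
Variables (z : R -> R) (v : R).
Hypothesis mz : measurable_fun [set: R] z.
Hypothesis Lz : forall t, L2 P (z \o X t).
Hypothesis Ez : forall t, Ex P (z \o X t) = 0.
Hypothesis Ez2 : forall t, Ex P (fun w => z (X t w) ^+ 2) = v.

Lemma second_moment_ge0 : 0 <= v.
Proof. by rewrite -(Ez2 0); exact: Ex_sqr_ge0. Qed.

Lemma lagsum_lin (g : nat -> R) sg p T : (sg <= p)%N ->
  let S := fun w => \sum_(p.+1 <= t < T.+1) g t * z (X (t - sg)%N w) in
  L2 P S /\ Ex P (fun w => S w ^+ 2) = v * \sum_(p.+1 <= t < T.+1) g t ^+ 2.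
Proof.
move=> sp S; pose c l := if (p < l + sg <= T)%N then g (l + sg)%N else 0.
have SE : S = lin X z c T.+1.
  apply/funext => w; rewrite /S (shift_sum (fun t l => g t * z (X l w)) T sp).
  by apply: eq_bigr => l _; rewrite /c; case: ifP => // _; rewrite mul0r.
rewrite SE; split; first exact: L2_lin.
rewrite (Ex_lin_sq indepX mz Lz Ez Ez2) (shift_sum (fun t l => g t ^+ 2) T sp); congr (_ * _).
by apply: eq_bigr => l _; rewrite /c; case: ifP => // _; rewrite expr0n.
Qed.

Lemma lagsum_quad (g : nat -> nat -> R) sg p T : (sg <= p)%N ->
  let S := fun w => \sum_(p.+1 <= t < T.+1) z (X (t - sg)%N w) *
    \sum_(0 <= l < T.+1) g t l * z (X l w) in
  L1 P S /\ Ex P (fun w => `|S w|) <= v * \sum_(p.+1 <= t < T.+1) `|g t (t - sg)%N| +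
    v * Num.sqrt (2 * \sum_(p.+1 <= t < T.+1) \sum_(0 <= l < T.+1) g t l ^+ 2).
Proof.
move=> sp S; pose k a l := if (p < a + sg <= T)%N then g (a + sg)%N l else 0.
have SE : S = (fun w => \sum_(0 <= t < T.+1) \sum_(0 <= l < T.+1) k t l * (z (X t w) * z (X l w))).
  apply/funext => w; rewrite /S (shift_sum (fun t l => z (X l w) *
    \sum_(0 <= l < T.+1) g t l * z (X l w)) T sp).
  apply: eq_bigr => a _; rewrite /k; case: ifP => _.
    by rewrite mulr_sumr; apply: eq_bigr => l _; rewrite mulrCA.
  by rewrite big1// => l _; rewrite mul0r.
have [L E] := quad_form_L1 indepX mz Lz Ez Ez2 k T.+1.
rewrite SE; split=> //; apply: le_trans E _; rewrite le_eqVlt; apply/orP; left; apply/eqP.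
congr (_ * _ + _ * Num.sqrt (_ * _)).
- rewrite (shift_sum (fun t l => `|g t l|) T sp); apply: eq_bigr => l _; rewrite /k.
  by case: ifP => // _; rewrite normr0.
- rewrite (shift_sum (fun t _ => \sum_(0 <= l < T.+1) g t l ^+ 2) T sp).
  apply: eq_bigr => l _; rewrite /k.
  by case: ifP => // _; rewrite big1// => i _; rewrite expr0n.
Qed.

End lagged_sums.

Lemma invsqrt_mul (R : realType) (x : R) : 0 < x -> (Num.sqrt x)^-1 * x = Num.sqrt x.
Proof. by move=> x0; rewrite -{2}(sqr_sqrtr (ltW x0)) expr2 mulKf// gt_eqF// sqrtr_gt0. Qed.

(** * Negligibility of the bias and of the kernel noise *)

Section residuals.
Context (R : realType) (d : measure_display) (Omega : measurableType d)
  (P : probability Omega R) (X : nat -> {RV P >-> R}).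
Hypothesis indepX : mutually_independent P X.
Variables (z : R -> R) (v : R).
Hypothesis mz : measurable_fun [set: R] z.
Hypothesis Lz : forall t, L2 P (z \o X t).
Hypothesis Ez : forall t, Ex P (z \o X t) = 0.
Hypothesis Ez2 : forall t, Ex P (fun w => z (X t w) ^+ 2) = v.
Variables (m : nat -> nat -> R) (M : R) (k : nat -> nat -> nat -> R)
  (ka be : nat -> R) (p N0 : nat).
Hypothesis mM : forall T t, `|m T t| <= M.
Hypothesis k1 : forall T t, (N0 <= T)%N -> (t <= T)%N -> \sum_(p.+1 <= i < T.+1) k T t i = 1.
Hypothesis kka : forall T t i, (N0 <= T)%N -> (t <= T)%N -> 0 <= k T t i <= ka T.

(* With X_t^2 = m_t + innov_t and weights k of sum 1, the residual X_t^2 - d_hat_t equals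
   innov - (bias + noise). *)
Definition bias T t := \sum_(p.+1 <= i < T.+1) k T t i * (m T i - m T t).

Hypothesis biasP : forall T t, (N0 <= T)%N -> (t <= T)%N -> `|bias T t| <= be T.
Hypothesis be0 : Num.sqrt T%:R * be T ^+ 2 @[T --> \oo] --> 0.
Hypothesis be1 : be @ \oo --> 0.
Hypothesis ka0 : Num.sqrt T%:R * ka T @[T --> \oo] --> 0.

Definition innov T t w := m T t * z (X t w).
Definition noise T t w := \sum_(p.+1 <= i < T.+1) k T t i * innov T i w.
Definition drift T t w := bias T t + noise T t w.
Definition resid T t w := innov T t w - drift T t w.

Let v0 : 0 <= v := second_moment_ge0 Ez2.

Let M0 : 0 <= M.
Proof. exact: le_trans (normr_ge0 _) (mM 0 0). Qed.

Let m2 T t : m T t ^+ 2 <= M ^+ 2.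
Proof. by rewrite -real_normK ?num_real// lerXn2r ?nnegrE. Qed.

Lemma sum_weight_sq T t : (N0 <= T)%N -> (t <= T)%N ->
  \sum_(p.+1 <= i < T.+1) k T t i ^+ 2 <= ka T.
Proof.
move=> NT tT; rewrite -[leRHS]mulr1 -(k1 NT tT) mulr_sumr; apply: ler_sum => i _.
by have /andP[k0 kk] := kka i NT tT; rewrite expr2 ler_wpM2r.
Qed.

Lemma noiseE T t w : noise T t w =
  \sum_(0 <= l < T.+1) (if (p < l)%N then k T t l * m T l else 0) * z (X l w).
Proof.
rewrite /noise (@big_nat_widenl _ _ _ _ 0)//= big_mkcond/=; apply: eq_bigr => l _.
by rewrite /innov; case: ifP => _; rewrite ?mulrA ?mul0r.
Qed.

Lemma L2_innov T t : L2 P (innov T t).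
Proof. exact: L2Zl (Lz t). Qed.

Lemma L2_noise T t : L2 P (noise T t).
Proof. by apply: L2_sum => i _; apply: L2Zl; exact: L2_innov. Qed.

Lemma L2_drift T t : L2 P (drift T t).
Proof. by apply: L2D; [exact: L2_cst|exact: L2_noise]. Qed.

Lemma noise_coef_sq T t : (N0 <= T)%N -> (t <= T)%N ->
  \sum_(0 <= l < T.+1) (if (p < l)%N then k T t l * m T l else 0) ^+ 2 <= M ^+ 2 * ka T.
Proof.
move=> NT tT.
rewrite (_ : \sum_(0 <= l < T.+1) _ = \sum_(p.+1 <= l < T.+1) (k T t l * m T l) ^+ 2).
  apply: (@le_trans _ _ (\sum_(p.+1 <= l < T.+1) M ^+ 2 * k T t l ^+ 2)).
    by apply: ler_sum => l _; rewrite exprMn mulrC; apply: ler_wpM2r; rewrite ?sqr_ge0.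
  by rewrite -mulr_sumr ler_wpM2l ?sqr_ge0// sum_weight_sq.
rewrite [RHS](@big_nat_widenl _ _ _ _ 0)//= [RHS]big_mkcond/=; apply: eq_bigr => l _.
by case: ifP => // _; rewrite expr0n.
Qed.

Lemma Ex_noise_sq T t : (N0 <= T)%N -> (t <= T)%N ->
  Ex P (fun w => noise T t w ^+ 2) <= v * (M ^+ 2 * ka T).
Proof.
move=> NT tT; under eq_Ex do rewrite noiseE.
rewrite (Ex_lin_sq indepX mz Lz Ez Ez2); apply: ler_wpM2l => //.
exact: noise_coef_sq.
Qed.

Lemma Ex_drift_sq T t : (N0 <= T)%N -> (t <= T)%N ->
  Ex P (fun w => drift T t w ^+ 2) <= 2 * be T ^+ 2 + 2 * (v * (M ^+ 2 * ka T)).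
Proof.
move=> NT tT.
rewrite (le_trans (Ex_sqrD_le (L2_cst P (bias T t)) (L2_noise T t)))//.
rewrite Ex_cst; have := Ex_noise_sq NT tT.
have : bias T t ^+ 2 <= be T ^+ 2.
  by rewrite -real_normK ?num_real// lerXn2r ?nnegrE ?biasP// (le_trans _ (biasP NT tT)).
lra.
Qed.

(** Cauchy-Schwarz term by term is enough here: each product has absolute mean of order be^2 + ka,
    and there are T of them, divided by sqrt T. *)
Lemma drift_drift_op1 sg ta : (sg <= p)%N -> (ta <= p)%N ->
  op1 P (fun T w => (Num.sqrt T%:R)^-1 *
    \sum_(p.+1 <= t < T.+1) drift T (t - sg) w * drift T (t - ta) w).
Proof.
move=> sp tp.
pose u (T : nat) := 2 * (Num.sqrt T%:R * be T ^+ 2) + 2 * v * M ^+ 2 * (Num.sqrt T%:R * ka T) : R.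
apply: (@op1_L1 _ _ _ _ _ u (maxn 1 N0)) => [T|]; last first.
  rewrite -[X in _ --> X](_ : 2 * 0 + 2 * v * M ^+ 2 * 0 = 0); last by ring.
  by apply: cvgD; apply: cvgMr.
rewrite geq_max => /andP[T0 NT].
have Tp : 0 < T%:R :> R by rewrite ltr0n.
have s0 : 0 < Num.sqrt T%:R :> R by rewrite sqrtr_gt0.
have LD t : L1 P (fun w => drift T (t - sg) w * drift T (t - ta) w).
  by apply: L2_mul; exact: L2_drift.
have LS : L1 P (fun w => \sum_(p.+1 <= t < T.+1) drift T (t - sg) w * drift T (t - ta) w).
  exact: L1_sum.
split; first exact: L1Zl.
pose rho := 2 * be T ^+ 2 + 2 * (v * (M ^+ 2 * ka T)).
have E t : (t <= T)%N -> Ex P (fun w => `|drift T (t - sg) w * drift T (t - ta) w|) <= rho.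
  move=> tT.
  rewrite (le_trans (Ex_mul_norm_le (L2_drift _ _) (L2_drift _ _)))//.
  have r0 : 0 <= rho by apply: le_trans (Ex_drift_sq NT tT); exact: Ex_sqr_ge0.
  rewrite -[leRHS]sqr_sqrtr// expr2.
  have tt s : (t - s <= T)%N by rewrite (leq_trans (leq_subr _ _)).
  by apply: ler_pM; rewrite ?sqrtr_ge0// ler_sqrt// Ex_drift_sq.
have -> : u T = (Num.sqrt T%:R)^-1 * (T%:R * rho).
  rewrite mulrA invsqrt_mul// /u /rho; ring.
under eq_Ex do rewrite normrM gtr0_norm ?invr_gt0//.
rewrite ExZl; last exact: L1_norm.
apply: ler_wpM2l; first by rewrite invr_ge0 ltW.
apply: (@le_trans _ _ (\sum_(p.+1 <= t < T.+1)
    Ex P (fun w => `|drift T (t - sg) w * drift T (t - ta) w|))).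
  rewrite -Ex_sum; last by move=> t _; exact: L1_norm.
  apply: le_Ex; [exact: L1_norm|by apply: L1_sum => t _; exact: L1_norm|].
  by move=> w; exact: ler_norm_sum.
apply: (@le_trans _ _ (\sum_(p.+1 <= t < T.+1) rho)).
  by rewrite big_nat [leRHS]big_nat; apply: ler_sum => t /andP[_]; exact: E.
have r0 : 0 <= rho by apply: le_trans (Ex_drift_sq NT (leqnn T)); exact: Ex_sqr_ge0.
by rewrite sumr_const_nat -[leLHS]mulr_natl ler_wpM2r// ler_nat subSS leq_subr.
Qed.

(** The bias is deterministic, so the sum is a linear form in centred variables: its variance is of
    order be^2, without a factor T. *)
Lemma innov_bias_op1 sg ta : (sg <= p)%N -> (ta <= p)%N ->
  op1 P (fun T w => (Num.sqrt T%:R)^-1 *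
    \sum_(p.+1 <= t < T.+1) innov T (t - sg) w * bias T (t - ta)).
Proof.
move=> sp tp.
apply: (@op1_L2 _ _ _ _ _ (fun T => v * M ^+ 2 * (be T * be T)) (maxn 1 N0)) => [T|]; last first.
  rewrite -[X in _ --> X](_ : v * M ^+ 2 * (0 * 0) = 0); last by ring.
  by apply: cvgMr; apply: cvgM.
rewrite geq_max => /andP[T0 NT].
have Tp : 0 < T%:R :> R by rewrite ltr0n.
pose g t := (Num.sqrt T%:R)^-1 * (m T (t - sg) * bias T (t - ta)).
have [L E] := lagsum_lin indepX mz Lz Ez Ez2 g T sp.
have SE : (fun w => (Num.sqrt T%:R)^-1 *
    \sum_(p.+1 <= t < T.+1) innov T (t - sg) w * bias T (t - ta)) =
    (fun w => \sum_(p.+1 <= t < T.+1) g t * z (X (t - sg)%N w)).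
  apply/funext => w; rewrite mulr_sumr; apply: eq_bigr => t _; rewrite /g /innov; ring.
rewrite SE; split=> //.
have -> : Ex P (fun w => ((Num.sqrt T%:R)^-1 *
    \sum_(p.+1 <= t < T.+1) innov T (t - sg) w * bias T (t - ta)) ^+ 2) =
    Ex P (fun w => (\sum_(p.+1 <= t < T.+1) g t * z (X (t - sg)%N w)) ^+ 2).
  by apply: eq_Ex => w; have /(congr1 (@^~ w)) /= -> := SE.
rewrite E -mulrA; apply: ler_wpM2l => //.
apply: (@le_trans _ _ (\sum_(p.+1 <= t < T.+1) M ^+ 2 * (be T * be T) / T%:R)).
  rewrite big_nat [leRHS]big_nat; apply: ler_sum => t /andP[_ tT].
  rewrite /g !exprMn exprVn sqr_sqrtr ?(ltW Tp)// [leRHS]mulrC.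
  apply: ler_wpM2l; first by rewrite invr_ge0 ltW.
  apply: ler_pM; rewrite ?sqr_ge0 ?m2//.
  have tt : (t - ta <= T)%N by rewrite (leq_trans (leq_subr _ _)).
  rewrite -expr2 -real_normK ?num_real// lerXn2r ?nnegrE ?biasP//.
  exact: le_trans (biasP NT tt).
rewrite sumr_const_nat -mulrnAr -[leRHS]mulr1; apply: ler_wpM2l.
  by rewrite mulr_ge0 ?sqr_ge0// -expr2 sqr_ge0.
by rewrite -mulr_natl ler_pdivrMr// mul1r ler_nat subSS leq_subr.
Qed.

(** Term-by-term bounds would lose a factor sqrt T. Treated as one quadratic form, the sum has a
    diagonal part of order sqrt T ka and an off-diagonal part of order sqrt ka. *)
Lemma innov_noise_op1 sg ta : (sg <= p)%N -> (ta <= p)%N ->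
  op1 P (fun T w => (Num.sqrt T%:R)^-1 *
    \sum_(p.+1 <= t < T.+1) innov T (t - sg) w * noise T (t - ta) w).
Proof.
move=> sp tp.
pose u (T : nat) : R := v * M ^+ 2 * (Num.sqrt T%:R * ka T) + v * M ^+ 2 * Num.sqrt (2 * ka T).
have ka1 : ka @ \oo --> 0.
  apply: (@cvg0_le _ _ (fun T => Num.sqrt T%:R * ka T) (maxn 1 N0)) => // T.
  rewrite geq_max => /andP[T0 NT].
  have k0 : 0 <= ka T by have /andP[a b] := kka 0 NT (leqnn T); exact: le_trans b.
  by rewrite k0 ler_peMl// -[leLHS]sqrtr1 ler_sqrt ?ler0n// ler1n.
apply: (@op1_L1 _ _ _ _ _ u (maxn 1 N0)) => [T|]; last first.
  rewrite -[X in _ --> X](_ : v * M ^+ 2 * 0 + v * M ^+ 2 * 0 = 0); last by ring.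
  apply: cvgD; apply: cvgMr => //.
  rewrite -[X in _ --> X]sqrtr0 -[X in _ --> Num.sqrt X](mulr0 2).
  by apply: continuous_cvg; [exact: sqrt_continuous|exact: cvgMr].
rewrite geq_max => /andP[T0 NT].
have Tp : 0 < T%:R :> R by rewrite ltr0n.
have s0 : 0 < Num.sqrt T%:R :> R by rewrite sqrtr_gt0.
have k0 : 0 <= ka T by have /andP[a b] := kka 0 NT (leqnn T); exact: le_trans b.
pose g t l := m T (t - sg) * (if (p < l)%N then k T (t - ta) l * m T l else 0).
have [L E] := lagsum_quad indepX mz Lz Ez Ez2 g T sp.
have SE : (fun w => \sum_(p.+1 <= t < T.+1) innov T (t - sg) w * noise T (t - ta) w) =
    (fun w => \sum_(p.+1 <= t < T.+1) z (X (t - sg)%N w) *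
      \sum_(0 <= l < T.+1) g t l * z (X l w)).
  apply/funext => w; apply: eq_bigr => t _; rewrite noiseE /innov (mulrC (m _ _)) -mulrA.
  by congr (_ * _); rewrite mulr_sumr; apply: eq_bigr => l _; rewrite /g mulrA.
have tt t s : (t < T.+1)%N -> (t - s <= T)%N by move=> tT; rewrite (leq_trans (leq_subr _ _)).
split.
  by apply: L1Zl; rewrite SE.
under eq_Ex do rewrite normrM gtr0_norm ?invr_gt0//.
rewrite ExZl; last by apply: L1_norm; rewrite SE.
have -> : Ex P (fun w => `|\sum_(p.+1 <= t < T.+1) innov T (t - sg) w * noise T (t - ta) w|) =
    Ex P (fun w => `|\sum_(p.+1 <= t < T.+1) z (X (t - sg)%N w) *
      \sum_(0 <= l < T.+1) g t l * z (X l w)|).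
  by apply: eq_Ex => w; have /(congr1 (@^~ w)) /= -> := SE.
have -> : u T = (Num.sqrt T%:R)^-1 * (v * (T%:R * (M ^+ 2 * ka T)) +
    v * (Num.sqrt T%:R * (M ^+ 2 * Num.sqrt (2 * ka T)))).
  rewrite mulrDr !(mulrCA _ v) !(mulrA (Num.sqrt T%:R)^-1) invsqrt_mul// mulVf ?gt_eqF// /u.
  ring.
apply: ler_wpM2l; first by rewrite invr_ge0 ltW.
apply: le_trans E _; apply: lerD; apply: ler_wpM2l => //.
- apply: (@le_trans _ _ (\sum_(p.+1 <= t < T.+1) M ^+ 2 * ka T)).
    rewrite big_nat [leRHS]big_nat; apply: ler_sum => t /andP[_ tT]; rewrite /g normrM expr2 -mulrA.
    apply: ler_pM; rewrite ?normr_ge0//.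
    case: ifP => _; last by rewrite normr0 mulr_ge0.
    have /andP[kt0 kt] := kka (t - sg) NT (tt _ ta tT).
    by rewrite normrM ger0_norm// mulrC ler_pM.
  rewrite sumr_const_nat -[leLHS]mulr_natl ler_wpM2r ?mulr_ge0 ?sqr_ge0//.
  by rewrite ler_nat subSS leq_subr.
- have -> : Num.sqrt T%:R * (M ^+ 2 * Num.sqrt (2 * ka T)) =
      Num.sqrt (2 * (T%:R * (M ^+ 2 * (M ^+ 2 * ka T)))).
    rewrite (_ : 2 * (T%:R * _) = T%:R * ((M ^+ 2) ^+ 2 * (2 * ka T))); last by ring.
    by rewrite (sqrtrM _ (ler0n R T)) (sqrtrM _ (sqr_ge0 _)) sqrtr_sqr ger0_norm ?sqr_ge0.
  rewrite ler_sqrt; last by rewrite !mulr_ge0 ?sqr_ge0.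
  apply: ler_wpM2l => //.
  apply: (@le_trans _ _ (\sum_(p.+1 <= t < T.+1) M ^+ 2 * (M ^+ 2 * ka T))).
    rewrite big_nat [leRHS]big_nat; apply: ler_sum => t /andP[_ tT].
    apply: (@le_trans _ _ (m T (t - sg) ^+ 2 *
        \sum_(0 <= l < T.+1) (if (p < l)%N then k T (t - ta) l * m T l else 0) ^+ 2)).
      by rewrite mulr_sumr; apply: ler_sum => l _; rewrite exprMn.
    apply: ler_pM; rewrite ?sqr_ge0 ?m2//; first by apply: sumr_ge0 => l _; exact: sqr_ge0.
    exact: noise_coef_sq NT (tt _ _ tT).
  rewrite sumr_const_nat -[leLHS]mulr_natl ler_wpM2r ?mulr_ge0 ?sqr_ge0//.
  by rewrite ler_nat subSS leq_subr.
Qed.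

(** The normalisation by sqrt T is that of the right-hand side of the normal equations; the Gram
    matrix, normalised by T, is covered a fortiori. *)
Lemma resid_op1 sg ta : (sg <= p)%N -> (ta <= p)%N ->
  op1 P (fun T w => (Num.sqrt T%:R)^-1 *
    (\sum_(p.+1 <= t < T.+1) resid T (t - sg) w * resid T (t - ta) w -
     \sum_(p.+1 <= t < T.+1) innov T (t - sg) w * innov T (t - ta) w)).
Proof.
move=> sp tp.
have opN Y : op1 P Y -> op1 P (fun T w => - Y T w).
  by apply: (@op1_le _ _ _ _ 0) => n w _; rewrite normrN.
have := op1D (drift_drift_op1 sp tp) (opN _ (op1D
  (op1D (innov_bias_op1 sp tp) (innov_noise_op1 sp tp))
  (op1D (innov_bias_op1 tp sp) (innov_noise_op1 tp sp)))).
congr op1; apply/funext => T; apply/funext => w.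
rewrite -!mulrDr -mulrN -mulrDr; congr (_ * _).
rewrite -!big_split/= -!sumrN -!big_split/=; apply: eq_bigr => t _.
rewrite /resid /drift; ring.
Qed.

End residuals.

(** * Laws of large numbers for the Gram matrix *)

Section gram_matrix.
Context (R : realType) (d : measure_display) (Omega : measurableType d)
  (P : probability Omega R) (X : nat -> {RV P >-> R}).
Hypothesis indepX : mutually_independent P X.
Hypothesis idX : identically_distributed P X.
Variables (z : R -> R) (v : R).
Hypothesis mz : measurable_fun [set: R] z.
Hypothesis Lz : forall t, L2 P (z \o X t).
Hypothesis Ez : forall t, Ex P (z \o X t) = 0.
Hypothesis Ez2 : forall t, Ex P (fun w => z (X t w) ^+ 2) = v.

(** For distinct lags the quadratic form has no diagonal, so its L1 norm is of order sqrt T, against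
    the normalisation T. *)
Lemma innov_cross_op1 (m : nat -> nat -> R) (M : R) p sg ta :
  (forall T t, `|m T t| <= M) -> (sg <= p)%N -> (ta <= p)%N -> sg != ta ->
  op1 P (fun T w => T%:R^-1 *
    \sum_(p.+1 <= t < T.+1) innov X z m T (t - sg) w * innov X z m T (t - ta) w).
Proof.
move=> mM sp tp st.
have v0 := second_moment_ge0 Ez2.
have M0 : 0 <= M by exact: le_trans (normr_ge0 _) (mM 0 0).
have m2 T t : m T t ^+ 2 <= M ^+ 2 by rewrite -real_normK ?num_real// lerXn2r ?nnegrE.
apply: (@op1_L1 _ _ _ _ _ (fun T => v * M ^+ 2 * Num.sqrt 2 * (Num.sqrt T%:R)^-1) 1) => [T T0|];
  last first.
  by rewrite -[X in _ --> X](mulr0 (v * M ^+ 2 * Num.sqrt 2)); apply: cvgMr; exact: cvg_invsqrt.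
have Tp : 0 < T%:R :> R by rewrite ltr0n.
have s0 : 0 < Num.sqrt T%:R :> R by rewrite sqrtr_gt0.
pose g (t l : nat) := if (l == t - ta)%N then m T (t - sg)%N * m T l else 0.
have [L E] := lagsum_quad indepX mz Lz Ez Ez2 g T sp.
have tt t : (t < T.+1)%N -> (t - ta)%N \in index_iota 0 T.+1.
  by rewrite mem_index_iota /= !ltnS => tT; rewrite (leq_trans (leq_subr _ _)).
have SE w : \sum_(p.+1 <= t < T.+1) innov X z m T (t - sg) w * innov X z m T (t - ta) w =
    \sum_(p.+1 <= t < T.+1) z (X (t - sg)%N w) * \sum_(0 <= l < T.+1) g t l * z (X l w).
  rewrite big_nat [RHS]big_nat; apply: eq_bigr => t /andP[_ tT].
  rewrite (bigD1_seq (t - ta)%N) ?iota_uniq ?tt//= /g eqxx big1.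
    by rewrite /innov addr0; ring.
  by move=> l /negbTE ->; rewrite mul0r.
have {}SE := funext SE.
split; first by apply: L1Zl; rewrite SE.
under eq_Ex do rewrite normrM gtr0_norm ?invr_gt0//.
rewrite ExZl; last by apply: L1_norm; rewrite SE.
under eq_Ex => w do rewrite (congr1 (@^~ w) SE).
have -> : v * M ^+ 2 * Num.sqrt 2 * (Num.sqrt T%:R)^-1 =
    T%:R^-1 * (v * (M ^+ 2 * Num.sqrt 2 * Num.sqrt T%:R)).
  have -> : T%:R^-1 = (Num.sqrt T%:R)^-1 * (Num.sqrt T%:R)^-1 :> R.
    by rewrite -invfM -expr2 sqr_sqrtr// ltW.
  by field; exact: lt0r_neq0.
apply: ler_wpM2l; first by rewrite invr_ge0 ltW.
apply: le_trans E _; rewrite big_nat big1 ?mulr0 ?add0r.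
  apply: ler_wpM2l => //.
  have -> : M ^+ 2 * Num.sqrt 2 * Num.sqrt T%:R = Num.sqrt (2 * (T%:R * (M ^+ 2 * M ^+ 2))).
    rewrite (_ : 2 * (T%:R * _) = (M ^+ 2) ^+ 2 * (2 * T%:R)); last by ring.
    by rewrite (sqrtrM _ (sqr_ge0 _)) sqrtr_sqr ger0_norm ?sqr_ge0// (sqrtrM _ (ler0n R 2)) mulrA.
  rewrite ler_sqrt; last by rewrite !mulr_ge0 ?sqr_ge0.
  apply: ler_wpM2l => //.
  apply: (@le_trans _ _ (\sum_(p.+1 <= t < T.+1) M ^+ 2 * M ^+ 2)).
    rewrite big_nat [leRHS]big_nat; apply: ler_sum => t /andP[_ tT].
    rewrite (bigD1_seq (t - ta)%N) ?iota_uniq ?tt//= /g eqxx big1.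
      by rewrite addr0 exprMn ler_pM ?sqr_ge0 ?m2.
    by move=> l /negbTE ->; rewrite expr0n.
  rewrite sumr_const_nat -[leLHS]mulr_natl ler_wpM2r ?mulr_ge0 ?sqr_ge0//.
  by rewrite ler_nat subSS leq_subr.
move=> t /andP[pt _]; rewrite /g ifN ?normr0//.
(* As t > p bounds both lags, truncated subtraction from [t] is injective on them. *)
by apply: contra_neq st; clear -pt sp tp; lia.
Qed.

(* Truncate z: the error is small in L1 uniformly in T and the variance of the bounded part is
   of order 1 / T. *)
Lemma square_lln (c : nat -> nat -> R) (M : R) p sg : (forall T t, `|c T t| <= M) -> (sg <= p)%N ->
  op1 P (fun T w => T%:R^-1 *
    \sum_(p.+1 <= t < T.+1) c T t * (z (X (t - sg)%N w) ^+ 2 - v)).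
Proof.
move=> cM sp.
have v0 := second_moment_ge0 Ez2.
have M0 : 0 <= M by exact: le_trans (normr_ge0 _) (cM 0 0).
set Y := fun T w => _.
have LY T : L1 P (Y T).
  apply: L1Zl; apply: L1_sum => t _; apply: L1Zl; apply: L1B; last exact: L1_cst.
  exact: L1_sqr (Lz _).
apply: (@op1_L1 _ _ _ _ _ (fun T => Ex P (fun w => `|Y T w|)) 1) => [T _|].
  by split.
apply/cvgrPdist_le => e e0.
(* The mean of |z^2 - y^2| is at most (2 sqrt v + 1) de; it counts twice, the second time for the
   change of variance, and [M] bounds the coefficients. *)
pose a := 2 * M * (2 * Num.sqrt v + 1).
have a0 : 0 <= a by rewrite /a !mulr_ge0// addr_ge0// mulr_ge0// sqrtr_ge0.
pose de := Num.min 1 (e / (2 * (a + 1))).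
have de0 : 0 < de by rewrite lt_min ltr01 divr_gt0//; lra.
have de1 : de <= 1 by rewrite ge_min lexx.
have ade : a * de <= e / 2.
  have : de <= e / (2 * (a + 1)) by rewrite ge_min lexx orbT.
  by rewrite ler_pdivlMr; [nra|lra].
have d2 : 0 < de ^+ 2 by exact: exprn_gt0.
have [y [B [my yB Ey Ezy]]] := truncation idX mz Lz Ez d2.
have Ly t : L2 P (y \o X t) by apply: (@L2_bounded _ _ _ _ _ B) => [|w]; [exact: measurableT_comp|exact: yB].
have Lzy t : L2 P (fun w => z (X t w) - y (X t w)) by exact: (L2B (Lz t) (Ly t)).
pose vy := Ex P (fun w => y (X 0%N w) ^+ 2).
pose y2 x := y x ^+ 2 - vy.
have my2 : measurable_fun setT y2 by apply: measurable_funB => //; exact: measurable_funX.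
have Ly2 t : L2 P (y2 \o X t).
  have Ly2' : L2 P (fun w => y (X t w) ^+ 2).
    apply: (@L2_bounded _ _ _ _ _ (B ^+ 2)).
      by apply: measurable_funX; exact: measurableT_comp.
    move=> w; rewrite normrX lerXn2r ?nnegrE//.
    exact: le_trans (normr_ge0 _) (yB 0).
  exact: L2B Ly2' (L2_cst _ _).
have Evy t : Ex P (fun w => y (X t w) ^+ 2) = vy.
  apply: (@Ex_id _ _ _ _ _ X idX t 0%N (fun x => y x ^+ 2)); first exact: measurable_funX.
  exact: L1_sqr (Ly t).
have Ey2 t : Ex P (y2 \o X t) = 0.
  rewrite /y2 ExB; [|exact: L1_sqr (Ly t)|exact: L1_cst].
  by rewrite Evy Ex_cst subrr.
pose u := Ex P (fun w => y2 (X 0%N w) ^+ 2).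
have Ey22 t : Ex P (fun w => y2 (X t w) ^+ 2) = u.
  apply: (@Ex_id _ _ _ _ _ X idX t 0%N (fun x => y2 x ^+ 2)); first exact: measurable_funX.
  exact: L1_sqr (Ly2 t).
have sd t : Ex P (fun w => `|z (X t w) ^+ 2 - y (X t w) ^+ 2|) <= (2 * Num.sqrt v + 1) * de.
  have A w : z (X t w) ^+ 2 - y (X t w) ^+ 2 =
    2 * (z (X t w) * (z (X t w) - y (X t w))) - (z (X t w) - y (X t w)) ^+ 2 by ring.
  under eq_Ex do rewrite A.
  have L1' : L1 P (fun w => 2 * (z (X t w) * (z (X t w) - y (X t w)))).
    by apply: L1Zl; apply: (L2_mul (Lz t) (Lzy t)).
  have L2' := L1_sqr (Lzy t).
  apply: (@le_trans _ _ (Ex P (fun w => 2 * `|z (X t w) * (z (X t w) - y (X t w))| +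
      (z (X t w) - y (X t w)) ^+ 2))).
    apply: le_Ex; first by apply: L1_norm; exact: L1B.
      by apply: L1D => //; apply: L1Zl; apply: L1_norm; exact: (L2_mul (Lz t) (Lzy t)).
    move=> w; rewrite (le_trans (ler_normB _ _))// normrM [`|2|]ger0_norm//.
    by rewrite [X in _ + X <= _]ger0_norm ?sqr_ge0.
  rewrite ExD//; last by apply: L1Zl; apply: L1_norm; exact: (L2_mul (Lz t) (Lzy t)).
  rewrite ExZl; last by apply: L1_norm; exact: (L2_mul (Lz t) (Lzy t)).
  have H1 := Ex_mul_norm_le (Lz t) (Lzy t).
  have H2 := Ezy t.
  have H3 : Num.sqrt (Ex P (fun w => (z (X t w) - y (X t w)) ^+ 2)) <= de.
    by rewrite -[leRHS](gtr0_norm de0) -sqrtr_sqr ler_sqrt// ltW.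
  have H4 : Ex P (fun w => `|z (X t w) * (z (X t w) - y (X t w))|) <= Num.sqrt v * de.
    apply: (le_trans H1); rewrite (_ : Ex P (fun w => (z \o X t) w ^+ 2) = v); last exact: Ez2.
    by rewrite ler_wpM2l ?sqrtr_ge0.
  have H5 : de ^+ 2 <= de by rewrite expr2 ler_piMl// ltW.
  by move: H2 H4 H5; clear; lra.
have vvy : `|v - vy| <= (2 * Num.sqrt v + 1) * de.
  have -> : v - vy = Ex P (fun w => z (X 0%N w) ^+ 2 - y (X 0%N w) ^+ 2).
    rewrite -(Ez2 0%N) -(Evy 0%N) ExB//; [exact: L1_sqr (Lz 0)|exact: L1_sqr (Ly 0)].
  apply: (le_trans _ (sd 0%N)); apply: le_norm_Ex.
  by apply: L1B; [exact: L1_sqr (Lz 0)|exact: L1_sqr (Ly 0)].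
have u0 : 0 <= u by exact: Ex_sqr_ge0.
have lim0 : Num.sqrt u * M * (Num.sqrt T%:R)^-1 @[T --> \oo] --> 0.
  by rewrite -[X in _ --> X](mulr0 (Num.sqrt u * M)); apply: cvgMr; exact: cvg_invsqrt.
have e2 : 0 < e / 2 by lra.
move/cvgrPdist_le : lim0 => /(_ _ e2) [N1 _ HN1].
exists (maxn 1 N1) => // T /=; rewrite geq_max => /andP[T0 /HN1 /= HT].
have Tp : 0 < T%:R :> R by rewrite ltr0n.
have s0 : 0 < Num.sqrt T%:R :> R by rewrite sqrtr_gt0.
rewrite sub0r normrN ger0_norm in HT; last by rewrite !mulr_ge0 ?sqrtr_ge0// invr_ge0 ltW.
rewrite sub0r normrN ger0_norm; last by apply: Ex_ge0 => w; exact: normr_ge0.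
pose f t w := c T t * (z (X (t - sg)%N w) ^+ 2 - y (X (t - sg)%N w) ^+ 2 - (v - vy)).
pose S w := \sum_(p.+1 <= t < T.+1) c T t * y2 (X (t - sg)%N w).
have [LS ES] := lagsum_lin indepX my2 Ly2 Ey2 Ey22 (c T) T sp.
rewrite -/S in LS ES.
have Lf t : L1 P (f t).
  by apply: L1Zl; apply: L1B; [apply: L1B; [exact: L1_sqr (Lz _)|exact: L1_sqr (Ly _)]|exact: L1_cst].
have Ef t : Ex P (fun w => `|f t w|) <= a * de.
  apply: (@le_trans _ _ (Ex P (fun w => M * (`|z (X (t - sg)%N w) ^+ 2 - y (X (t - sg)%N w) ^+ 2| + `|v - vy|)))).
    apply: le_Ex; first exact: L1_norm.
      by apply: L1Zl; apply: L1D; [apply: L1_norm; apply: L1B; [exact: L1_sqr (Lz _)|exact: L1_sqr (Ly _)]|exact: L1_cst].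
    by move=> w; rewrite normrM ler_pM// ler_normB.
  rewrite ExZl; last by apply: L1D; [apply: L1_norm; apply: L1B; [exact: L1_sqr (Lz _)|exact: L1_sqr (Ly _)]|exact: L1_cst].
  rewrite ExD; [|by apply: L1_norm; apply: L1B; [exact: L1_sqr (Lz _)|exact: L1_sqr (Ly _)]|exact: L1_cst].
  rewrite Ex_cst /a.
  rewrite (_ : _ * de = M * ((2 * Num.sqrt v + 1) * de + (2 * Num.sqrt v + 1) * de)); last by ring.
  by apply: ler_wpM2l => //; apply: lerD => //; exact: sd.
have YE w : Y T w = T%:R^-1 * (\sum_(p.+1 <= t < T.+1) f t w + S w).
  by rewrite /Y /S -big_split; congr (_ * _); apply: eq_bigr => t _; rewrite /f /y2/=; ring.
apply: (@le_trans _ _ (T%:R^-1 * (\sum_(p.+1 <= t < T.+1) Ex P (fun w => `|f t w|) +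
    Ex P (fun w => `|S w|)))).
  have L1S := L1_norm (L2_L1 LS).
  have LSf : L1 P (fun w => \sum_(p.+1 <= t < T.+1) `|f t w|).
    by apply: L1_sum => t _; exact: L1_norm.
  rewrite -Ex_sum; last by move=> t _; exact: L1_norm.
  rewrite -ExD// -ExZl; last exact: L1D.
  apply: le_Ex; [exact: L1_norm|by apply: L1Zl; exact: L1D|move=> w].
  rewrite YE normrM [X in X * _]gtr0_norm ?invr_gt0//.
  apply: ler_wpM2l; first by rewrite invr_ge0 ltW.
  rewrite (le_trans (ler_normD _ _))// lerD2r; exact: ler_norm_sum.
have F1 : \sum_(p.+1 <= t < T.+1) Ex P (fun w => `|f t w|) <= T%:R * (e / 2).
  apply: (@le_trans _ _ (\sum_(p.+1 <= t < T.+1) e / 2)).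
    by apply: ler_sum => t _; exact: le_trans (Ef t) ade.
  rewrite sumr_const_nat -[leLHS]mulr_natl; apply: ler_wpM2r; first exact: ltW.
  by rewrite ler_nat subSS leq_subr.
have F2 : Ex P (fun w => `|S w|) <= T%:R * (e / 2).
  apply: le_trans (Ex_norm_le_sqrt LS (_ : _ <= (Num.sqrt u * M * Num.sqrt T%:R) ^+ 2)) _.
    rewrite ES !exprMn !sqr_sqrtr ?(ltW Tp)// -mulrA; apply: ler_wpM2l => //.
    apply: (@le_trans _ _ (\sum_(p.+1 <= t < T.+1) M ^+ 2)).
      by apply: ler_sum => t _; rewrite -real_normK ?num_real// lerXn2r ?nnegrE.
    rewrite sumr_const_nat -[leLHS]mulr_natl mulrC; apply: ler_wpM2l; first exact: sqr_ge0.
    by rewrite ler_nat subSS leq_subr.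
  rewrite sqrtr_sqr ger0_norm; last by rewrite !mulr_ge0 ?sqrtr_ge0.
  have := ler_wpM2l (ltW Tp) HT; apply: le_trans.
  rewrite (_ : T%:R * _ = Num.sqrt u * M * ((Num.sqrt T%:R)^-1 * T%:R)); last by ring.
  by rewrite invsqrt_mul.
rewrite ler_pdivrMl//; move: F1 F2; clear; lra.
Unshelve. all: by [].
Qed.

End gram_matrix.

(** * Normal equations and their perturbation *)

Section least_squares_algebra.
Context (R : realType).

Lemma normal_equations (p : nat) (r : seq nat) (y : nat -> R) (f : nat -> 'I_p -> R)
    (a : 'I_p -> R) :
  (forall a' : 'I_p -> R, \sum_(t <- r) (y t - \sum_(j < p) a j * f t j) ^+ 2 <=
    \sum_(t <- r) (y t - \sum_(j < p) a' j * f t j) ^+ 2) ->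
  forall i, \sum_(j < p) (\sum_(t <- r) f t i * f t j) * a j = \sum_(t <- r) y t * f t i.
Proof.
move=> amin i.
pose u t := y t - \sum_(j < p) a j * f t j.
pose G := \sum_(t <- r) u t * f t i; pose H := \sum_(t <- r) f t i ^+ 2.
have H0 : 0 <= H by apply: sumr_ge0 => t _; exact: sqr_ge0.
have H1 : 0 < H + 1 by lra.
have Q x : \sum_(t <- r) u t ^+ 2 <= \sum_(t <- r) u t ^+ 2 - 2 * x * G + x ^+ 2 * H.
  have := amin (fun j => a j + x * (j == i)%:R); move/le_trans; apply.
  rewrite /G /H !mulr_sumr -sumrB -big_split/= le_eqVlt; apply/orP; left; apply/eqP.
  apply: eq_bigr => t _.
  have -> : \sum_(j < p) (a j + x * (j == i)%:R) * f t j = \sum_(j < p) a j * f t j + x * f t i.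
    under eq_bigr do rewrite mulrDl.
    rewrite big_split/=; congr (_ + _); rewrite (bigD1 i)//= eqxx big1 ?addr0 ?mulr1//.
    by move=> j /negbTE ->; rewrite mulr0 mul0r.
  by rewrite /u; ring.
have G0 : G = 0.
  (* The minimiser along the line would be G / H; H + 1 avoids a zero denominator and still gives (H
     + 2) x^2 <= 0 for the step x = G / (H + 1), hence G = 0. *)
  have := Q (G / (H + 1)).
  have -> : 2 * (G / (H + 1)) * G = (2 * H + 2) * (G / (H + 1)) ^+ 2.
    by field; rewrite gt_eqF.
  have := sqr_ge0 (G / (H + 1)); set g := _ ^+ 2 => g0 Qg.
  have g00 : g = 0 by clear -Qg g0 H0; nra.
  move/eqP: g00; rewrite /g sqrf_eq0 mulf_eq0 invr_eq0 (gt_eqF H1) orbF => /eqP //.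
have : \sum_(t <- r) y t * f t i - \sum_(j < p) (\sum_(t <- r) f t i * f t j) * a j = 0.
  transitivity G; last exact: G0.
  rewrite /G.
  under [X in _ - X]eq_bigr do rewrite mulr_suml.
  rewrite exchange_big/= -sumrB; apply: eq_bigr => t _.
  rewrite /u mulrBl mulr_suml; congr (_ - _); apply: eq_bigr => j _; ring.
by move/eqP; rewrite subr_eq0 => /eqP ->.
Qed.

(** An a priori bound replaces the inverse matrix: each ka x_i - s_i is at most e times the l1 norm
    of x, and p e <= ka / 2 allows this norm to be absorbed when the bounds are summed over i. *)
Lemma perturbed_identity (p : nat) (S : 'I_p -> 'I_p -> R) (s W x : 'I_p -> R) (ka e B : R) :
  0 < ka -> 0 <= e -> p%:R * e <= ka / 2 ->
  (forall i, \sum_(j < p) S i j * x j = s i) ->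
  (forall i j, `|S i j - ka * (i == j)%:R| <= e) ->
  (forall i, `|s i - ka * W i| <= e) -> (forall i, `|ka * W i| <= B) ->
  forall i, `|x i - W i| <= (e + e * (2 * (p%:R * (B + e)) / ka)) / ka.
Proof.
move=> k0 e0 pe Sx SE sE WB i.
pose m := \sum_(j < p) `|x j|.
have m0 : 0 <= m by exact: sumr_ge0.
have E j : ka * x j - s j = - \sum_(l < p) (S j l - ka * (j == l)%:R) * x l.
  under eq_bigr do rewrite mulrBl.
  rewrite sumrB Sx opprB; congr (_ - _); rewrite (bigD1 j)//= eqxx mulr1 big1 ?addr0// => l.
  by rewrite eq_sym => /negbTE ->; rewrite mulr0 mul0r.
have D j : `|ka * x j - s j| <= e * m.
  rewrite E normrN (le_trans (ler_norm_sum _ _ _))// /m mulr_sumr; apply: ler_sum => l _.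
  by rewrite normrM ler_wpM2r.
have mb : m <= 2 * (p%:R * (B + e)) / ka.
  have A : ka * m <= p%:R * (B + e) + p%:R * (e * m).
    rewrite -mulrDr /m mulr_sumr.
    apply: (@le_trans _ _ (\sum_(j < p) (B + e + e * m))); last first.
      by rewrite sumr_const card_ord mulr_natl.
    apply: ler_sum => j _; rewrite -[X in X * _](gtr0_norm k0) -normrM.
    have := D j; have := sE j; have := WB j.
    have := ler_normD (ka * x j - s j) (s j - ka * W j).
    have := ler_normD (ka * x j - s j + (s j - ka * W j)) (ka * W j).
    rewrite (_ : ka * x j - s j + (s j - ka * W j) + ka * W j = ka * x j); last by ring.
    lra.
  rewrite ler_pdivlMr//; have := ler_wpM2r m0 pe; lra.
rewrite ler_pdivlMr// mulrC -[X in X * _](gtr0_norm k0) -normrM.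
rewrite (_ : _ * (_ - _) = (ka * x i - s i) + (s i - ka * W i)); last by ring.
rewrite (le_trans (ler_normD _ _))// addrC lerD//.
by rewrite (le_trans (D i))// ler_wpM2l.
Qed.

End least_squares_algebra.

Section op1_facts.
Context (d : measure_display) (Omega : measurableType d) (R : realType)
  (P : probability Omega R).

Lemma op1_norm (Y : nat -> Omega -> R) : op1 P Y -> op1 P (fun n w => `|Y n w|).
Proof. by apply: (@op1_le _ _ _ _ 0) => n w _; rewrite normr_id. Qed.

Lemma op1_cst (u : nat -> R) : u @ \oo --> 0 -> op1 P (fun n _ => u n).
Proof.
move=> u0 e r e0 r0; have /cvgrPdist_le /(_ _ e0) [N _ HN] := u0.
exists N => n /HN /=; rewrite sub0r normrN => un.
by exists set0; split=> //; rewrite measure0 lee_fin ltW.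
Qed.

End op1_facts.

Section least_squares_limit.
Context (R : realType) (d : measure_display) (Omega : measurableType d)
  (P : probability Omega R) (X : nat -> {RV P >-> R}).
Hypothesis indepX : mutually_independent P X.
Hypothesis idX : identically_distributed P X.
Variables (z : R -> R) (v : R).
Hypothesis mz : measurable_fun [set: R] z.
Hypothesis Lz : forall t, L2 P (z \o X t).
Hypothesis Ez : forall t, Ex P (z \o X t) = 0.
Hypothesis Ez2 : forall t, Ex P (fun w => z (X t w) ^+ 2) = v.
Variables (m : nat -> nat -> R) (M : R) (k : nat -> nat -> nat -> R)
  (ka be : nat -> R) (p N0 : nat).
Hypothesis mM : forall T t, `|m T t| <= M.
Hypothesis k1 : forall T t, (N0 <= T)%N -> (t <= T)%N -> \sum_(p.+1 <= i < T.+1) k T t i = 1.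
Hypothesis kka : forall T t i, (N0 <= T)%N -> (t <= T)%N -> 0 <= k T t i <= ka T.
Hypothesis biasP : forall T t, (N0 <= T)%N -> (t <= T)%N -> `|bias m k p T t| <= be T.
Hypothesis be0 : Num.sqrt T%:R * be T ^+ 2 @[T --> \oo] --> 0.
Hypothesis be1 : be @ \oo --> 0.
Hypothesis ka0 : Num.sqrt T%:R * ka T @[T --> \oo] --> 0.
Variable s2 : R.
Hypothesis s2_gt0 : 0 < v * s2.
Hypothesis m2_cvg : forall sg, (sg <= p)%N ->
  \sum_(p.+1 <= t < T.+1) m T (t - sg)%N ^+ 2 / T%:R @[T --> \oo] --> s2.

Notation res := (resid X z m k p).

(* Lag 0 stands for the response, so that gram 0 i.+1 is the right-hand side of the normal equations. *)
Definition gram T (sg ta : nat) w := \sum_(p.+1 <= t < T.+1) res T (t - sg) w * res T (t - ta) w.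

Lemma gram_op1 sg ta : (sg <= p)%N -> (ta <= p)%N ->
  op1 P (fun T w => T%:R^-1 * gram T sg ta w - v * s2 * (sg == ta)%:R).
Proof.
move=> sp tp.
have v0 := second_moment_ge0 Ez2.
have A : op1 P (fun T w => T%:R^-1 * (gram T sg ta w -
    \sum_(p.+1 <= t < T.+1) innov X z m T (t - sg) w * innov X z m T (t - ta) w)).
  have := resid_op1 indepX mz Lz Ez Ez2 mM k1 kka biasP be0 be1 ka0 sp tp.
  apply: (@op1_le _ _ _ _ 1) => T w T0; rewrite !normrM ler_wpM2r//.
  have Tp : 0 < T%:R :> R by rewrite ltr0n.
  rewrite !gtr0_norm ?invr_gt0 ?sqrtr_gt0// lef_pV2 ?posrE ?sqrtr_gt0//.
  rewrite -[leRHS]sqr_sqrtr ?(ltW Tp)// expr2; apply: ler_peMl; rewrite ?sqrtr_ge0//.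
  by rewrite -[leLHS]sqrtr1 ler_sqrt ?(ltW Tp)// ler1n.
suff B : op1 P (fun T w => T%:R^-1 *
    (\sum_(p.+1 <= t < T.+1) innov X z m T (t - sg) w * innov X z m T (t - ta) w) -
    v * s2 * (sg == ta)%:R).
  by have := op1D A B; congr op1; apply/funext => T; apply/funext => w; ring.
have [E|st] := eqVneq sg ta; last first.
  have := innov_cross_op1 indepX mz Lz Ez Ez2 mM sp tp st.
  by congr op1; apply/funext => T; apply/funext => w; rewrite mulr0 subr0.
rewrite -E => {A E ta tp}.
have cM T t : `|m T (t - sg)%N ^+ 2| <= M ^+ 2.
  by rewrite normrX lerXn2r ?nnegrE// (le_trans _ (mM T (t - sg)%N)).
have A := square_lln indepX idX mz Lz Ez Ez2 cM sp.
have B : op1 P (fun T (_ : Omega) => v * (\sum_(p.+1 <= t < T.+1) m T (t - sg)%N ^+ 2 / T%:R - s2)).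
  apply: op1_cst; rewrite -[X in _ --> X](_ : v * (s2 - s2) = 0); last by rewrite subrr mulr0.
  apply: cvgMr; apply: cvgB; [exact: m2_cvg|exact: cvg_cst].
have := op1D A B; congr op1; apply/funext => T; apply/funext => w.
rewrite mulr1 mulrBr addrA; congr (_ - _).
rewrite -mulr_suml (mulrC _ T%:R^-1) mulrCA -mulrDr; congr (_ * _).
rewrite mulr_sumr -big_split/=; apply: eq_bigr => t _; rewrite /innov; ring.
Qed.

(** Weight of the lagged product of innovations in the leading term of the estimator: the two local
    variances over the limiting diagonal entry of the Gram matrix. *)
Definition lag_coef T (t j : nat) := m T t * m T (t - j.+1)%N / (v * s2).

Lemma lag_coef_bound T t j : `|lag_coef T t j| <= M ^+ 2 / (v * s2).
Proof.
by rewrite normrM normfV (gtr0_norm s2_gt0) ler_pM2r ?invr_gt0// normrM expr2 ler_pM.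
Qed.

Lemma psum_lag_coef T j w : v * s2 * psum X z p T (lag_coef T) T j w = (Num.sqrt T%:R)^-1 *
  \sum_(p.+1 <= t < T.+1) innov X z m T t w * innov X z m T (t - j.+1) w.
Proof.
rewrite /psum !mulr_sumr; apply: eq_bigr => t _; rewrite /incr /lag_coef /innov.
by move: (v * s2) s2_gt0 (Num.sqrt _)^-1 => q q0 sT; field; rewrite gt_eqF.
Qed.

Variable ahat : nat -> 'I_p -> Omega -> R.
Hypothesis normal_eq : forall T w (i : 'I_p), (N0 <= T)%N ->
  \sum_(j < p) gram T i.+1 j.+1 w * ahat T j w = gram T 0 i.+1 w.

(** Outside two small exceptional sets the leading term is bounded and the normalised normal
    equations are close to a multiple of the identity, so that [perturbed_identity] applies
    pointwise. *)
Lemma estimator_op1 (i : 'I_p) :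
  op1 P (fun T w => Num.sqrt T%:R * ahat T i w - psum X z p T (lag_coef T) T i w).
Proof.
pose q := v * s2.
pose W T (i : 'I_p) w := psum X z p T (lag_coef T) T i w.
pose dev T w := \sum_(i < p) (\sum_(j < p) `|T%:R^-1 * gram T i.+1 j.+1 w - q * (i == j)%:R| +
  `|(Num.sqrt T%:R)^-1 * gram T 0 i.+1 w - q * W T i w|).
have odev : op1 P dev.
  apply: op1_sum => l _; apply: op1D.
    by apply: op1_sum => j _; apply: op1_norm; have := gram_op1 (ltn_ord l) (ltn_ord j).
  apply: op1_norm; have := resid_op1 indepX mz Lz Ez Ez2 mM k1 kka biasP be0 be1 ka0 (leq0n p) (ltn_ord l).
  congr op1; apply/funext => T; apply/funext => w; rewrite /W psum_lag_coef -mulrBr.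
  congr (_ * (_ - _)); rewrite /gram; apply: eq_bigr => t _; by rewrite subn0.
have OW : Op1 P (fun T w => \sum_(i < p) `|q * W T i w|).
  have LW T (j : 'I_p) : L2 P (W T j) := L2_psum indepX mz Lz Ez Ez2 T (lag_coef T) (ltn_ord j).
  apply: (@Op1_L1 _ _ _ _ _ (\sum_(i < p) q * Num.sqrt (v ^+ 2 * (M ^+ 2 / q) ^+ 2)) 1) => T T0; split.
    by apply: L1_sum => j _; apply: L1_norm; apply: L1Zl; exact: L2_L1.
  have -> : Ex P (fun w => `|\sum_(i < p) `|q * W T i w| |) = Ex P (fun w => \sum_(i < p) `|q * W T i w|).
    by apply: eq_Ex => w; rewrite ger0_norm//; exact: sumr_ge0.
  rewrite Ex_sum; last by move=> j _; apply: L1_norm; apply: L1Zl; exact: L2_L1.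
  apply: ler_sum => j _.
  have -> : Ex P (fun w => `|q * W T j w|) = Ex P (fun w => q * `|W T j w|).
    by apply: eq_Ex => w; rewrite normrM (gtr0_norm s2_gt0).
  rewrite ExZl; last by apply: L1_norm; exact: L2_L1.
  apply: ler_wpM2l; first exact: ltW.
  apply: Ex_norm_le_sqrt => //; apply: (Ex_psum_sq indepX mz Lz Ez Ez2 (ltn_ord j) T0) => t _.
  exact: lag_coef_bound.
move=> e r e0 r0; have r2 : 0 < r / 2 by lra.
have [B0 [N1 HN1]] := OW _ r2.
pose B := `|B0| + 1; have B1 : 1 <= B by rewrite /B lerDr.
have B0B : B0 <= B by rewrite /B (le_trans (ler_norm _))// lerDl.
pose D := 1 + 2 * (p%:R * (B + 1)) / q.
have p0 : 0 <= p%:R :> R by exact: ler0n.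
have D1 : 1 <= D by rewrite /D lerDl divr_ge0 ?(ltW s2_gt0)// !mulr_ge0//; lra.
have q0 : 0 < q := s2_gt0.
(* The second entry is for the absorption condition of [perturbed_identity], the third for the final
   bound ep D / q <= e; ep <= 1 lets [D] be fixed beforehand. *)
pose ep := Num.min 1 (Num.min (q / (2 * (p%:R + 1))) (e * q / D)).
have ep0 : 0 < ep.
  have p1 : 0 < 2 * (p%:R + 1) :> R by lra.
  by rewrite !lt_min ltr01/=; apply/andP; split; apply: divr_gt0 => //; [exact: mulr_gt0|lra].
have [ep1 ep2 ep3] : [/\ ep <= 1, ep <= q / (2 * (p%:R + 1)) & ep <= e * q / D].
  by rewrite /ep !ge_min !lexx !orbT.
have [N2 HN2] := odev _ _ ep0 r2.
exists (maxn (maxn 1 N0) (maxn N1 N2)) => T; rewrite !geq_max => /andP[/andP[T0 NT] /andP[/HN1[A1 [mA1 PA1 HA1]] /HN2[A2 [mA2 PA2 HA2]]]].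
exists (A1 `|` A2); split; first exact: measurableU.
  rewrite (le_trans (measureU2 _ _ _))// (splitr r) EFinD; exact: leeD.
move=> w /not_orP[/HA1 Ww /HA2 dw].
have Tp : 0 < T%:R :> R by rewrite ltr0n.
have s0 : 0 < Num.sqrt T%:R :> R by rewrite sqrtr_gt0.
have term0 (l : 'I_p) : 0 <= \sum_(j < p) `|T%:R^-1 * gram T l.+1 j.+1 w - q * (l == j)%:R| +
  `|(Num.sqrt T%:R)^-1 * gram T 0 l.+1 w - q * W T l w| by rewrite addr_ge0// sumr_ge0.
have devl (l : 'I_p) : \sum_(j < p) `|T%:R^-1 * gram T l.+1 j.+1 w - q * (l == j)%:R| +
  `|(Num.sqrt T%:R)^-1 * gram T 0 l.+1 w - q * W T l w| <= ep.
  apply: le_trans dw; rewrite /dev [leRHS]ger0_norm; last by apply: sumr_ge0 => j _; exact: term0.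
  by rewrite [leRHS](bigD1 l)//= lerDl; apply: sumr_ge0 => j _; exact: term0.
have Wl (l : 'I_p) : `|q * W T l w| <= B.
  rewrite (le_trans _ B0B)// (le_trans _ Ww)// [leRHS]ger0_norm; last by apply: sumr_ge0.
  by rewrite [leRHS](bigD1 l)//= lerDl sumr_ge0.
have := @perturbed_identity _ p (fun l j => T%:R^-1 * gram T l.+1 j.+1 w)
  (fun l => (Num.sqrt T%:R)^-1 * gram T 0 l.+1 w) (fun l => W T l w)
  (fun l => Num.sqrt T%:R * ahat T l w) q ep B q0 (ltW ep0).
move=> H; apply: (@le_trans _ _ ((ep + ep * (2 * (p%:R * (B + ep)) / q)) / q)).
  apply: H.
  - have : ep * (2 * (p%:R + 1)) <= q by rewrite -ler_pdivlMr//; lra.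
    by have := ltW ep0; lra.
  - move=> l; rewrite -(normal_eq w l NT) mulr_sumr; apply: eq_bigr => j _.
    have -> : T%:R^-1 = (Num.sqrt T%:R)^-1 * (Num.sqrt T%:R)^-1 :> R.
      by rewrite -invfM -expr2 sqr_sqrtr// ltW.
    by move: (gram _ _ _ _) (ahat _ _ _) => u1 u2; field; exact: lt0r_neq0.
  - move=> l j; apply: le_trans (devl l); rewrite (bigD1 j)//= -!addrA lerDl addr_ge0//.
    by apply: sumr_ge0.
  - by move=> l; apply: le_trans (devl l); rewrite lerDr sumr_ge0.
  - exact: Wl.
rewrite ler_pdivrMr//.
have : ep * D <= e * q by rewrite -ler_pdivlMr//; lra.
apply: le_trans; rewrite /D [leRHS]mulrDr mulr1 lerD2l ler_pM2l// ler_pM2r ?invr_gt0//.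
by rewrite ler_pM2l// ler_wpM2l// lerD2l.
Qed.

Hypothesis mahat : forall T i, meas (ahat T i).
Variable s4 : R.
Hypothesis m4_cvg :
  \sum_(p.+1 <= t < T.+1) (m T t) ^+ 4 / T%:R @[T --> \oo] --> s4.
Hypothesis m_lag : exists2 A, 0 <= A & forall T t j, (p < t <= T)%N -> (j < p)%N ->
  `|m T (t - j.+1)%N - m T t| <= A / T%:R.

(** Extended by 0 to all indices, because the test functions take sequences as arguments. *)
Definition scaled_estimator T j w :=
  Num.sqrt T%:R * (if insub j is Some i then ahat T i w else 0).

Lemma measurable_scaled_estimator T j : meas (scaled_estimator T j).
Proof.
apply: measurable_funM => //; case: insub => [i|]; first exact: mahat.
exact: measurable_cst.
Qed.

(** The squared weight of lag j differs from m^4 / (v s2)^2 by O(1/T), as the local variance changes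
    by O(1/T) between t - j - 1 and t; the common variance required by [lag_clt] is therefore
    available. *)
Lemma estimator_clt D (q q1 q2 : nat -> R -> R) : (forall j, TC D (q j) (q1 j) (q2 j)) ->
  Ex P (fun w => \prod_(j < p) q j (scaled_estimator T j w)) @[T --> \oo] -->
  \prod_(j < p) gsm (v * Num.sqrt (s4 / (v * s2) ^+ 2)) (q j) 0.
Proof.
move=> tq; have M0 : 0 <= M by exact: le_trans (normr_ge0 _) (mM 0 0).
have D0 : 0 <= D by exact: le_trans (tc0 (tq 0%N) 0).
have q20 : 0 < (v * s2) ^+ 2 by exact: exprn_gt0.
have [AL AL0 HAL] := m_lag.
have s40 : 0 <= s4.
  rewrite -(cvg_lim _ m4_cvg)//; apply: limr_ge; first by apply/cvg_ex; exists s4; exact: m4_cvg.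
  by near=> T; apply: sumr_ge0 => t _; rewrite divr_ge0// -[4%N]/(2 * 2)%N exprM sqr_ge0.
pose r T t := m T t ^+ 4 / (v * s2) ^+ 2.
pose A0 := M ^+ 2 / (v * s2).
have A00 : 0 <= A0 by rewrite divr_ge0 ?sqr_ge0// ltW.
(* One constant for three demands: a bound on the weights, a bound A^2 on [r], and the O(1/T)
   distance between their squares and [r]. *)
pose A := A0 + 2 * M ^+ 3 * AL / (v * s2) ^+ 2.
have x0 : 0 <= 2 * M ^+ 3 * AL / (v * s2) ^+ 2.
  by rewrite divr_ge0 ?(ltW q20)// !mulr_ge0// exprn_ge0.
have A0A : A0 <= A by rewrite /A lerDl.
have H := @lag_clt _ _ _ P X indepX idX z v mz Lz Ez Ez2 p lag_coef r A D
  (s4 / (v * s2) ^+ 2) q q1 q2.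
have {}H : Ex P (fun w => \prod_(j < p) q j (psum X z p T (lag_coef T) T j w)) @[T --> \oo] -->
    \prod_(j < p) gsm (v * Num.sqrt (s4 / (v * s2) ^+ 2)) (q j) 0.
  apply: H => //.
  - exact: le_trans A0A.
  - by move=> T t j _; rewrite (le_trans (lag_coef_bound _ _ _)).
  - move=> T t _; rewrite /r divr_ge0 ?(ltW q20)//=; last by rewrite -[4%N]/(2 * 2)%N exprM sqr_ge0.
    apply: (@le_trans _ _ (A0 ^+ 2)); last by rewrite lerXn2r ?nnegrE// (le_trans A00).
    rewrite /A0 expr_div_n ler_pM2r ?invr_gt0// -exprM -[(2 * 2)%N]/4%N.
    by rewrite -[leLHS]ger0_norm ?normrX ?lerXn2r ?nnegrE// -[4%N]/(2 * 2)%N exprM sqr_ge0.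
  - move=> T t j tT jp; rewrite /r /lag_coef.
    rewrite (_ : _ - _ = m T t ^+ 2 * (m T (t - j.+1)%N + m T t) * (m T (t - j.+1)%N - m T t) / (v * s2) ^+ 2); last first.
      by move: (v * s2) s2_gt0 => u u0; field; rewrite gt_eqF.
    apply: (@le_trans _ _ (2 * M ^+ 3 * AL / (v * s2) ^+ 2 / T%:R)); last first.
      by rewrite ler_wpM2r ?invr_ge0 ?ler0n// /A lerDr.
    rewrite normrM normfV (gtr0_norm q20) [leRHS]mulrAC ler_pM2r ?invr_gt0//.
    rewrite normrM -[leRHS]mulrA; apply: ler_pM => //; last exact: HAL.
    rewrite normrM (_ : 2 * M ^+ 3 = M ^+ 2 * (M + M)); last by ring.
    by apply: ler_pM => //; [rewrite normrX lerXn2r ?nnegrE|rewrite (le_trans (ler_normD _ _))// lerD].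
  - by rewrite divr_ge0// ltW.
  - rewrite (_ : (fun T => _) =
        (fun T => (\sum_(p.+1 <= t < T.+1) (m T t) ^+ 4 / T%:R) * ((v * s2) ^+ 2)^-1)); last first.
      apply/funext => T; rewrite mulr_suml; apply: eq_bigr => t _; rewrite /r; ring.
    by apply: cvgM; [exact: m4_cvg|exact: cvg_cst].
pose K := Num.max 1 D.
have K1 : 1 <= K by rewrite le_max lexx.
have qK j x : `|q j x| <= K by rewrite (le_trans (tc0 (tq j) x))// le_max lexx orbT.
have mq j : measurable_fun setT (q j) by exact: lip_measurable (tcL0 (tq j)).
have mpsum T (j : 'I_p) : meas (psum X z p T (lag_coef T) T j).
  by have [] := L2_psum indepX mz Lz Ez Ez2 T (lag_coef T) (ltn_ord j).
have PK (u : nat -> R) : `|\prod_(j < p) q j (u j)| <= K ^+ p.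
  rewrite normr_prod -[X in _ ^+ X]card_ord -prodr_const.
  by apply: ler_prod => j _; rewrite normr_ge0 qK.
suff O : op1 P (fun T w => \prod_(j < p) q j (scaled_estimator T j w) -
    \prod_(j < p) q j (psum X z p T (lag_coef T) T j w)).
  have B : Ex P (fun w => \prod_(j < p) q j (scaled_estimator T j w)) -
      Ex P (fun w => \prod_(j < p) q j (psum X z p T (lag_coef T) T j w)) @[T --> \oo] --> 0.
    apply: (@op1_Ex _ _ _ P (fun T w => \prod_(j < p) q j (scaled_estimator T j w))
      (fun T w => \prod_(j < p) q j (psum X z p T (lag_coef T) T j w)) (K ^+ p) 0) => //.
    - move=> T _; apply: measurable_prod => j _; apply: measurableT_comp; first exact: mq.
      exact: measurable_scaled_estimator.
    - move=> T _; apply: measurable_prod => j _; apply: measurableT_comp; first exact: mq.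
      exact: mpsum.
    - by move=> T w; exact: (PK (fun j => scaled_estimator T j w)).
    - by move=> T w; exact: (PK (fun j => psum X z p T (lag_coef T) T j w)).
  have BH := cvgD B H; rewrite add0r in BH.
  apply: cvg_trans (BH _); apply: near_eq_cvg.
  by apply: nearW => T; rewrite /GRing.add/= subrK.
have O : op1 P (fun T w => K ^+ p * D * \sum_(j < p)
    `|Num.sqrt T%:R * ahat T j w - psum X z p T (lag_coef T) T j w|).
  apply: op1M.
    move=> e0 e00; exists (K ^+ p * D), 0%N => n _; exists set0; split=> //.
      by rewrite measure0 lee_fin ltW.
    by move=> w _; rewrite ger0_norm// mulr_ge0// exprn_ge0// (le_trans _ K1).
  by apply: op1_sum => j _; apply: op1_norm; exact: estimator_op1.
apply: op1_le O => T w _.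
rewrite (le_trans (@prod_lip _ K p (fun j => q j (scaled_estimator T j w))
  (fun j => q j (psum X z p T (lag_coef T) T j w)) K1 _ _))//.
rewrite [leRHS]ger0_norm; last by rewrite !mulr_ge0 ?exprn_ge0 ?sumr_ge0//; lra.
rewrite -mulrA; apply: ler_wpM2l; first by rewrite exprn_ge0//; lra.
rewrite mulr_sumr; apply: ler_sum => j _.
rewrite -{1}(subrKC (psum X z p T (lag_coef T) T j w) (scaled_estimator T j w)).
rewrite (le_trans (tcL0 (tq j) _ _))//; apply: ler_wpM2l => //.
by rewrite /scaled_estimator valK.
Unshelve. all: by end_near.
Qed.

End least_squares_limit.

(** * The model under the null hypothesis *)

Section lipschitz_algebra.
Context (R : realType).

Lemma lipM (f g : R -> R) (Lf Lg Mf Mg : R) : lip Lf f -> lip Lg g ->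
  (forall x, `|f x| <= Mf) -> (forall x, `|g x| <= Mg) ->
  lip (Mf * Lg + Lf * Mg) (fun x => f x * g x).
Proof.
move=> lf lg fM gM x h.
rewrite (_ : _ - _ = f (x + h) * (g (x + h) - g x) + (f (x + h) - f x) * g x); last by ring.
rewrite (le_trans (ler_normD _ _))// [leRHS]mulrDl; apply: lerD; rewrite normrM.
  by rewrite -mulrA ler_pM.
by rewrite mulrAC ler_pM.
Qed.

(** Positivity and regularity of a0 are known on [0, 1] only; composition with this projection gives
    a function that is bounded and Lipschitz on the whole line and agrees with a0 there. *)
Definition unit_clamp (u : R) := Num.max 0 (Num.min u 1).

Lemma unit_clamp_itv u : 0 <= unit_clamp u <= 1.
Proof. by rewrite /unit_clamp le_max lexx ge_max ler01 ge_min lexx orbT. Qed.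

Lemma unit_clamp_id u : 0 <= u <= 1 -> unit_clamp u = u.
Proof. by move=> /andP[u0 u1]; rewrite /unit_clamp min_l// max_r. Qed.

Lemma unit_clamp_lip x y : `|unit_clamp y - unit_clamp x| <= `|y - x|.
Proof.
have E u : unit_clamp u = if u <= 0 then 0 else if u <= 1 then u else 1.
  rewrite /unit_clamp; case: (leP u 1) => u1.
    by case: leP.
  by rewrite max_r ?ler01// leNgt (lt_trans ltr01 u1).
rewrite !E; case: (leP y 0) => y0; case: (leP y 1) => y1; case: (leP x 0) => x0;
  case: (leP x 1) => x1; case: (ler0P (y - x)) => yx; rewrite ?ler_norml; lra.
Qed.

Lemma lip_unit_clamp (f : R -> R) : [lipschitz f u | u in `[0, 1]%classic] ->
  exists L, lip L (f \o unit_clamp).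
Proof.
(* The Lipschitz property holds for every constant above [N]; N + 1 is one of them, and the maximum
   with 0 fixes its sign. *)
move=> [N [_ H]]; exists (Num.max (N + 1) 0) => x h.
have /H/= HN : N < N + 1 by rewrite ltrDl.
have := HN (unit_clamp (x + h), unit_clamp x).
rewrite /= !in_itv/= !unit_clamp_itv => /(_ (conj isT isT)) Hf.
rewrite (le_trans Hf)//.
have := unit_clamp_lip x (x + h); rewrite addrAC subrr add0r => Hc.
apply: (@le_trans _ _ (Num.max (N + 1) 0 * `|unit_clamp (x + h) - unit_clamp x|)).
  by apply: ler_wpM2r; rewrite ?le_max ?lexx.
by apply: ler_wpM2l; rewrite ?le_max ?lexx ?orbT.
Qed.

End lipschitz_algebra.

Section moments.
Context (R : realType) (d : measure_display) (Omega : measurableType d)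
  (P : probability Omega R).

Lemma variance_Ex (f : Omega -> R) : L1 P f ->
  fine 'V_P[f] = Ex P (fun w => (f w - Ex P f) ^+ 2).
Proof.
move=> lf; rewrite /variance covariance.unlock.
have Ef : fine ('E_P[f])%E = Ex P f by rewrite expectation_Ex.
by rewrite Ef expectation_Ex.
Qed.

(** Domination by 1 + |f|^(4 (1 + de)), according to whether |f| <= 1. *)
Lemma L1_pow4 (f : Omega -> R) (de : R) : meas f -> 0 < de ->
  ('E_P[(fun w => (`|f w| `^ (4 * (1 + de)))%R)] < +oo)%E -> L1 P (fun w => f w ^+ 4).
Proof.
move=> mf de0; rewrite expectation_Ex => fin.
have mg : meas (fun w => `|f w| `^ (4 * (1 + de))).
  apply: (@measurableT_comp _ _ _ _ _ _ (fun x : R => x `^ (4 * (1 + de)))) => //.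
  exact: measurableT_comp.
have lg : L1 P (fun w => `|f w| `^ (4 * (1 + de))).
  apply/integrableP; split; first exact/measurable_EFinP.
  apply: le_lt_trans fin; rewrite le_eqVlt; apply/orP; left; apply/eqP.
  by apply: eq_integral => w _ /=; rewrite ger0_norm ?powR_ge0.
apply: (L1_le _ (L1D (L1_cst P 1) lg)); first exact: measurable_funX.
move=> w; rewrite normrX; have [f1|/ltW f1] := leP `|f w| 1.
  by rewrite (le_trans (exprn_ile1 _ _ _))// lerDl powR_ge0.
rewrite -powR_mulrn// -[leLHS]add0r lerD// ler_powR//; lra.
Qed.

End moments.

Section arch_variables.
Context (R : realType) (d : measure_display) (Omega : measurableType d)
  (P : probability Omega R) (xi : int -> {RV P >-> R}) (delta : R).
Hypothesis iidxi : iid P xi.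
Hypothesis Exi : forall t, ('E_P[xi t] = 0)%E.
Hypothesis Vxi : forall t, ('V_P[xi t] = 1)%E.
Hypothesis delta0 : 0 < delta.
Hypothesis momxi : ('E_P[(fun w => (`|xi 1%Z w| `^ (4 * (1 + delta)))%R)] < +oo)%E.

Definition centered_sq (x : R) := x ^+ 2 - 1.

Lemma measurable_centered_sq : measurable_fun setT centered_sq.
Proof. by apply: measurable_funB => //; exact: measurable_funX. Qed.

Lemma L2_xi_sq t : L2 P (fun w => xi t w ^+ 2).
Proof.
apply: (@L2_id _ _ _ _ _ xi iidxi.2 1%Z t (fun x => x ^+ 2)); first exact: measurable_funX.
split; first by apply: measurable_funX.
have := L1_pow4 (measurable_funPT _) delta0 momxi.
by congr L1; apply/funext => w; rewrite -exprM.
Qed.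

Lemma L2_xi t : L2 P (xi t).
Proof. by split; [exact: measurable_funPT|exact: L2_L1 (L2_xi_sq t)]. Qed.

Lemma Ex_xi_sq t : Ex P (fun w => xi t w ^+ 2) = 1.
Proof.
have E0 : Ex P (xi t) = 0 by have := Exi t; rewrite expectation_Ex => E; rewrite /Ex /Rintegral E.
have := variance_Ex (L2_L1 (L2_xi t)); rewrite Vxi E0 /= => ->.
by apply: eq_Ex => w; rewrite subr0.
Qed.

Lemma L2_centered_sq t : L2 P (centered_sq \o xi t).
Proof. exact: L2B (L2_xi_sq t) (L2_cst P 1). Qed.

Lemma Ex_centered_sq t : Ex P (centered_sq \o xi t) = 0.
Proof.
by rewrite (ExB (L2_L1 (L2_xi_sq t)) (L1_cst P 1)) Ex_xi_sq Ex_cst subrr.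
Qed.

Lemma var_scaled_sq t (c : R) :
  fine 'V_P[fun w => c * xi t w ^+ 2] = c ^+ 2 * Ex P (fun w => centered_sq (xi t w) ^+ 2).
Proof.
rewrite variance_Ex; last by apply: L1Zl; exact: L2_L1 (L2_xi_sq t).
rewrite ExZl; last exact: L2_L1 (L2_xi_sq t).
rewrite Ex_xi_sq -ExZl; last exact: L1_sqr (L2_centered_sq t).
by apply: eq_Ex => w; rewrite /centered_sq; ring.
Qed.

Lemma Ex_centered_sq_sq t s : Ex P (fun w => centered_sq (xi t w) ^+ 2) = Ex P (fun w => centered_sq (xi s w) ^+ 2).
Proof.
apply: (@Ex_id _ _ _ _ _ xi iidxi.2 t s (fun x => centered_sq x ^+ 2)).
  by apply: measurable_funX; exact: measurable_centered_sq.
exact: L1_sqr (L2_centered_sq t).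
Qed.

Lemma indep_nat : mutually_independent P (fun n : nat => xi n%:Z).
Proof.
move=> s B us mB.
have := iidxi.1 (map Posz s) (fun i => B `|i|%N) _ (fun i => mB `|i|%N).
rewrite !big_map; apply.
by rewrite map_inj_uniq// => i j [].
Qed.

Lemma id_nat : identically_distributed P (fun n : nat => xi n%:Z).
Proof. by move=> i j B mB; exact: iidxi.2. Qed.

End arch_variables.

Lemma sqpos_scale (R : realType) (p : nat) (c : R) (x : 'I_p -> R) : 0 <= c ->
  sqpos p (fun j => c * (if insub j is Some i then x i else 0)) =
  c ^+ 2 * \sum_(j < p) Num.max (x j) 0 ^+ 2.
Proof.
move=> c0; rewrite /sqpos mulr_sumr; apply: eq_bigr => j _.
by rewrite valK /pos -exprMn maxr_pMr// mulr0.
Qed.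

(** As the weights sum to 1, the local variance at [t] can be written as their average and
    subtracted inside the kernel sum, which isolates the bias. *)
Lemma resid_d_hat (R : realType) (d : measure_display) (Omega : measurableType d)
    (P : probability Omega R) (X : nat -> {RV P >-> R}) (K : R -> R) (p T : nat) (b : nat -> R)
    (m : nat -> nat -> R) (x : int -> R) (w : Omega) (t : nat) :
  (forall s : nat, (0 < s <= T)%N -> x s%:Z ^+ 2 = m T s * X s w ^+ 2) -> (0 < t <= T)%N ->
  \sum_(p.+1 <= i < T.+1) kernel_weight K p T (b T) t%:Z i%:Z = 1 ->
  x t%:Z ^+ 2 - d_hat K p T (b T) x t%:Z =
  resid X (@centered_sq R) m (fun T t i => kernel_weight K p T (b T) t%:Z i%:Z) p T t w.
Proof.
move=> xm tT k1; rewrite xm// /resid /drift /noise /bias /innov /centered_sq /d_hat.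
have -> : \sum_(p.+1 <= i < T.+1) kernel_weight K p T (b T) t i * x i ^+ 2 =
    \sum_(p.+1 <= i < T.+1) (kernel_weight K p T (b T) t i * (m T i - m T t) +
    kernel_weight K p T (b T) t i * (m T i * (X i w ^+ 2 - 1)) +
    kernel_weight K p T (b T) t i * m T t).
  rewrite big_nat [RHS]big_nat; apply: eq_bigr => i /andP[pi iT].
  by rewrite xm; [ring|rewrite (leq_ltn_trans _ pi)//= -ltnS].
rewrite !big_split/= -mulr_suml k1; ring.
Qed.

Theorem proposition3 (R : realType)
    (d : measure_display) (Omega : measurableType d) (P : probability Omega R)
    (d' : measure_display) (Omega' : measurableType d')
    (P' : probability Omega' R)
    (p : nat) (xi : int -> {RV P >-> R})
    (a0 : R -> R) (a : 'I_p -> R)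
    (X : nat -> int -> Omega -> R) (Xu : R -> int -> {RV P >-> R})
    (K : R -> R) (b : nat -> R) (delta h c C : R)
    (ahat : nat -> 'I_p -> {RV P >-> R}) (Z : 'I_p -> {RV P' >-> R}) :
  (1 <= p)%N ->
  iid P xi ->
  (forall t, ('E_P[xi t] = 0)%E) ->
  (forall t, ('V_P[xi t] = 1)%E) ->
  (forall u, 0 <= u <= 1 -> 0 < a0 u) ->
  [lipschitz a0 u | u in `[0, 1]%classic] ->
  (forall j, 0 <= a j) ->
  \sum_(j < p) a j < 1 ->
  tvARCH a0 a xi X ->
  (forall u, 0 <= u <= 1 -> stationary_ARCH P (a0 u) a xi (Xu u)) ->
  smoothing_kernel K ->
  0 < delta < 1 ->
  ('E_P[(fun w => (`|xi 1%Z w| `^ (4 * (1 + delta)))%R)] < +oo)%E ->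
  0 < c -> 0 < C ->
  4^-1 < h < 3 / 4 - (2 * (1 + delta))^-1 ->
  (forall T : nat, (p < T)%N ->
    c * T%:R `^ (- h) <= b T <= C * T%:R `^ (- h)) ->
  (* the denominator of sigma2 does not vanish *)
  \int[lebesgue_measure]_(u in `[0, 1]) (var_sq P Xu u) != 0 ->
  (* null hypothesis *)
  (forall j, a j = 0) ->
  (forall (T : nat) (w : Omega), (p < T)%N ->
    ls_argmin K T (b T) (fun t => X T t w) (fun j => ahat T j w)) ->
  standard_gaussian_vector P' Z ->
  cvg_in_distribution P P'
    (fun T : nat => scaled_pos_sqnorm T%:R (ahat T))
    (scaled_pos_sqnorm (sigma2 P Xu) Z).
Proof.
move=> _ iidxi Exi Vxi a0_gt0 lipa _ _ arch stat sK /andP[delta0 delta1] mom c0 C0 /andP[h14 h34]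
  bP den0 aj0 amin gaussZ.
(* As delta < 1, the upper bound on h is less than 3/4 - 1/4. *)
have h12 : h < 2^-1.
  have : 4^-1 < (2 * (1 + delta))^-1 by rewrite ltf_pV2 ?posrE; lra.
  lra.
have [L lipA] := lip_unit_clamp lipa; pose A u := a0 (unit_clamp u).
have L0 : 0 <= L by have := lipA 0 1; rewrite normr1 mulr1; apply: le_trans.
pose M := `|A 0| + L.
have AM u : `|A u| <= M.
  have [v1 v2] := (unit_clamp_itv u, unit_clamp_id (unit_clamp_itv u)).
  rewrite /M -(subrKC (A 0) (A u)) (le_trans (ler_normD _ _))// lerD2l.
  rewrite /A -[in X in a0 X - _]v2; have := lipA 0 (unit_clamp u); rewrite add0r => /le_trans; apply.
  by rewrite ler_piMr// ger0_norm; case/andP: v1.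
have M0 : 0 <= M by exact: le_trans (normr_ge0 _) (AM 0).
have AE u : 0 <= u <= 1 -> A u = a0 u by move=> u01; rewrite /A unit_clamp_id.
pose m (T t : nat) := A (t%:R / T%:R).
have mM T t : `|m T t| <= M by exact: AM.
have mlip T (s t : nat) : (0 < T)%N -> `|m T s - m T t| <= L * (`|s%:R - t%:R| / T%:R).
  move=> T0; rewrite /m -[s%:R / _](subrKC (t%:R / T%:R)) (le_trans (lipA _ _))//.
  by rewrite -mulrBl normrM normfV [`|T%:R|]ger0_norm.
pose v := Ex P (fun w => centered_sq (xi 0 w) ^+ 2).
have v0 : 0 <= v by exact: Ex_sqr_ge0.
pose Xn (n : nat) := xi n%:Z.
have Lz t := L2_centered_sq iidxi delta0 mom (Posz t).
have Ez t := Ex_centered_sq iidxi Exi Vxi delta0 mom (Posz t).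
have Ez2 t := Ex_centered_sq_sq iidxi delta0 mom (Posz t) 0.
pose k (T t i : nat) := kernel_weight K p T (b T) t%:Z i%:Z.
have [Ck Ck0 [N N1 HK]] := kernel_weights sK p.
pose ka T := Ck / (T%:R * b T); pose be T := L * b T.
have [N0 HN0] : exists N0 : nat, forall T, (N0 <= T)%N ->
    [/\ (p < T)%N, N <= T%:R * b T, b T <= 4^-1 & N <= T%:R].
  have h4 : 0 < 4^-1 :> R by lra.
  have Hb := bandwidth_cvg0 c0 h14 h12 bP; have Hi := bandwidth_infty c0 h14 h12 bP N.
  have [N0 _ H] : \forall T \near \oo, [/\ (p < T)%N, N <= T%:R * b T, b T <= 4^-1 & N <= T%:R].
    near=> T; split.
    - by near: T; exact: nbhs_infty_gt.
    - by near: T.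
    - by near: T; move/cvgr_le : Hb => /(_ _ h4).
    - near: T; exists (Num.truncn N).+1 => // T /= NT.
      by rewrite (le_trans (ltW (truncnS_gt _)))// ler_nat.
  by exists N0 => T; exact: H.
have pos_of T : (p < T)%N -> (0 < T)%N by exact: leq_ltn_trans.
have k1 T t : (N0 <= T)%N -> (t <= T)%N -> \sum_(p.+1 <= i < T.+1) k T t i = 1.
  by move=> /HN0[pT H1 H2 H3] tT; have [] := HK T t (b T) (pos_of _ pT) H1 H2 H3 tT.
have kka T t i : (N0 <= T)%N -> (t <= T)%N -> 0 <= k T t i <= ka T.
  by move=> /HN0[pT H1 H2 H3] tT; have [_ H _] := HK T t (b T) (pos_of _ pT) H1 H2 H3 tT; exact: H.
have biasP T t : (N0 <= T)%N -> (t <= T)%N -> `|bias m k p T t| <= be T.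
  move=> NT tT; have [pT H1 H2 H3] := HN0 _ NT.
  have [_ _ H] := HK T t (b T) (pos_of _ pT) H1 H2 H3 tT.
  have Tp : 0 < T%:R :> R by rewrite ltr0n pos_of.
  (* Weights with |t - i| > T b vanish; for the others the local variance changes by at most L b,
     and the weights sum to 1. *)
  rewrite /bias (le_trans (ler_norm_sum _ _ _))// -[leRHS]mul1r -(k1 T t NT tT) mulr_suml.
  apply: ler_sum => i _; have /andP[ki0 _] := kka T t i NT tT.
  rewrite normrM (ger0_norm ki0).
  have [far|near] := ltP (T%:R * b T) `|t%:R - i%:R|; first by rewrite /k (H _ far) !mul0r.
  apply: ler_wpM2l => //; rewrite (le_trans (mlip _ _ _ (pos_of _ pT)))//.
  by apply: ler_wpM2l => //; rewrite ler_pdivrMr// distrC mulrC.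
have be0 : Num.sqrt T%:R * be T ^+ 2 @[T --> \oo] --> 0.
  have E : (fun T : nat => Num.sqrt T%:R * be T ^+ 2) =
      (fun T : nat => L ^+ 2 * (Num.sqrt T%:R * b T ^+ 2)).
    by apply/funext => T; rewrite /be exprMn mulrCA.
  rewrite E -[X in _ --> X](mulr0 (L ^+ 2)).
  by apply: cvgMr; exact: sqrt_bandwidth_sq_cvg0 c0 C0 h14 h12 bP.
have be1 : be @ \oo --> 0.
  by rewrite -[X in _ --> X](mulr0 L); apply: cvgMr; exact: bandwidth_cvg0 c0 h14 h12 bP.
have ka0 : Num.sqrt T%:R * ka T @[T --> \oo] --> 0.
  have E : (fun T : nat => Num.sqrt T%:R * ka T) =
      (fun T : nat => Ck * (Num.sqrt T%:R * b T)^-1).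
    apply/funext => T; rewrite /ka mulrCA; congr (_ * _).
    (* At T = 0 both sides are 0, by the convention on the inverse of 0. *)
    case: T => [|T]; first by rewrite sqrtr0 !mul0r invr0.
    rewrite !invfM mulrA; congr (_ * _).
    rewrite -{2}(sqr_sqrtr (ler0n R T.+1)) expr2 invfM mulrA.
    by rewrite mulfV ?mul1r// gt_eqF// sqrtr_gt0 ltr0n.
  rewrite E -[X in _ --> X](mulr0 Ck).
  by apply: cvgMr; exact: inv_sqrt_bandwidth_cvg0 c0 h14 h12 bP.
pose A2 u := A u * A u; pose A4 u := A2 u * A2 u.
have lipA2 : lip (M * L + L * M) A2 := lipM lipA lipA AM AM.
have A2M u : `|A2 u| <= M * M by rewrite normrM ler_pM.
have lipA4 := lipM lipA2 lipA2 A2M A2M.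
have A4M u : `|A4 u| <= M * M * (M * M) by rewrite normrM ler_pM.
pose s2 := \int[lebesgue_measure]_(u in `[0, 1]) A2 u.
pose s4 := \int[lebesgue_measure]_(u in `[0, 1]) A4 u.
have m2_cvg sg : (sg <= p)%N ->
    \sum_(p.+1 <= t < T.+1) m T (t - sg)%N ^+ 2 / T%:R @[T --> \oo] --> s2.
  move=> sp; apply: (riemann_sum_cvg (phi := A2) lipA2 (p := p) (M := M * M)
    (s := fun T t => (t - sg)%N%:R / T%:R)) => // T t tT.
  rewrite -mulrBl normrM [`|_^-1|]ger0_norm ?invr_ge0// ler_wpM2r ?invr_ge0//.
  have [ts|/ltnW ts] := leqP sg t.
    by rewrite natrB// addrAC subrr add0r normrN normr_nat ler_nat.
  by rewrite (eqP ts) sub0r normrN normr_nat ler_nat (leq_trans ts).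
have m4_cvg : \sum_(p.+1 <= t < T.+1) m T t ^+ 4 / T%:R @[T --> \oo] --> s4.
  have := riemann_sum_cvg (phi := A4) lipA4 (p := p) (M := M * M * (M * M))
    (s := fun T t => t%:R / T%:R); rewrite -/s4 => H.
  have {}H := H (fun u _ => A4M u); apply: cvg_trans (H _) => [|T t _]; last first.
    by rewrite subrr normr0 divr_ge0.
  apply: near_eq_cvg; near=> T; apply: eq_bigr => t _; congr (_ / _).
  by rewrite /A4 /A2 /m; ring.
have VE u : u \in `[0, 1]%classic -> var_sq P Xu u = v * A2 u.
  rewrite inE/= in_itv/= => u01; have [_ XE] := stat _ u01.
  rewrite /var_sq /A2 !AE//.
  have -> : (fun w => Xu u 0 w ^+ 2) = (fun w => a0 u * xi 0 w ^+ 2).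
    apply/funext => w; rewrite XE big1 ?addr0; last by move=> j _; rewrite aj0 mul0r.
    by rewrite exprMn sqr_sqrtr ?(ltW (a0_gt0 _ u01))// mulrC.
  by rewrite (var_scaled_sq iidxi Exi Vxi delta0 mom) -/v expr2 mulrC.
have int_A2 : lebesgue_measure.-integrable `[0, 1] (EFin \o A2).
  by apply: (@integrable_continuous _ _ _ 0 1) => //; exact: lip_continuous lipA2.
have int_A4 : lebesgue_measure.-integrable `[0, 1] (EFin \o A4).
  by apply: (@integrable_continuous _ _ _ 0 1) => //; exact: lip_continuous lipA4.
have I2 : \int[lebesgue_measure]_(u in `[0, 1]) var_sq P Xu u = v * s2.
  by rewrite -RintegralZl//; apply: eq_Rintegral => u u01; rewrite VE.
have I4 : \int[lebesgue_measure]_(u in `[0, 1]) (var_sq P Xu u ^+ 2) = v ^+ 2 * s4.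
  rewrite -RintegralZl//; apply: eq_Rintegral => u u01; rewrite VE// /A4; ring.
have s20 : 0 <= s2 by apply: Rintegral_ge0 => // u _; rewrite /A2 -expr2 sqr_ge0.
have s40 : 0 <= s4 by apply: Rintegral_ge0 => // u _; rewrite /A4 -expr2 sqr_ge0.
(* v s2 is the integral of the variance, nonnegative here and nonzero by assumption. *)
have vs2 : 0 < v * s2.
  by rewrite lt_neqAle mulr_ge0// andbT eq_sym -I2.
(* Limiting standard deviation of each coordinate of the rescaled estimator; its square is the ratio
   of v^2 s4 to (v s2)^2. *)
pose sig := v * Num.sqrt (s4 / (v * s2) ^+ 2).
have sig0 : 0 <= sig by rewrite mulr_ge0// sqrtr_ge0.
have sig2 : sig ^+ 2 = sigma2 P Xu.
  rewrite /sig exprMn sqr_sqrtr ?divr_ge0 ?(ltW (exprn_gt0 _ vs2))//.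
  by rewrite /sigma2 I2 I4 mulrA.
have m_lag : exists2 B, 0 <= B & forall T t j, (p < t <= T)%N -> (j < p)%N ->
    `|m T (t - j.+1)%N - m T t| <= B / T%:R.
  exists (L * p%:R); first by rewrite mulr_ge0.
  move=> T t j /andP[pt tT] jp.
  have T0 : (0 < T)%N by exact: leq_trans (leq_ltn_trans (leq0n p) pt) tT.
  rewrite (le_trans (mlip _ _ _ T0))//.
  rewrite -mulrA ler_wpM2l// ler_wpM2r ?invr_ge0//.
  rewrite natrB; last by rewrite (leq_trans jp)// ltnW.
  by rewrite addrAC subrr add0r normrN normr_nat ler_nat.
have xm T w (s : nat) : (p < T)%N -> (0 < s <= T)%N -> X T s%:Z w ^+ 2 = m T s * Xn s w ^+ 2.
  move=> pT sT; have T0 : 0 < T%:R :> R by rewrite ltr0n pos_of.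
  rewrite arch//.
  rewrite big1 ?addr0; last by move=> j _; rewrite aj0 mul0r.
  have st : 0 <= (s%:R / T%:R : R) <= 1.
    by rewrite divr_ge0//= ler_pdivrMr// mul1r ler_nat; case/andP: sT.
  by rewrite /m AE// exprMn sqr_sqrtr ?(ltW (a0_gt0 _ st))// mulrC.
have normal_eq T w (i : 'I_p) : (N0 <= T)%N ->
    \sum_(j < p) gram Xn (@centered_sq R) m k p T i.+1 j.+1 w * ahat T j w =
    gram Xn (@centered_sq R) m k p T 0 i.+1 w.
  move=> NT; have [pT _ _ _] := HN0 _ NT.
  have e_res t : (0 < t <= T)%N ->
      X T t%:Z w ^+ 2 - d_hat K p T (b T) (fun t => X T t w) t%:Z = resid Xn (@centered_sq R) m k p T t w.
    move=> tT; apply: resid_d_hat => //; last by apply: k1 => //; case/andP: tT.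
    by move=> s sT; exact: xm.
  have lossE (a' : 'I_p -> R) : ls_loss K T (b T) (fun t => X T t w) a' =
      \sum_(p.+1 <= t < T.+1) (resid Xn (@centered_sq R) m k p T t w -
        \sum_(j < p) a' j * resid Xn (@centered_sq R) m k p T (t - j.+1) w) ^+ 2.
    rewrite /ls_loss big_nat [RHS]big_nat; apply: eq_bigr => t /andP[pt tT].
    congr ((_ - _) ^+ 2); first by apply: e_res; rewrite (leq_ltn_trans _ pt).
    apply: eq_bigr => j _; congr (_ * _).
    (* Since j < p < t, every lagged index lies between 1 and T, where the equation of the model is
       available. *)
    have jt : (j.+1 < t)%N by rewrite (leq_ltn_trans (ltn_ord j)).
    have -> : t%:Z - j.+1%:Z = (t - j.+1)%N%:Z by rewrite subzn// ltnW.
    by apply: e_res; rewrite subn_gt0 jt (leq_trans (leq_subr _ _)).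
  have := @normal_equations R p (index_iota p.+1 T.+1) (fun t => resid Xn (@centered_sq R) m k p T t w)
    (fun t j => resid Xn (@centered_sq R) m k p T (t - j.+1) w) (fun j => ahat T j w).
  rewrite /gram => ->; first by apply: eq_bigr => t _; rewrite subn0.
  by move=> a'; rewrite -!lossE; exact: amin.
have mahat T i : meas (ahat T i) by exact: measurable_funPT.
pose y j w := sig * (if insub j is Some i then Z i w else 0).
have my j : meas (y j).
  apply: measurable_funM => //; case: insub => [i|]; first exact: measurable_funPT.
  exact: measurable_cst.
apply: (@sqpos_cvg R p d Omega P d' Omega' P'
  (scaled_estimator (fun T i w => ahat T i w)) y) => //.
- by move=> T j; apply: measurable_scaled_estimator.
- move=> D q q1 q2 tq.
  have -> : Ex P' (fun w => \prod_(j < p) q j (y j w)) = \prod_(j < p) gsm sig (q j) 0.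
    rewrite -(Ex_prod_gauss gaussZ sig tq); apply: eq_Ex => w.
    by apply: eq_bigr => j _; rewrite /y valK.
  exact: (estimator_clt (indep_nat iidxi) (id_nat iidxi) (@measurable_centered_sq R) Lz Ez Ez2
    mM k1 kka biasP be0 be1 ka0 vs2 m2_cvg normal_eq mahat m4_cvg m_lag tq).
- by move=> T w; rewrite [RHS]sqpos_scale ?sqrtr_ge0// sqr_sqrtr.
- by move=> w; rewrite [RHS]sqpos_scale// sig2.
Unshelve. all: by end_near.
Qed.
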